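(* The braided Lie algebra $\mathrm{aut}_{\mathcal O(S^4_\theta)}(\mathcal O(SO_\theta(5,\mathbb R)))$ of infinitesimal gauge transformations of the $\mathcal O(SO_\theta(4,\mathbb R))$-Hopf--Galois extension $\mathcal O(S^4_\theta)\subset\mathcal O(SO_\theta(5,\mathbb R))$ is generated, as an $\mathcal O(S^4_\theta)$-module, by the elements $$\widetilde K_j:=\mathcal D(K_j),\qquad\widetilde W_{\mathsf r}:=\mathcal D(W_{\mathsf r}),\qquad j=1,2,\ \mathsf r\in\Gamma,$$ with bracket $$[\widetilde K_1,\widetilde K_2]_{\mathsf R_{\mathsf F}}=\mathcal D([K_1,K_2]),\quad[\widetilde K_j,\widetilde W_{\mathsf r}]_{\mathsf R_{\mathsf F}}=\mathcal D([K_j,W_{\mathsf r}]),\quad[\widetilde W_{\mathsf r},\widetilde W_{\mathsf s}]_{\mathsf R_{\mathsf F}}=e^{-i\pi\theta\,\mathsf r\wedge\mathsf s}\,\mathcal D([W_{\mathsf r},W_{\mathsf s}]).$$ The braided Lie bracket of generic elements of $\mathrm{aut}_{\mathcal O(S^4_\theta)}(\mathcal O(SO_\theta(5,\mathbb R)))$ is given by $$[b\bullet_\theta\widetilde X,\ b'\bullet_\theta\widetilde X']_{\mathsf R_{\mathsf F}}=b\bullet_\theta(\mathsf R_{\mathsf F\,\alpha}\triangleright b')\bullet_\theta[\mathsf R_{\mathsf F}^{\ \alpha}\triangleright\widetilde X,\widetilde X']_{\mathsf R_{\mathsf F}}$$ for $b,b'\in\mathcal O(S^4_\theta)$ and $\widetilde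 X,\widetilde X'$ in the linear span of the generators $\widetilde K_j,\widetilde W_{\mathsf r}$.
   Context: **Classical bundle.** On indices put $1'=3,2'=4,3'=1,4'=2,5'=5$. $\mathcal O(SO(5,\mathbb R))$ is the commutative complex $*$-Hopf algebra generated by the entries of $N=(n_{JL})_{J,L=1}^5$ with $N^tQN=Q=NQN^t$, $\det N=1$, where $Q=\begin{pmatrix}0&I_2&0\\ I_2&0&0\\0&0&1\end{pmatrix}$, $(n_{JL})^*=n_{J'L'}$, matrix coproduct. $\mathcal O(SO(4,\mathbb R))$ is defined likewise with $M=(m_{JL})_{J,L=1}^4$ and $Q=\begin{pmatrix}0&I_2\\ I_2&0\end{pmatrix}$. The coaction of $\mathcal O(SO(4,\mathbb R))$ on $\mathcal O(SO(5,\mathbb R))$ is $\delta(N)=N\dot\otimes\begin{pmatrix}M&0\\0&1\end{pmatrix}$ (tensor product combined with matrix multiplication). The coinvariants form $\mathcal O(S^4)$, generated by $u_j=n_{j5}$ ($j=1,\dots,4$; $u_3=u_1^*$, $u_4=u_2^*$) and $x=n_{55}$, with $2(u_1^*u_1+u_2^*u_2)+x^2=1$. With $\partial_{IJ}$ the partial derivative with respect to $n_{IJ}$, and summation over $K=1,\dots,5$, define derivations of $\mathcal O(SO(5,\mathbb R))$: $H_1=n_{1K}\partial_{1K}-n_{3K}\partial_{3K}$, $H_2=n_{2K}\partial_{2K}-n_{4K}\partial_{4K}$, $E_{10}=n_{5K}\partial_{3K}-n_{1K}\partial_{5K}$, $E_{-10}=n_{3K}\partial_{5K}-n_{5K}\partial_{1K}$,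 $E_{01}=n_{5K}\partial_{4K}-n_{2K}\partial_{5K}$, $E_{0-1}=n_{4K}\partial_{5K}-n_{5K}\partial_{2K}$, $E_{11}=n_{2K}\partial_{3K}-n_{1K}\partial_{4K}$, $E_{-1-1}=n_{3K}\partial_{2K}-n_{4K}\partial_{1K}$, $E_{1-1}=n_{4K}\partial_{3K}-n_{1K}\partial_{2K}$, $E_{-11}=n_{3K}\partial_{4K}-n_{2K}\partial_{1K}$. $\Gamma=\{(\pm1,0),(0,\pm1),(\pm1,\pm1)\}$. Define $K_1=xH_2+u_2^*E_{01}+u_2E_{0-1}$, $K_2=xH_1+u_1^*E_{10}+u_1E_{-10}$, $W_{01}=u_2H_1+u_1^*E_{11}+u_1E_{-11}$, $W_{0-1}=u_2^*H_1+u_1^*E_{1-1}+u_1E_{-1-1}$, $W_{10}=u_1H_2-u_2^*E_{11}+u_2E_{1-1}$, $W_{-10}=u_1^*H_2+u_2^*E_{-11}-u_2E_{-1-1}$, $W_{11}=xE_{11}+u_1E_{01}-u_2E_{10}$, $W_{-1-1}=xE_{-1-1}+u_1^*E_{0-1}-u_2^*E_{-10}$, $W_{1-1}=-xE_{1-1}+u_2^*E_{10}+u_1E_{0-1}$, $W_{-11}=-xE_{-11}+u_2E_{-10}+u_1^*E_{01}$. **Twist.** $\theta\in\mathbb R$; $\mathsf r\wedge\mathsf s:=r_1s_2-r_2s_1$. Put $\mathrm{wt}(1)=(1,0)$, $\mathrm{wt}(2)=(0,1)$, $\mathrm{wt}(3)=(-1,0)$, $\mathrm{wt}(4)=(0,-1)$,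 $\mathrm{wt}(5)=(0,0)$; $n_{IJ}$ has left weight $\mathrm{wt}(I)$ and right weight $\mathrm{wt}(J)$, weights being additive on products (the left weight $\mathsf s$ of $a$ is given by $H_ja=s_ja$). $\mathcal O(SO_\theta(5,\mathbb R))$ is the vector space $\mathcal O(SO(5,\mathbb R))$ with product $a\bullet_\theta a'=e^{-i\pi\theta\,\mathsf s\wedge\mathsf m}\,e^{i\pi\theta\,\mathsf s'\wedge\mathsf m'}\,aa'$ for $a,a'$ of left weights $\mathsf s,\mathsf m$ and right weights $\mathsf s',\mathsf m'$; unchanged coalgebra structure. $\mathcal O(SO_\theta(4,\mathbb R))$ is obtained in the same way from $\mathcal O(SO(4,\mathbb R))$. The coaction $\delta$ is unchanged as a linear map, and its coinvariant subalgebra $\mathcal O(S^4_\theta)$ is the vector space $\mathcal O(S^4)$ with product $\bullet_\theta$. $K$ is the universal enveloping algebra of the abelian Lie algebra spanned by $H_1,H_2$, with twist $\mathsf F=e^{\pi i\theta(H_1\otimes H_2-H_2\otimes H_1)}$ and $R$-matrix $\mathsf R_{\mathsf F}=\mathsf F^{-2}=\mathsf R_{\mathsf F}^{\ \alpha}\otimes\mathsf R_{\mathsf F\,\alpha}$ (always applied to weight vectors). $K$ acts on linear maps by $H_j\triangleright\psi=[H_j,\psi]$; $\psi$ has weight $\mathsf r$ if $[H_j,\psi]=r_j\psi$. So $(\mathsf R_{\mathsf F\,\alpha}\triangleright b)\otimes(\mathsf R_{\mathsf F}^{\ \alpha}\triangleright\psi)=e^{-2\pi i\theta\,\mathsf r\wedge\mathsf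 s}\,b\otimes\psi$ for $\psi$ of weight $\mathsf r$, $b$ of left weight $\mathsf s$. A braided derivation is a linear map with $\psi(a\bullet_\theta a')=\psi(a)\bullet_\theta a'+(\mathsf R_{\mathsf F\,\alpha}\triangleright a)\bullet_\theta(\mathsf R_{\mathsf F}^{\ \alpha}\triangleright\psi)(a')$. $\mathrm{aut}_{\mathcal O(S^4_\theta)}(\mathcal O(SO_\theta(5,\mathbb R)))$ is the space of braided derivations $\psi$ of $\mathcal O(SO_\theta(5,\mathbb R))$ with $\delta\circ\psi=(\psi\otimes\mathrm{id})\circ\delta$ and $\psi|_{\mathcal O(S^4_\theta)}=0$, with module structure $(b\bullet_\theta\psi)(a)=b\bullet_\theta\psi(a)$ and bracket $[\psi,\lambda]_{\mathsf R_{\mathsf F}}=\psi\circ\lambda-(\mathsf R_{\mathsf F\,\alpha}\triangleright\lambda)\circ(\mathsf R_{\mathsf F}^{\ \alpha}\triangleright\psi)$. For an equivariant derivation $X$ of $\mathcal O(SO(5,\mathbb R))$ of weight $\mathsf r$, $\mathcal D(X)(a)=e^{-i\pi\theta\,\mathsf r\wedge\mathsf s}X(a)$ for $a$ of left weight $\mathsf s$, extended linearly in $X$. $K_j$ has weight $0$, $W_{\mathsf r}$ weight $\mathsf r$; $[\ ,\ ]$ is the ordinary commutator. *)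

(* Defs.v *)
From HB Require Import structures.
From mathcomp Require Import all_boot all_order all_algebra.
From mathcomp Require Import boolp reals trigo.
From mathcomp Require Import complex mpoly ring_quotient generic_quotient.

Set Implicit Arguments.
Unset Strict Implicit.
Unset Printing Implicit Defensive.

Import GRing.Theory.

Local Open Scope ring_scope.
Local Open Scope quotient_scope.

(* Coordinate ring over a commutative base ring [R] of the group
     { N : N^T Q N = Q = N Q N^T, det N = 1 },
   i.e. R[n_ij] modulo these relations; n_ij is the class of the variable of
   index [mxvec_index i j]. *)

Section CoordinateRing.
Variables (R : comNzRingType) (n : nat) (Q : 'M[R]_n).

Definition varmx : 'M[{mpoly R[n * n]}]_n :=
  \matrix_(i, j) 'X_(mxvec_index i j).

Definition Qpoly : 'M[{mpoly R[n * n]}]_n := map_mx (@mpolyC (n * n) R) Q.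

Definition OSO_rels : seq {mpoly R[n * n]} :=
  let N := varmx in
  [seq (N^T *m Qpoly *m N - Qpoly) i j | i <- enum 'I_n, j <- enum 'I_n]
  ++ [seq (N *m Qpoly *m N^T - Qpoly) i j | i <- enum 'I_n, j <- enum 'I_n]
  ++ [:: \det N - 1].

Definition OSO_ideal : pred {mpoly R[n * n]} := fun p =>
  `[< exists c : nat -> {mpoly R[n * n]},
        p = \sum_(k < size OSO_rels) c k * OSO_rels`_k >].

Lemma meval1_varmx :
  map_mx (meval (fun k => mxvec (1%:M : 'M[R]_n) 0 k)) varmx = 1%:M.
Proof. by apply/matrixP=> i j; rewrite !mxE mevalXU mxvecE mxE. Qed.

Lemma meval1_OSO_rels p : p \in OSO_rels ->
  meval (fun k => mxvec (1%:M : 'M[R]_n) 0 k) p = 0.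
Proof.
set v := fun k => _.
have Qv : map_mx (meval v) Qpoly = Q.
  by apply/matrixP=> i j; rewrite !mxE mevalC.
have ev (A : 'M[{mpoly R[n * n]}]_n) i j : meval v (A i j) = map_mx (meval v) A i j.
  by rewrite mxE.
rewrite !mem_cat => /or3P[/allpairsP[[i j] [_ _ ->]]|/allpairsP[[i j] [_ _ ->]]|].
- rewrite ev map_mxB !map_mxM -?matrix.map_trmx meval1_varmx Qv.
  by rewrite trmx1 mul1mx mulmx1 subrr mxE.
- rewrite ev map_mxB !map_mxM -?matrix.map_trmx meval1_varmx Qv.
  by rewrite trmx1 mul1mx mulmx1 subrr mxE.
rewrite inE => /eqP ->.
by rewrite rmorphB rmorph1 -det_map_mx meval1_varmx det1 subrr.
Qed.

Lemma OSO_ideal_closed : idealr_closed OSO_ideal.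
Proof.
split.
- by apply/asboolP; exists (fun _ => 0); rewrite big1 // => k _; rewrite mul0r.
- apply/negP => /asboolP[c e].
  have := congr1 (meval (fun k => mxvec (1%:M : 'M[R]_n) 0 k)) e.
  rewrite rmorph1 rmorph_sum big1 => [/eqP|k _]; first by rewrite oner_eq0.
  by rewrite rmorphM [X in _ * X]meval1_OSO_rels ?mulr0 ?mem_nth.
- move=> a p q /asboolP[c ->] /asboolP[d ->]; apply/asboolP.
  exists (fun k => a * c k + d k).
  rewrite mulr_sumr -big_split /=.
  by apply: eq_bigr => k _; rewrite mulrDl mulrA.
Qed.

HB.instance Definition _ := isIdealr.Build _ OSO_ideal OSO_ideal_closed.

Definition OSO :=
  {ideal_quot GRing.ZmodClosed.clone _ OSO_ideal _}.

HB.instance Definition _ := GRing.ComNzRing.on OSO.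
HB.instance Definition _ := EqQuotient.on OSO.

Definition OSO_class (p : {mpoly R[n * n]}) : OSO := \pi_OSO p.

Definition OSO_scale (c : R) (a : OSO) : OSO := OSO_class c%:MP * a.

Lemma OSO_scaleA c d a : OSO_scale c (OSO_scale d a) = OSO_scale (c * d) a.
Proof. by rewrite /OSO_scale /OSO_class mulrA mpolyCM rmorphM. Qed.

Lemma OSO_scale1 : left_id 1 OSO_scale.
Proof. by move=> a; rewrite /OSO_scale /OSO_class mpolyC1 rmorph1 mul1r. Qed.

Lemma OSO_scaleDr : right_distributive OSO_scale +%R.
Proof. by move=> c a b; rewrite /OSO_scale mulrDr. Qed.

Lemma OSO_scaleDl a : {morph OSO_scale^~ a : c d / c + d}.
Proof.
by move=> c d; rewrite /OSO_scale /OSO_class mpolyCD rmorphD mulrDl.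
Qed.

HB.instance Definition _ := GRing.Zmodule_isLmodule.Build R OSO
  OSO_scaleA OSO_scale1 OSO_scaleDr OSO_scaleDl.

Lemma OSO_scaleAl (c : R) (a b : OSO) : c *: (a * b) = (c *: a) * b.
Proof. exact: mulrA. Qed.

HB.instance Definition _ := GRing.Lmodule_isLalgebra.Build R OSO OSO_scaleAl.
HB.instance Definition _ := GRing.Lalgebra_isComAlgebra.Build R OSO.

Definition OSO_gen : 'M[OSO]_n := map_mx OSO_class varmx.

End CoordinateRing.

Definition Q4 (R : pzRingType) : 'M[R]_4 :=
  (block_mx 0 1%:M 1%:M 0 : 'M[R]_(2 + 2)).

Definition Q5 (R : pzRingType) : 'M[R]_5 :=
  (block_mx (Q4 R) 0 0 1%:M : 'M[R]_(4 + 1)).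

(* The indices 1, ..., 5 of the rows and columns of N. *)
Definition i1 : 'I_5 := @Ordinal 5 0 isT.
Definition i2 : 'I_5 := @Ordinal 5 1 isT.
Definition i3 : 'I_5 := @Ordinal 5 2 isT.
Definition i4 : 'I_5 := @Ordinal 5 3 isT.
Definition i5 : 'I_5 := @Ordinal 5 4 isT.

(* J |-> J' *)
Definition prm (J : 'I_5) : 'I_5 := nth i5 [:: i3; i4; i1; i2; i5] J.

Definition weight : Type := (int * int)%type.
HB.instance Definition _ := GRing.Zmodule.on weight.

Definition wedge (r s : weight) : int := r.1 * s.2 - r.2 * s.1.

Definition wt (J : 'I_5) : weight :=
  nth 0 [:: (1, 0); (0, 1); (- 1, 0); (0, - 1); (0, 0)] J.

(* Left and right weight of a monomial in the n_IJ. *)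
Definition lwt (m : 'X_{1..5 * 5}) : weight :=
  \sum_(I < 5) \sum_(J < 5) wt I *+ m (mxvec_index I J).
Definition rwt (m : 'X_{1..5 * 5}) : weight :=
  \sum_(I < 5) \sum_(J < 5) wt J *+ m (mxvec_index I J).

Section GaugeAlgebra.
Variable R : realType.
Local Notation C := R[i].

(* e^{i pi theta k} *)
Definition phase (theta : R) (k : int) : C :=
  let t := trigo.pi * theta * k%:~R in Complex (cos t) (sin t).

(* O(SO(5,R)).  Below, linear maps out of A and AH are given by a formula on a
   representative polynomial; they are induced maps, because the formulas
   preserve the ideal of relations. *)
Definition A := OSO (Q5 C).
HB.instance Definition _ := GRing.ComAlgebra.on A.
HB.instance Definition _ := EqQuotient.on A.

Definition cls (p : {mpoly C[5 * 5]}) : A := OSO_class (Q5 C) p.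
Definition gen (I J : 'I_5) : A := cls 'X_(mxvec_index I J).

(* Antilinear involution with n_JL^* = n_J'L'. *)
Definition star_poly : {mpoly C[5 * 5]} -> {mpoly C[5 * 5]} :=
  mmap (fun c : C => (conjc c)%:MP)
       (fun k => mxvec (\matrix_(J, L) varmx C 5 (prm J) (prm L)) 0 k).
Definition star (a : A) : A := cls (star_poly (repr a)).

(* A (x) O(SO(4,R)), realised as the base change of O(SO(4,R)) from C to A:
   a (x) h corresponds to a times the image of h. *)
Definition AH := OSO (Q4 A).
HB.instance Definition _ := GRing.ComAlgebra.on AH.
HB.instance Definition _ := EqQuotient.on AH.

(* delta(N) = N (x.) diag(M, 1) *)
Definition coactN : 'M[AH]_5 :=
  map_mx (in_alg AH) (\matrix_(I, J) gen I J)
  *m (block_mx (OSO_gen (Q4 A)) 0 0 1%:M : 'M[AH]_(4 + 1)).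
Definition coact (a : A) : AH :=
  mmap (fun c : C => (c%:A : A)%:A) (fun k => mxvec coactN 0 k) (repr a).

(* psi (x) id: apply psi to the coefficients in A. *)
Definition tens_id (psi : A -> A) (t : AH) : AH :=
  OSO_class (Q4 A) (map_mpoly psi (repr t)).

(* O(S^4), as the coinvariants of delta. *)
Definition OS4 (b : A) : Prop := coact b = b%:A.

(* \sum_K n_JK d_IK, on polynomials in the n_IJ. *)
Definition nd (J I : 'I_5) (p : {mpoly C[5 * 5]}) : {mpoly C[5 * 5]} :=
  \sum_(K < 5) 'X_(mxvec_index J K) * p^`M(mxvec_index I K).

(* n_JK d_IK - n_J2K d_I2K on A.  A single [nd J I] does not preserve the
   ideal of relations, but the differences used below do. *)
Definition vf (J I J2 I2 : 'I_5) (a : A) : A :=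
  cls (nd J I (repr a) - nd J2 I2 (repr a)).

Definition H1 := vf i1 i1 i3 i3.
Definition H2 := vf i2 i2 i4 i4.
Definition E10 := vf i5 i3 i1 i5.
Definition Em10 := vf i3 i5 i5 i1.
Definition E01 := vf i5 i4 i2 i5.
Definition E0m1 := vf i4 i5 i5 i2.
Definition E11 := vf i2 i3 i1 i4.
Definition Em1m1 := vf i3 i2 i4 i1.
Definition E1m1 := vf i4 i3 i1 i2.
Definition Em11 := vf i3 i4 i2 i1.

Definition u1 : A := gen i1 i5.
Definition u2 : A := gen i2 i5.
Definition xS : A := gen i5 i5.

Definition K1 a := xS * H2 a + star u2 * E01 a + u2 * E0m1 a.
Definition K2 a := xS * H1 a + star u1 * E10 a + u1 * Em10 a.
Definition W01 a := u2 * H1 a + star u1 * E11 a + u1 * Em11 a.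
Definition W0m1 a := star u2 * H1 a + star u1 * E1m1 a + u1 * Em1m1 a.
Definition W10 a := u1 * H2 a - star u2 * E11 a + u2 * E1m1 a.
Definition Wm10 a := star u1 * H2 a + star u2 * Em11 a - u2 * Em1m1 a.
Definition W11 a := xS * E11 a + u1 * E01 a - u2 * E10 a.
Definition Wm1m1 a := xS * Em1m1 a + star u1 * E0m1 a - star u2 * Em10 a.
Definition W1m1 a := - xS * E1m1 a + star u2 * E10 a + u1 * E0m1 a.
Definition Wm11 a := - xS * Em11 a + u2 * Em10 a + star u1 * E01 a.

(* K_1, K_2 are K ord0 and K ord_max. *)
Definition K (j : 'I_2) : A -> A := nth K1 [:: K1; K2] j.

Definition Gamma : seq weight :=
  [:: (1, 0); (- 1, 0); (0, 1); (0, - 1); (1, 1); (- 1, - 1);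
      (1, - 1); (- 1, 1)].

(* Only used for r in Gamma. *)
Definition W (r : weight) : A -> A :=
  nth (fun=> 0) [:: W10; Wm10; W01; W0m1; W11; Wm1m1; W1m1; Wm11]
      (index r Gamma).

(* The weight vector c X^m occurring in a. *)
Definition term (a : A) (m : 'X_{1..5 * 5}) : A :=
  (repr a)@_m *: cls 'X_[m].

(* \sum_s F s (a_s) for F linear in its second argument and a = \sum_s a_s
   with a_s of left weight s; the sum runs over the monomials of a
   representative, which is independent of the choice because the relations
   are homogeneous for both weights. *)
Definition wsum (F : weight -> A -> A) (a : A) : A :=
  \sum_(m <- msupp (repr a)) F (lwt m) (term a m).

(* \sum_r f r *: psi_r for psi = \sum_r psi_r with [H_j, psi_r] = r_j psi_r:
   psi_r maps left weight m to left weight m + r. *)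
Definition wact (f : weight -> C) (psi : A -> A) (a : A) : A :=
  wsum (fun m a_m => wsum (fun p y => f (p - m) *: y) (psi a_m)) a.

Definition comm (X Y : A -> A) (a : A) : A := X (Y a) - Y (X a).

Section Twist.
Variable theta : R.

(* The product of O(SO_theta(5,R)) on the vector space A. *)
Definition tmul (a a' : A) : A :=
  \sum_(m <- msupp (repr a)) \sum_(m' <- msupp (repr a'))
    (phase theta (- wedge (lwt m) (lwt m')) *
     phase theta (wedge (rwt m) (rwt m'))) *: (term a m * term a' m').

(* R_F^alpha |> psi, when R_F,alpha acts on a vector of weight s. *)
Definition Ract (s : weight) (psi : A -> A) : A -> A :=
  wact (fun r => phase theta (- 2 * wedge r s)) psi.

Definition braided_derivation (psi : A -> A) : Prop :=
  linear psi /\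
  forall a a', psi (tmul a a') =
    tmul (psi a) a' + wsum (fun s a_s => tmul a_s (Ract s psi a')) a.

Definition aut (psi : A -> A) : Prop :=
  [/\ braided_derivation psi,
      forall a, coact (psi a) = tens_id psi (coact a)
    & forall b, OS4 b -> psi b = 0].

Definition tscale (b : A) (psi : A -> A) (a : A) : A := tmul b (psi a).

(* In the subtracted term, y is the part of psi a_m of weight p, i.e. it is
   psi_r a_m with r = p - m. *)
Definition brk (psi lam : A -> A) (a : A) : A :=
  psi (lam a) -
  wsum (fun m a_m => wsum (fun p y =>
    wact (fun s => phase theta (- 2 * wedge (p - m) s)) lam y) (psi a_m)) a.

Definition D (X : A -> A) (a : A) : A :=
  wsum (fun s a_s => wact (fun r => phase theta (- wedge r s)) X a_s) a.

Definition tK (j : 'I_2) : A -> A := D (K j).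
Definition tW (r : weight) : A -> A := D (W r).

Definition in_span (X : A -> A) : Prop :=
  exists (k : 'I_2 -> C) (w : weight -> C), forall a,
    X a = \sum_(j < 2) k j *: tK j a + \sum_(r <- Gamma) w r *: tW r a.

End Twist.
End GaugeAlgebra.

(* Main.v *)
(* A braided derivation psi commuting with the coaction preserves right weights, and
   rescaling its left-weight components by phases turns it into an ordinary derivation X
   with psi = D X; equivariance and verticality are unaffected.  This reduces the module
   statement to theta = 0.  There S := X(N) Q N^T is skew and X(N) = S Q N; equivariance
   says that S has entries in O(S^4), verticality that S kills v = (n_{K'5})_K.  As v pairs
   to 1 with the last column of N, such an S is the interior product by v of a three-form,
   and the ten fields K_j, W_r are, up to sign, the interior products by v of the ten basis
   three-forms.  Conversely, a vertical X kills every coinvariant b, and not only the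
   n_{I5}: X(N) = N z with z in so(4) tensor A, so X is the coaction followed by the tangent
   vector z at the identity of SO(4), which vanishes on delta b = b (x) 1.  The bracket
   formulas are checked on weight vectors, where they are identities between phases. *)

Require Import Defs.
From HB Require Import structures.
From mathcomp Require Import all_boot all_order all_algebra.
From mathcomp Require Import boolp reals trigo perm.
From mathcomp Require Import complex mpoly ring_quotient generic_quotient ring.

Set Implicit Arguments.
Unset Strict Implicit.
Unset Printing Implicit Defensive.

Import Order.TTheory GRing.Theory Num.Theory.
Local Open Scope ring_scope.
Local Open Scope quotient_scope.

(** * Quotients by the orthogonality relations *)

(** The twist is governed by the automorphisms [T w], which multiply left weight q by the phase of
    q∧w. Since r∧q = (q+r)∧q, the map [D X] is [T (- q)] after [X] on left weight q, and on weights
    s, m the braided Leibniz rule is the image of the ordinary one under [T (- (s + m))], up to a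
    nonzero scalar. The right phases of the product must be the same in all terms, so [X] has to
    preserve right weights; equivariance gives this through the torus of SO(4), whose complex points
    are compatible with every C-linear map. [D] is not linear over the coinvariants: for [X] of
    weight r it takes b X to [T r b] times [D X]. The span is unaffected, because [T r] permutes the
    coinvariants. A second constraint is that every map is a formula on a chosen representative, so
    each formula must first be shown to respect the ideal. For morphisms and derivations this is a
    matrix identity in N and Q, for weight sums the homogeneity of the relations, for psi ⊗ id the
    integrality of their coefficients. *)

Section Derivation.
Variables (S B : comNzRingType) (phi : {rmorphism S -> B}) (d : {additive S -> B}).
Hypothesis dM : forall x y, d (x * y) = d x * phi y + phi x * d y.

Lemma der1 : d 1 = 0.
Proof.
have := dM 1 1; rewrite mulr1 rmorph1 mulr1 mul1r => /esym/eqP.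
by rewrite -subr_eq0 addrK => /eqP.
Qed.

Lemma map_der_mulmx m n p (X : 'M[S]_(m, n)) (Y : 'M_(n, p)) :
  map_mx d (X *m Y) =
  map_mx d X *m map_mx phi Y + map_mx phi X *m map_mx d Y.
Proof.
apply/matrixP=> i j; rewrite !mxE raddf_sum /= -big_split /=.
by apply: eq_bigr => k _; rewrite dM !mxE.
Qed.

Lemma der_prod (I : finType) (P : pred I) (F : I -> S) :
  d (\prod_(i | P i) F i) =
  \sum_(i | P i) d (F i) * \prod_(k | P k && (k != i)) phi (F k).
Proof.
suff H : forall s : seq I, uniq s ->
  d (\prod_(i <- s | P i) F i) =
  \sum_(i <- s | P i) d (F i) * \prod_(k <- s | P k && (k != i)) phi (F k).
  exact: H (index_enum_uniq I).
elim=> [|x s IH] /=; first by rewrite !big_nil der1.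
move=> /andP[xs us]; rewrite !big_cons.
have tail : \prod_(k <- s | P k && (k != x)) phi (F k) = \prod_(k <- s | P k) phi (F k).
  rewrite big_seq_cond [RHS]big_seq_cond; apply: eq_bigl => k.
  by case: eqP => [->|]; rewrite ?andbT // (negbTE xs).
have sumE : \sum_(j <- s | P j) d (F j) * \prod_(k <- x :: s | P k && (k != j)) phi (F k)
  = (if P x then phi (F x) else 1) *
    (\sum_(j <- s | P j) d (F j) * \prod_(k <- s | P k && (k != j)) phi (F k)).
  rewrite mulr_sumr big_seq_cond [RHS]big_seq_cond.
  apply: eq_bigr => j /andP[js _]; rewrite big_cons.
  have -> : x != j by apply: contraNneq xs => ->.
  by rewrite andbT; case: (P x); rewrite ?mul1r // mulrCA.
case Px: (P x); last by rewrite sumE Px mul1r IH.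
rewrite sumE Px dM IH // eqxx andbF tail.
by rewrite rmorph_prod.
Qed.

(** Jacobi's formula for a derivation along [phi]. Differentiating the Leibniz expansion gives the
    sum over i of the determinants with row i differentiated; the cofactors along row i do not see
    that row, and Laplace expansion along it yields the trace. *)
Lemma der_det n (X : 'M[S]_n) :
  d (\det X) = \tr (map_mx d X *m \adj (map_mx phi X)).
Proof.
pose Xr i : 'M[B]_n := \matrix_(k, l) if k == i then d (X k l) else phi (X k l).
have Xcof i j : cofactor (Xr i) i j = cofactor (map_mx phi X) i j.
  rewrite /cofactor; congr (_ * \det _); apply/matrixP=> k l.
  by rewrite !mxE eq_sym (negbTE (neq_lift _ _)).
have -> : \tr (map_mx d X *m \adj (map_mx phi X)) = \sum_i \det (Xr i).
  apply: eq_bigr => i _; rewrite mxE (expand_det_row _ i).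
  by apply: eq_bigr => j _; rewrite Xcof !mxE eqxx.
rewrite /determinant raddf_sum exchange_big /=; apply: eq_bigr => s _.
have -> : d ((-1) ^+ (odd_perm s) * \prod_i X i (s i)) = (-1) ^+ (odd_perm s) * d (\prod_i X i (s i)).
  by case: odd_perm; rewrite ?expr0 ?expr1 ?mul1r // !mulN1r raddfN.
rewrite der_prod mulr_sumr; apply: eq_bigr => i _; congr (_ * _).
rewrite [in RHS](bigD1 i) //= !mxE eqxx; congr (_ * _).
by apply: eq_bigr => k /negbTE ki; rewrite mxE ki.
Qed.
End Derivation.

Section Quot.
Variables (R : comNzRingType) (n : nat) (Q : 'M[R]_n).
Local Notation OSO := (OSO Q).
Local Notation cl := (OSO_class Q).

Lemma OSO_classK (a : OSO) : cl (repr a) = a.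
Proof. exact: reprK. Qed.

HB.instance Definition _ := GRing.RMorphism.copy cl (\pi_OSO : {mpoly R[n*n]} -> OSO).

Lemma OSO_classZ c p : cl (c *: p) = c *: cl p.
Proof. by rewrite -mul_mpolyC rmorphM. Qed.

Lemma OSO_class_eq p q : cl p = cl q -> 
  exists c : nat -> {mpoly R[n * n]},
        p - q = \sum_(k < size (OSO_rels Q)) c k * (OSO_rels Q)`_k.
Proof.
move=> /eqP; rewrite -Quotient.idealrBE.
by move=> /asboolP.
Qed.

Lemma OSO_rel0 r : r \in OSO_rels Q -> cl r = 0.
Proof.
move=> rin; have /eqP -> : cl r == cl 0; last exact: rmorph0.
rewrite -Quotient.idealrBE subr0; apply/asboolP.
have [k ks <-] := nthP 0 rin; exists (fun l => (l == k)%:R).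
rewrite (bigD1 (Ordinal ks)) //= eqxx mul1r big1 ?addr0 // => i.
by rewrite -val_eqE /= => /negbTE ->; rewrite mul0r.
Qed.

Let map_cl (X : 'M[{mpoly R[n * n]}]_n) :
  (forall i j, cl (X i j) = 0) -> map_mx cl X = 0.
Proof. by move=> X0; apply/matrixP=> i j; rewrite !mxE X0. Qed.

Lemma OSO_gen_l : (OSO_gen Q)^T *m map_mx cl (Qpoly Q) *m OSO_gen Q = map_mx cl (Qpoly Q).
Proof.
apply/eqP; rewrite -subr_eq0 /OSO_gen matrix.map_trmx -!map_mxM -map_mxB; apply/eqP.
apply: map_cl => i j; apply: OSO_rel0; rewrite !mem_cat.
by apply/or3P/Or31/allpairsP; exists (i, j); rewrite !mem_enum.
Qed.

Lemma OSO_gen_r : OSO_gen Q *m map_mx cl (Qpoly Q) *m (OSO_gen Q)^T = map_mx cl (Qpoly Q).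
Proof.
apply/eqP; rewrite -subr_eq0 /OSO_gen matrix.map_trmx -!map_mxM -map_mxB; apply/eqP.
apply: map_cl => i j; apply: OSO_rel0; rewrite !mem_cat.
by apply/or3P/Or32/allpairsP; exists (i, j); rewrite !mem_enum.
Qed.

Lemma OSO_gen_det : \det (OSO_gen Q) = 1.
Proof.
have h : \det (varmx R n) - 1 \in OSO_rels Q.
  by rewrite !mem_cat; apply/or3P/Or33; exact: mem_head.
have := OSO_rel0 h; rewrite rmorphB rmorph1 => /eqP; rewrite subr_eq0 => /eqP <-.
by rewrite /OSO_gen det_map_mx.
Qed.

(** Only additivity is asked of [f]: weight sums and coefficientwise maps are not multiplicative, so
    the multiples c * r of a relation have to be treated as a whole. *)
Lemma OSO_kill (V : zmodType) (f : {additive {mpoly R[n * n]} -> V}) :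
  (forall c r, r \in OSO_rels Q -> f (c * r) = 0) ->
  forall p q, cl p = cl q -> f p = f q.
Proof.
move=> f0 p q /OSO_class_eq[c e]; apply/eqP; rewrite -subr_eq0 -raddfB e raddf_sum.
by rewrite big1 // => k _; rewrite f0 // mem_nth.
Qed.

Lemma OSO_rels_ind (P : {mpoly R[n * n]} -> Prop) :
  (forall i j, P (((varmx R n)^T *m Qpoly Q *m varmx R n - Qpoly Q) i j)) ->
  (forall i j, P ((varmx R n *m Qpoly Q *m (varmx R n)^T - Qpoly Q) i j)) ->
  P (\det (varmx R n) - 1) ->
  forall r, r \in OSO_rels Q -> P r.
Proof.
move=> h1 h2 h3 r.
rewrite !mem_cat => /or3P[/allpairsP[[i j] [_ _ ->]]|/allpairsP[[i j] [_ _ ->]]|].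
- exact: h1.
- exact: h2.
by rewrite inE => /eqP ->.
Qed.

Section Rmorph.
Variables (B : comNzRingType) (phi : {rmorphism {mpoly R[n * n]} -> B}).
Let N := map_mx phi (varmx R n).
Let Q' := map_mx phi (Qpoly Q).
Hypotheses (h1 : N^T *m Q' *m N = Q') (h2 : N *m Q' *m N^T = Q') (h3 : \det N = 1).

Lemma rmorph_rels r : r \in OSO_rels Q -> phi r = 0.
Proof.
have ev (X : 'M[{mpoly R[n * n]}]_n) i j : phi (X i j) = map_mx phi X i j by rewrite mxE.
move: r; apply: OSO_rels_ind => [i j|i j|].
- by rewrite ev map_mxB !map_mxM -matrix.map_trmx h1 subrr mxE.
- by rewrite ev map_mxB !map_mxM -matrix.map_trmx h2 subrr mxE.
by rewrite rmorphB rmorph1 -det_map_mx h3 subrr.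
Qed.

Lemma rmorph_OSO p q : cl p = cl q -> phi p = phi q.
Proof. by apply: OSO_kill => c r /rmorph_rels e; rewrite -[LHS]/(phi (c * r)) rmorphM e mulr0. Qed.

Section Der.
Variable d : {additive {mpoly R[n * n]} -> B}.
Hypothesis dM : forall x y, d (x * y) = d x * phi y + phi x * d y.
Hypothesis dQ : map_mx d (Qpoly Q) = 0.
Let dN := map_mx d (varmx R n).
Hypotheses (d1 : dN^T *m Q' *m N + N^T *m Q' *m dN = 0)
           (d2 : dN *m Q' *m N^T + N *m Q' *m dN^T = 0)
           (d3 : \tr (dN *m \adj N) = 0).

(** Here [phi] is a [B]-point of the group and [d] a tangent vector there: [d1], [d2], [d3] are the
    relations linearised at [N], the last by Jacobi's formula. As [phi] kills a relation r, d (c *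
    r) = phi c * d r, and it suffices that [d] kills r. *)
Lemma der_OSO p q : cl p = cl q -> d p = d q.
Proof.
apply: OSO_kill => c r rin; rewrite -[LHS]/(d (c * r)) dM (rmorph_rels rin) mulr0 add0r.
suff -> : d r = 0 by rewrite mulr0.
have ev (X : 'M[{mpoly R[n * n]}]_n) i j : d (X i j) = map_mx d X i j by rewrite mxE.
move: r rin; apply: OSO_rels_ind => [i j|i j|].
- rewrite ev map_mxB !(map_der_mulmx dM) !map_mxM dQ -!matrix.map_trmx.
  by rewrite mulmx0 addr0 subr0 d1 mxE.
- rewrite ev map_mxB !(map_der_mulmx dM) !map_mxM dQ -!matrix.map_trmx.
  by rewrite mulmx0 addr0 subr0 d2 mxE.
by rewrite raddfB (der1 dM) subr0 (der_det dM).
Qed.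
End Der.
End Rmorph.

Lemma mnm_ind k (P : 'X_{1..k} -> Prop) :
  P 0%MM -> (forall i m, P m -> P (U_(i) + m)%MM) -> forall m, P m.
Proof.
move=> P0 PD m; have [d] := ubnP (mdeg m); elim: d m => // d IH m.
have [->//|m0] := eqVneq m 0%MM.
have [i mi] : exists i, m i != 0%N.
  apply/existsP; apply: contraNT m0; rewrite negb_exists => /forallP m0; apply/eqP/mnmP => i.
  by rewrite mnm0E; apply/eqP; have := m0 i; rewrite negbK.
have em : m = (U_(i) + (m - U_(i)))%MM.
  by rewrite addmC submK // lep1mP.
rewrite em mdegD mdeg1 add1n ltnS => lt; apply: PD; exact: IH.
Qed.

Lemma OSO_alg_ind (P : OSO -> Prop) :
  P 1 -> (forall c a, P a -> P (c *: a)) -> (forall a b, P a -> P b -> P (a + b)) ->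
  (forall a b, P a -> P b -> P (a * b)) -> (forall i j, P (OSO_gen Q i j)) ->
  forall a, P a.
Proof.
move=> P1 PZ PD PM PG a; rewrite -[a]OSO_classK.
have P0 : P 0 by rewrite -(scale0r 1); exact: PZ.
rewrite [repr a]mpolyE raddf_sum; apply: big_ind => // m _.
rewrite -[X in P X]/(cl _) OSO_classZ; apply: PZ.
elim/mnm_ind: m => [|k m IH]; first by rewrite mpolyX0 rmorph1.
rewrite mpolyXD rmorphM; apply: PM => //.
by case/mxvec_indexP: k => i j; have := PG i j; rewrite !mxE.
Qed.

Section MapMpoly.
Variable psi : {additive R -> R}.

(* Holds in particular for polynomials with integer coefficients. *)
Definition map_linear (r : {mpoly R[n * n]}) :=
  forall c, map_mpoly psi (c * r) = map_mpoly psi c * r.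

Lemma map_linear1 : map_linear 1.
Proof. by move=> c; rewrite !mulr1. Qed.

Lemma map_linear0 : map_linear 0.
Proof. by move=> c; rewrite !mulr0 raddf0. Qed.

Lemma map_linearD r s : map_linear r -> map_linear s -> map_linear (r + s).
Proof. by move=> hr hs c; rewrite !mulrDr raddfD /= hr hs. Qed.

Lemma map_linearN r : map_linear r -> map_linear (- r).
Proof. by move=> hr c; rewrite !mulrN raddfN /= hr. Qed.

Lemma map_linearM r s : map_linear r -> map_linear s -> map_linear (r * s).
Proof. by move=> hr hs c; rewrite !mulrA hs hr. Qed.

Lemma map_mpolyZX c (m : 'X_{1..n * n}) : map_mpoly psi (c *: 'X_[m]) = psi c *: 'X_[m].
Proof.
by apply/mpolyP=> k; rewrite mcoeff_map_mpoly !mcoeffZ !mcoeffX; case: eqP;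
  rewrite ?mulr1 ?mulr0 ?raddf0.
Qed.

Lemma map_linearX m : map_linear 'X_[m].
Proof.
move=> c; rewrite [c]mpolyE mulr_suml.
have mapS (F : 'X_{1..n * n} -> {mpoly R[n * n]}) :
    map_mpoly psi (\sum_(k <- msupp c) F k) = \sum_(k <- msupp c) map_mpoly psi (F k).
  exact: raddf_sum.
rewrite !mapS mulr_suml; apply: eq_bigr => k _.
by rewrite -scalerAl -mpolyXD !map_mpolyZX mpolyXD scalerAl.
Qed.

Lemma map_mpoly_der : (forall a b, psi (a * b) = psi a * b + a * psi b) ->
  forall p q : {mpoly R[n * n]},
    map_mpoly psi (p * q) = map_mpoly psi p * q + p * map_mpoly psi q.
Proof.
move=> psiM p q.
have mapS r (F : 'X_{1..n * n} -> {mpoly R[n * n]}) :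
    map_mpoly psi (\sum_(k <- r) F k) = \sum_(k <- r) map_mpoly psi (F k).
  exact: raddf_sum.
rewrite [p]mpolyE mulr_suml !mapS !mulr_suml -big_split; apply: eq_bigr => k _ /=.
rewrite [q]mpolyE mulr_sumr !mapS !mulr_sumr -big_split; apply: eq_bigr => l _ /=.
have XX a b : (a *: 'X_[k]) * (b *: 'X_[l]) = (a * b) *: 'X_[k + l] :> {mpoly R[n * n]}.
  by rewrite -scalerAl -scalerAr scalerA mpolyXD.
by rewrite XX !map_mpolyZX !XX psiM scalerDl.
Qed.

Lemma map_linear_sum (I : Type) (s : seq I) (P : pred I) F :
  (forall i, map_linear (F i)) -> map_linear (\sum_(i <- s | P i) F i).
Proof.
by move=> h; apply: big_ind => //; [exact: map_linear0 | exact: map_linearD].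
Qed.

Lemma map_linear_prod (I : Type) (s : seq I) (P : pred I) F :
  (forall i, map_linear (F i)) -> map_linear (\prod_(i <- s | P i) F i).
Proof.
by move=> h; apply: big_ind => //; [exact: map_linear1 | exact: map_linearM].
Qed.

Lemma map_linear_mulmx k l m (X : 'M_(k, l)) (Y : 'M_(l, m)) :
  (forall i j, map_linear (X i j)) -> (forall i j, map_linear (Y i j)) ->
  forall i j, map_linear ((X *m Y) i j).
Proof.
by move=> hX hY i j; rewrite mxE; apply: map_linear_sum => t; exact: map_linearM.
Qed.

Lemma map_linear_det k (X : 'M_k) :
  (forall i j, map_linear (X i j)) -> map_linear (\det X).
Proof.
move=> hX; apply: map_linear_sum => s; apply: map_linearM; last exact: map_linear_prod.
case: odd_perm; rewrite ?expr0 ?expr1; last exact: map_linear1.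
exact/map_linearN/map_linear1.
Qed.

Hypothesis hQ : forall i j, map_linear (Qpoly Q i j).

Lemma map_linear_varmx i j : map_linear (varmx R n i j).
Proof. by rewrite mxE; exact: map_linearX. Qed.

Lemma map_linear_rels r : r \in OSO_rels Q -> map_linear r.
Proof.
have hN := map_linear_varmx.
have hNt i j : map_linear ((varmx R n)^T i j) by rewrite mxE.
move: r; apply: OSO_rels_ind => [i j|i j|].
- rewrite mxE [X in _ + X]mxE; apply: map_linearD; last exact: map_linearN.
  by do 2!apply: map_linear_mulmx => //.
- rewrite mxE [X in _ + X]mxE; apply: map_linearD; last exact: map_linearN.
  by do 2!apply: map_linear_mulmx => //.
apply: map_linearD; first exact: map_linear_det.
exact/map_linearN/map_linear1.
Qed.

(** [psi] is merely additive and would not preserve a general ideal. The relations, however, are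
    built from variables, integers and the entries of [Q], over all of which it is linear, so a
    multiple c * r goes to [map_mpoly psi c] * r. *)
Lemma map_mpoly_OSO p q : cl p = cl q ->
  cl (map_mpoly psi p) = cl (map_mpoly psi q).
Proof.
apply: (@OSO_kill _ (GRing.Additive.clone _ _ (cl \o map_mpoly psi) _)) => c r rin /=.
rewrite (map_linear_rels rin) rmorphM.
by rewrite -[X in _ * X]/(cl r) OSO_rel0 // mulr0.
Qed.
End MapMpoly.

End Quot.

Section Mmap.
Variables (R B : comNzRingType) (n : nat) (f : {rmorphism R -> B}) (X : 'M[B]_n).
Let h k := mxvec X 0 k.

Lemma mmap_varmx : map_mx (mmap f h) (varmx R n) = X.
Proof. by apply/matrixP=> i j; rewrite !mxE mmapX mmap1U /h mxvecE. Qed.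

End Mmap.

(** * The bigrading *)

Lemma prmK : involutive prm.
Proof. by case=> [[|[|[|[|[|]]]]]] //= i; apply/val_inj. Qed.

Lemma wt_prm J : wt (prm J) = - wt J.
Proof. by case: J => [[|[|[|[|[|]]]]]]. Qed.

Lemma block_mxE (T : Type) m1 m2 n1 n2 (X : 'M[T]_(m1, n1)) (Y : 'M_(m1, n2))
    (Z : 'M_(m2, n1)) (T' : 'M_(m2, n2)) i j :
  block_mx X Y Z T' i j =
  match split i, split j with
  | inl x, inl y => X x y | inl x, inr y => Y x y
  | inr x, inl y => Z x y | inr x, inr y => T' x y
  end.
Proof. by rewrite mxE; case: (split i) => x; rewrite mxE; case: (split j). Qed.

Lemma Q4E (R : pzRingType) (a b : 'I_4) :
  Q4 R a b = (nat_of_ord b == (a + 2) %% 4)%N%:R.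
Proof.
apply: (etrans (@block_mxE R 2 2 2 2 0 1%:M 1%:M 0 a b)); case: splitP => x ->; case: splitP => y ->; rewrite mxE;
by case: x => [[|[|]]] //= ?; case: y => [[|[|]]].
Qed.

Lemma Q5E (R : pzRingType) (a b : 'I_5) : Q5 R a b = (b == prm a)%:R.
Proof.
suff -> : (b == prm a) = (nat_of_ord b == nth 4 [:: 2; 3; 0; 1; 4] a)%N.
  apply: (etrans (@block_mxE R 4 1 4 1 (Q4 R) 0 0 1%:M a b)); case: splitP => x ->; case: splitP => y ->; rewrite ?Q4E ?mxE.
  - by case: x => [[|[|[|[|]]]]].
  - by case: x => [[|[|[|[|]]]]] //= ?; case: y => [[|]].
  - by case: y => [[|[|[|[|]]]]] //= ?; case: x => [[|]].
  by rewrite !ord1.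
by rewrite -val_eqE; case: a => [[|[|[|[|[|]]]]]].
Qed.

Definition biweight : Type := (weight * weight)%type.
HB.instance Definition _ := GRing.Zmodule.on biweight.

Definition bwt (m : 'X_{1..5 * 5}) : biweight := (lwt m, rwt m).

Lemma bwtD m1 m2 : bwt (m1 + m2)%MM = bwt m1 + bwt m2.
Proof.
by congr pair; rewrite -big_split; apply: eq_bigr => I _; rewrite -big_split /=;
  apply: eq_bigr => J _; rewrite mnmDE mulrnDr.
Qed.

Lemma bwt0 : bwt 0%MM = 0.
Proof. by apply: (addrI (bwt 0%MM)); rewrite -bwtD addm0 addr0. Qed.

Lemma bwtU I J : bwt U_(mxvec_index I J)%MM = (wt I, wt J).
Proof.
congr pair; rewrite [LHS](bigD1 I) //= (bigD1 J) //= mnm1E eqxx mulr1n.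
- rewrite big1 => [|J' J'J]; last first.
    rewrite mnm1E; case: eqP => // /cast_ord_inj/enum_rank_inj[] /eqP.
    by rewrite eq_sym (negbTE J'J).
  rewrite big1 ?addr0 // => I' I'I; rewrite big1 // => J' _; rewrite mnm1E.
  case: eqP => // /cast_ord_inj/enum_rank_inj[] /eqP.
  by rewrite eq_sym (negbTE I'I).
rewrite big1 => [|J' J'J]; last first.
  rewrite mnm1E; case: eqP => // /cast_ord_inj/enum_rank_inj[] /eqP.
  by rewrite eq_sym (negbTE J'J).
rewrite big1 ?addr0 // => I' I'I; rewrite big1 // => J' _; rewrite mnm1E.
case: eqP => // /cast_ord_inj/enum_rank_inj[] /eqP.
by rewrite eq_sym (negbTE I'I).
Qed.

Section Gradedogeneous.
Variable T : comNzRingType.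
Implicit Types (p q : {mpoly T[5 * 5]}) (s t : biweight).

Definition bihomog s p := forall m, m \in msupp p -> bwt m = s.

Lemma bihomog0 s : bihomog s 0.
Proof. by move=> m; rewrite msupp0. Qed.

Lemma bihomogC c : bihomog 0 c%:MP.
Proof.
move=> m; rewrite msuppC; case: eqP => // _; rewrite inE => /eqP ->; exact: bwt0.
Qed.

Lemma bihomogX m : bihomog (bwt m) 'X_[m].
Proof. by move=> k; rewrite msuppX inE => /eqP ->. Qed.

Lemma bihomogD s p q : bihomog s p -> bihomog s q -> bihomog s (p + q).
Proof.
by move=> hp hq m /msuppD_le; rewrite mem_cat => /orP[]; [exact: hp | exact: hq].
Qed.

Lemma bihomogN s p : bihomog s p -> bihomog s (- p).
Proof. by move=> hp m; rewrite (perm_mem (msuppN _)); exact: hp. Qed.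

Lemma bihomogM s t p q : bihomog s p -> bihomog t q -> bihomog (s + t) (p * q).
Proof.
move=> hp hq m /msuppM_le /allpairsP[[m1 m2] /= [h1 h2 ->]].
by rewrite bwtD (hp _ h1) (hq _ h2).
Qed.

Lemma bihomogZ s c p : bihomog s p -> bihomog s (c *: p).
Proof. by move=> hp m /msuppZ_le; exact: hp. Qed.

Lemma bihomog_sum s (I : Type) (r : seq I) (P : pred I) F :
  (forall i, bihomog s (F i)) -> bihomog s (\sum_(i <- r | P i) F i).
Proof. by move=> h; apply: big_ind => //; [exact: bihomog0 | exact: bihomogD]. Qed.

Lemma bihomog_prod (I : Type) (r : seq I) (P : pred I) F (S : I -> biweight) :
  (forall i, bihomog (S i) (F i)) ->
  bihomog (\sum_(i <- r | P i) S i) (\prod_(i <- r | P i) F i).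
Proof.
by move=> h; apply: (big_rec2 bihomog) => [|i *]; [exact: bihomogC | exact: bihomogM].
Qed.

Lemma bihomog_var I J : bihomog (wt I, wt J) (varmx T 5 I J).
Proof. by rewrite mxE -bwtU; exact: bihomogX. Qed.

(** Weights are attached to indices: the summation index contributes [b] to one factor and [- b] to
    the other. *)
Lemma bihomog_mulmx k l m (a : 'I_k -> biweight) b (c : 'I_m -> biweight)
    (X : 'M_(k, l)) (Y : 'M_(l, m)) :
  (forall i j, bihomog (a i + b j) (X i j)) -> (forall i j, bihomog (c j - b i) (Y i j)) ->
  forall i j, bihomog (a i + c j) ((X *m Y) i j).
Proof.
move=> hX hY i j; rewrite mxE; apply: bihomog_sum => t.
by rewrite -[a i](addrK (b t)) -addrA [- _ + _]addrC; exact: bihomogM.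
Qed.

Lemma bihomog_Qpoly (a : 'I_5 -> biweight) I J : (forall I, a (prm I) = - a I) ->
  bihomog (a I + a J) (Qpoly (Q5 T) I J).
Proof.
move=> ha; rewrite mxE Q5E; case: eqP => [->|_]; last exact: bihomog0.
by rewrite ha subrr; exact: bihomogC.
Qed.

(** With left weights [a] and right weights [b], n_IJ has weight a I + b J. The form pairs I with
    I', of opposite weight, so the inner weights cancel and the entries (i, j) of N^T Q N and N Q
    N^T have weights b i + b j and a i + a j. Each term of det N has weight 0 because the five
    weights add up to 0. *)
Lemma bihomog_rels r : r \in OSO_rels (Q5 T) -> exists s, bihomog s r.
Proof.
pose a (I : 'I_5) : biweight := (wt I, 0); pose b (I : 'I_5) : biweight := (0, wt I).
have ha I : a (prm I) = - a I by rewrite /a wt_prm.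
have hb I : b (prm I) = - b I by rewrite /b wt_prm.
have hN I J : bihomog (a I + b J) (varmx T 5 I J).
  by have := @bihomog_var I J; rewrite /a /b /GRing.add /= /add_pair /= addr0 add0r.
move: r; apply: OSO_rels_ind => [i j|i j|].
- exists (b i + b j); rewrite mxE [X in bihomog _ (_ + X)]mxE.
  apply: bihomogD; last exact/bihomogN/bihomog_Qpoly.
  apply: (@bihomog_mulmx _ _ _ b (fun k => - a k)) => k l; last by rewrite opprK addrC.
  apply: (@bihomog_mulmx _ _ _ b a (fun k => - a k)) => {}k {}l.
    by rewrite mxE addrC.
  by rewrite addrC; apply: (bihomog_Qpoly (a := fun k => - a k)) => I; rewrite ha.
- exists (a i + a j); rewrite mxE [X in bihomog _ (_ + X)]mxE.
  apply: bihomogD; last exact/bihomogN/bihomog_Qpoly.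
  apply: (@bihomog_mulmx _ _ _ a (fun k => - b k)) => k l; last by rewrite mxE opprK.
  apply: (@bihomog_mulmx _ _ _ a b (fun k => - b k)) => {}k {}l //.
  by rewrite addrC; apply: (bihomog_Qpoly (a := fun k => - b k)) => I; rewrite hb.
exists 0; apply: bihomogD; last exact/bihomogN/bihomogC.
apply: bihomog_sum => s; rewrite -[0]add0r; apply: bihomogM.
  by case: odd_perm; rewrite ?expr0 ?expr1; [apply: bihomogN|]; exact: bihomogC.
suff -> : 0 = \sum_i (wt i, wt (s i)) :> biweight.
  by apply: bihomog_prod => i; exact: bihomog_var.
have w0 : \sum_i wt i = 0 by rewrite !big_ord_recl big_ord0.
have -> : \sum_i ((wt i, wt (s i)) : biweight) = \sum_i a i + \sum_i b (s i).
  rewrite -big_split /=; apply: eq_bigr => i _.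
  by rewrite /a /b /GRing.add /= /add_pair /= addr0 add0r.
have <- : \sum_i b i = \sum_i b (s i) by exact: (reindex_perm s).
have -> : \sum_i a i = (\sum_i wt i, 0).
  by elim/big_rec2: _ => // i x y _ ->; rewrite /a /GRing.add /= /add_pair /= addr0.
have -> : \sum_i b i = (0, \sum_i wt i).
  by elim/big_rec2: _ => // i x y _ ->; rewrite /b /GRing.add /= /add_pair /= addr0.
by rewrite w0 addr0.
Qed.

End Gradedogeneous.

Section Grading.
Variable R : realType.
Local Notation C := R[i].
Local Notation A := (A R).
Local Notation cls := (@cls R).
Local Notation gen := (@gen R).
Implicit Types (a b x y : A) (f g : A -> A) (s t : biweight).

HB.instance Definition _ := GRing.RMorphism.copy cls (OSO_class (Q5 C)).

Lemma clsZ c p : cls (c *: p) = c *: cls p.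
Proof. exact: OSO_classZ. Qed.

Lemma clsK a : cls (repr a) = a.
Proof. exact: OSO_classK. Qed.

Lemma cls_ind (P : A -> Prop) : (forall p, P (cls p)) -> forall a, P a.
Proof. by move=> h a; rewrite -[a]clsK. Qed.

Lemma cls_sumE p : cls p = \sum_(m <- msupp p) p@_m *: cls 'X_[m].
Proof.
by rewrite {1}[p]mpolyE raddf_sum; apply: eq_bigr => m _; exact: clsZ.
Qed.

Lemma A_ind (P : A -> Prop) :
  P 1 -> (forall c a, P a -> P (c *: a)) -> (forall a b, P a -> P b -> P (a + b)) ->
  (forall a b, P a -> P b -> P (a * b)) -> (forall i j, P (gen i j)) ->
  forall a, P a.
Proof.
move=> P1 PZ PD PM PG; apply: (@OSO_alg_ind _ _ (Q5 C)) => // i j.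
by rewrite mxE mxE; exact: PG.
Qed.

Section Linear.
Variables (f : A -> A) (hf : linear f).
Let g : {linear A -> A} := HB.pack f (GRing.isLinear.Build C A A *:%R f hf).

Lemma lin0 : f 0 = 0. Proof. exact: (raddf0 g). Qed.
Lemma linD x y : f (x + y) = f x + f y. Proof. exact: (raddfD g). Qed.
Lemma linB x y : f (x - y) = f x - f y. Proof. exact: (raddfB g). Qed.
Lemma linZ c x : f (c *: x) = c *: f x. Proof. exact: (linearZ_LR g). Qed.
Lemma lin_sum (I : Type) (r : seq I) (P : pred I) F :
  f (\sum_(i <- r | P i) F i) = \sum_(i <- r | P i) f (F i).
Proof. exact: (raddf_sum g). Qed.
End Linear.

Lemma linear_id : linear (id : A -> A). Proof. by []. Qed.

Lemma linear_comp f g : linear f -> linear g -> linear (fun x => f (g x)).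
Proof. by move=> hf hg c x y; rewrite hg hf. Qed.

Lemma linear_add f g : linear f -> linear g -> linear (fun x => f x + g x).
Proof. by move=> hf hg c x y; rewrite hf hg scalerDr addrACA. Qed.

Lemma linear_opp f : linear f -> linear (fun x => - f x).
Proof. by move=> hf c x y; rewrite hf opprD scalerN. Qed.

Lemma linear_scale k f : linear f -> linear (fun x => k *: f x).
Proof. by move=> hf c x y; rewrite hf scalerDr !scalerA mulrC. Qed.

Lemma linear_mull b f : linear f -> linear (fun x => b * f x).
Proof. by move=> hf c x y; rewrite hf mulrDr scalerAr. Qed.

Lemma linear_mulr b f : linear f -> linear (fun x => f x * b).
Proof. by move=> hf c x y; rewrite hf mulrDl scalerAl. Qed.

Lemma linear_sum (I : Type) (r : seq I) (P : pred I) (F : I -> A -> A) :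
  (forall i, linear (F i)) -> linear (fun x => \sum_(i <- r | P i) F i x).
Proof.
move=> hF c x y; rewrite scaler_sumr -big_split /=; apply: eq_bigr => i _.
exact: hF.
Qed.

(** Common form of [wsum], where [F] sees the left weight only, and of the twisted product, a double
    sum of this kind that sees both weights. *)
Definition gsum (F : biweight -> A -> A) a : A :=
  \sum_(m <- msupp (repr a)) F (bwt m) (term a m).

Section Gsum.
Variables (F : biweight -> A -> A) (hF : forall s, linear (F s)).

Let psum (p : {mpoly C[5 * 5]}) : A :=
  \sum_(m <- msupp p) F (bwt m) (p@_m *: cls 'X_[m]).

Let psumE p r : uniq r -> {subset msupp p <= r} ->
  psum p = \sum_(m <- r) F (bwt m) (p@_m *: cls 'X_[m]).
Proof.
move=> ur hr; rewrite [RHS](bigID (mem (msupp p))) /= [X in _ + X]big1 => [|m].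
  rewrite addr0 -big_filter; apply: perm_big; apply: uniq_perm.
  - exact: msupp_uniq.
  - exact: filter_uniq.
  by move=> m; rewrite mem_filter; case: (boolP (m \in msupp p)) => // /hr ->.
by move=> /memN_msupp_eq0 ->; rewrite scale0r lin0.
Qed.

Let psum_linear c p q : psum (c *: p + q) = c *: psum p + psum q.
Proof.
pose r := undup (msupp (c *: p + q) ++ msupp p ++ msupp q).
rewrite !(@psumE _ r) ?undup_uniq //; try by move=> m hm; rewrite mem_undup !mem_cat hm ?orbT.
rewrite scaler_sumr -big_split; apply: eq_bigr => m _ /=.
by rewrite mcoeffD mcoeffZ scalerDl -scalerA hF.
Qed.

Let psum_homog s p : bihomog s p -> psum p = F s (cls p).
Proof.
move=> hp; rewrite cls_sumE (lin_sum (hF s)) /psum big_seq [RHS]big_seq.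
by apply: eq_bigr => m /hp ->.
Qed.

Let psum' : {linear {mpoly C[5 * 5]} -> A} :=
  HB.pack psum (GRing.isLinear.Build C _ A *:%R psum psum_linear).

(* The sum does not depend on the representative because the relations are
   homogeneous for both weights. *)
Lemma gsum_cls p : gsum F (cls p) = \sum_(m <- msupp p) F (bwt m) (p@_m *: cls 'X_[m]).
Proof.
apply: (@OSO_kill _ _ (Q5 C) _ psum'); last exact: OSO_classK.
move=> c r rin; have [s hs] := bihomog_rels rin.
rewrite [c]mpolyE mulr_suml raddf_sum big1 // => m _.
rewrite [LHS](@psum_homog (bwt m + s)).
  by rewrite rmorphM [X in _ * X](OSO_rel0 rin) mulr0 lin0.
by apply: bihomogM => //; apply: bihomogZ; exact: bihomogX.
Qed.

Lemma linear_gsum : linear (gsum F).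
Proof.
by move=> c; elim/cls_ind=> p; elim/cls_ind=> q; rewrite -clsZ -rmorphD !gsum_cls; exact: psum_linear.
Qed.

Lemma gsum_bihomog s p : bihomog s p -> gsum F (cls p) = F s (cls p).
Proof. by move=> hp; rewrite gsum_cls; exact: psum_homog. Qed.
End Gsum.

(** Some representative must have its weights in [S], not the chosen one: [repr a] may contain
    monomials of other weights that cancel modulo the relations. *)
Definition Graded (S : biweight -> Prop) a :=
  exists2 p, a = cls p & forall m, m \in msupp p -> S (bwt m).

Notation bhom s := (Graded (fun t => t = s)).
Notation lhom s := (Graded (fun t => t.1 = s)).
Notation rhom s := (Graded (fun t => t.2 = s)).

Lemma gsum_hom F s a : (forall s, linear (F s)) -> bhom s a -> gsum F a = F s a.
Proof. by move=> hF [p -> hp]; exact: gsum_bihomog. Qed.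

Lemma wsum_lhom (F : weight -> A -> A) s a :
  (forall w, linear (F w)) -> bhom s a -> wsum F a = F s.1 a.
Proof. by move=> hF; apply: (@gsum_hom (fun s => F s.1)) => t; exact: hF. Qed.

Lemma linear_wsum (F : weight -> A -> A) : (forall w, linear (F w)) -> linear (wsum F).
Proof. by move=> hF; apply: (@linear_gsum (fun s => F s.1)) => t; exact: hF. Qed.

Section GradedTheory.
Variable S : biweight -> Prop.

Lemma Graded0 : Graded S 0.
Proof. by exists 0; rewrite ?rmorph0 // => m; rewrite msupp0. Qed.

Lemma GradedD a b : Graded S a -> Graded S b -> Graded S (a + b).
Proof.
move=> [p -> hp] [q -> hq]; exists (p + q); first by rewrite rmorphD.
by move=> m /msuppD_le; rewrite mem_cat => /orP[]; [exact: hp | exact: hq].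
Qed.

Lemma GradedZ c a : Graded S a -> Graded S (c *: a).
Proof.
by move=> [p -> hp]; exists (c *: p); rewrite ?clsZ // => m /msuppZ_le; exact: hp.
Qed.

Lemma GradedN a : Graded S a -> Graded S (- a).
Proof. by rewrite -scaleN1r; exact: GradedZ. Qed.

Lemma GradedX m : S (bwt m) -> Graded S (cls 'X_[m]).
Proof. by exists 'X_[m] => // k; rewrite msuppX inE => /eqP ->. Qed.
End GradedTheory.

Lemma Graded_any a : Graded (fun=> True) a.
Proof. by elim/cls_ind: a => p; exists p. Qed.

Lemma Graded_sub (S T : biweight -> Prop) a : (forall s, S s -> T s) -> Graded S a -> Graded T a.
Proof. by move=> ST [p -> hp]; exists p => // m /hp; exact: ST. Qed.

Lemma GradedM (S T U : biweight -> Prop) a b : (forall s t, S s -> T t -> U (s + t)) ->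
  Graded S a -> Graded T b -> Graded U (a * b).
Proof.
move=> STU [p -> hp] [q -> hq]; exists (p * q); first by rewrite rmorphM.
move=> m /msuppM_le /allpairsP[[m1 m2] /= [h1 h2 ->]].
by rewrite bwtD; apply: STU; [exact: hp | exact: hq].
Qed.

Lemma hom_mul s t a b : bhom s a -> bhom t b -> bhom (s + t) (a * b).
Proof. by apply: GradedM => ? ? -> ->. Qed.

Lemma hom_gen I J : bhom (wt I, wt J) (gen I J).
Proof. by apply: GradedX; exact: bwtU. Qed.

Lemma hom1 : bhom 0 1.
Proof. by rewrite -(rmorph1 cls) -mpolyX0; apply: GradedX; exact: bwt0. Qed.

Lemma Graded_ind (S : biweight -> Prop) (P : A -> Prop) :
  P 0 -> (forall a b, P a -> P b -> P (a + b)) ->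
  (forall s a, S s -> bhom s a -> P a) -> forall a, Graded S a -> P a.
Proof.
move=> P0 PD Ph a [p -> hp]; rewrite cls_sumE big_seq.
apply: big_ind => // m /hp Sm; apply: (Ph (bwt m)) => //.
exact/GradedZ/GradedX.
Qed.

Lemma hom_ind (P : A -> Prop) :
  (forall a b, P a -> P b -> P (a + b)) ->
  (forall s a, bhom s a -> P a) -> forall a, P a.
Proof.
move=> PD Ph a; apply: (Graded_ind _ PD _ (Graded_any a)) => [|s b _]; last exact: Ph.
exact: (Ph 0 0 (Graded0 _)).
Qed.

Lemma linear_eq_hom (S : biweight -> Prop) f g : linear f -> linear g ->
  (forall s a, S s -> bhom s a -> f a = g a) -> forall a, Graded S a -> f a = g a.
Proof.
move=> hf hg fg; apply: Graded_ind => [|a b ea eb|]; first by rewrite !lin0.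
  by rewrite !linD // ea eb.
exact: fg.
Qed.

Lemma linear_eq f g : linear f -> linear g ->
  (forall s a, bhom s a -> f a = g a) -> f =1 g.
Proof. by move=> hf hg fg a; apply: (linear_eq_hom hf hg _ (Graded_any a)) => s b _; exact: fg. Qed.

(** The diagonal operator with eigenvalue f s on biweight s. Phases, torus characters and
    projections onto weight spaces are all of this form; for a character f it is an algebra
    automorphism. *)
Definition dg (f : biweight -> C) : A -> A := gsum (fun s y => f s *: y).

Section Diag.
Implicit Types h k : biweight -> C.

Lemma linear_dg h : linear (dg h).
Proof. by apply: linear_gsum => s; exact/linear_scale/linear_id. Qed.

Lemma dg_hom h s a : bhom s a -> dg h a = h s *: a.
Proof. by apply: gsum_hom => t; exact/linear_scale/linear_id. Qed.

Lemma Graded_dg S h a : Graded S a -> Graded S (dg h a).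
Proof.
apply: (@Graded_ind S (fun a => Graded S (dg h a))) => [|x y hx hy|s x Ss hx]; first by rewrite (lin0 (linear_dg h)); exact: Graded0.
  by rewrite (linD (linear_dg h)); exact: GradedD.
by rewrite (dg_hom h hx); apply: GradedZ; apply: Graded_sub hx => t ->.
Qed.

Lemma dg_comp h k a : dg h (dg k a) = dg (fun s => h s * k s) a.
Proof.
move: a; apply: (linear_eq (linear_comp (linear_dg h) (linear_dg k)) (linear_dg _)).
move=> s a ha; rewrite !(dg_hom _ ha) (linZ (linear_dg h)) (dg_hom _ ha).
by rewrite scalerA mulrC.
Qed.

Lemma dg_eq_Graded (S : biweight -> Prop) h k a :
  (forall s, S s -> h s = k s) -> Graded S a -> dg h a = dg k a.
Proof.
move=> hk; apply: (linear_eq_hom (linear_dg h) (linear_dg k)).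
by move=> s {}a Ss ha; rewrite !(dg_hom _ ha) hk.
Qed.

Lemma dg_eq h k a : h =1 k -> dg h a = dg k a.
Proof. by move=> hk; apply: (dg_eq_Graded _ (Graded_any a)) => s _; exact: hk. Qed.

Lemma dg_const c a : dg (fun=> c) a = c *: a.
Proof.
move: a; apply: (linear_eq (linear_dg _) (linear_scale c linear_id)).
by move=> s a ha; rewrite (dg_hom _ ha).
Qed.

Lemma dg_Graded_const S h c a : (forall s, S s -> h s = c) -> Graded S a -> dg h a = c *: a.
Proof. by move=> hc ha; rewrite -dg_const; exact: dg_eq_Graded ha. Qed.

Lemma dgM h : (forall s t, h (s + t) = h s * h t) ->
  forall a b, dg h (a * b) = dg h a * dg h b.
Proof.
move=> hM a b; move: a; apply: (linear_eq (linear_comp (linear_dg h) (linear_mulr b linear_id))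
  (linear_mulr (dg h b) (linear_dg h))) => s a ha.
move: b; apply: (linear_eq (linear_comp (linear_dg h) (linear_mull a linear_id))
  (linear_mull (dg h a) (linear_dg h))).
move=> t b hb; rewrite (dg_hom h (hom_mul ha hb)) (dg_hom h ha) (dg_hom h hb) hM.
by rewrite -scalerAl -scalerAr scalerA.
Qed.
End Diag.
End Grading.
Notation bhom s := (Graded (fun t => t = s)).
Notation lhom s := (Graded (fun t => t.1 = s)).
Notation rhom s := (Graded (fun t => t.2 = s)).

(** * Vector fields and the coaction *)

Lemma map_Q4 (R S : pzRingType) (f : {rmorphism R -> S}) : map_mx f (Q4 R) = Q4 S.
Proof. by apply/matrixP=> i j; rewrite mxE !Q4E rmorph_nat. Qed.

Lemma map_Q5 (R S : pzRingType) (f : {rmorphism R -> S}) : map_mx f (Q5 R) = Q5 S.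
Proof. by apply/matrixP=> i j; rewrite mxE !Q5E rmorph_nat. Qed.

Lemma mul_Q5 (R : pzRingType) m (X : 'M[R]_(5, m)) i j : (Q5 R *m X) i j = X (prm i) j.
Proof.
rewrite mxE (bigD1 (prm i)) //= Q5E eqxx mul1r big1 ?addr0 // => k /negbTE ki.
by rewrite Q5E ki mul0r.
Qed.

Lemma mulQ5 (R : pzRingType) m (X : 'M[R]_(m, 5)) i j : (X *m Q5 R) i j = X i (prm j).
Proof.
rewrite mxE (bigD1 (prm j)) //= Q5E prmK eqxx mulr1 big1 ?addr0 // => k ki.
by rewrite Q5E -(inj_eq (can_inj prmK)) prmK eq_sym (negbTE ki) mulr0.
Qed.

Lemma Q5K (R : pzRingType) : Q5 R *m Q5 R = 1%:M.
Proof. by apply/matrixP=> i j; rewrite mul_Q5 Q5E prmK mxE eq_sym. Qed.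

Lemma trQ5 (R : pzRingType) : (Q5 R)^T = Q5 R.
Proof.
by apply/matrixP=> i j; rewrite mxE !Q5E -(inj_eq (can_inj prmK)) prmK eq_sym.
Qed.

Lemma Q4K (R : pzRingType) : Q4 R *m Q4 R = 1%:M.
Proof.
rewrite /Q4; apply: (etrans (@mulmx_block R 2 2 2 2 2 2 _ _ _ _ _ _ _ _)).
rewrite !(mulmx0, mul0mx, mulmx1, addr0, add0r).
by symmetry; exact: (@scalar_mx_block R 2 2 1).
Qed.

Section ConjForm.
Variables (S : comNzRingType) (n : nat) (Q X : 'M[S]_n).
Hypotheses (QT : Q^T = Q) (QQ : Q *m Q = 1%:M).

(** Meant for the involution, which sends N to Q N Q. *)
Lemma conj_form : X^T *m Q *m X = Q -> (Q *m X *m Q)^T *m Q *m (Q *m X *m Q) = Q.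
Proof.
move=> hX; rewrite !trmx_mul QT.
have -> : Q *m (X^T *m Q) *m Q *m (Q *m X *m Q) = Q *m (X^T *m (Q *m (Q *m Q)) *m X) *m Q.
  by rewrite !mulmxA.
by rewrite QQ mulmx1 hX QQ mul1mx.
Qed.

Lemma conj_form_r : X *m Q *m X^T = Q -> (Q *m X *m Q) *m Q *m (Q *m X *m Q)^T = Q.
Proof.
move=> hX; rewrite !trmx_mul QT.
have -> : Q *m X *m Q *m Q *m (Q *m (X^T *m Q)) = Q *m (X *m (Q *m (Q *m Q)) *m X^T) *m Q.
  by rewrite !mulmxA.
by rewrite QQ mulmx1 hX QQ mul1mx.
Qed.
Variable e : 'M[S]_n.
Hypothesis eQ : e^T *m Q + Q *m e = 0.

Lemma so_mul_l : (e *m X)^T *m Q *m X + X^T *m Q *m (e *m X) = 0.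
Proof.
rewrite trmx_mul; transitivity (X^T *m (e^T *m Q + Q *m e) *m X).
  by rewrite mulmxDr mulmxDl !mulmxA.
by rewrite eQ mulmx0 mul0mx.
Qed.

(** Left multiplication by [e] in so(Q) is tangent to the group. This second linearised relation
    rests on e Q + Q e^T = 0, which is [eQ] conjugated by Q. *)
Lemma so_mul_r : X *m Q *m X^T = Q -> (e *m X) *m Q *m X^T + X *m Q *m (e *m X)^T = 0.
Proof.
move=> hX; rewrite trmx_mul.
transitivity (e *m (X *m Q *m X^T) + (X *m Q *m X^T) *m e^T); first by rewrite !mulmxA.
rewrite hX; transitivity ((Q *m Q) *m (e *m Q) + (Q *m e^T) *m (Q *m Q)).
  by rewrite QQ mul1mx mulmx1.
transitivity (Q *m (e^T *m Q + Q *m e) *m Q); last by rewrite eQ mulmx0 mul0mx.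
by rewrite mulmxDr mulmxDl !mulmxA addrC.
Qed.
End ConjForm.

Lemma mderivXU (R : nzRingType) n (i j : 'I_n) :
  ('X_j : {mpoly R[n]})^`M(i) = (j == i)%:R.
Proof.
rewrite mderivX mnm1E; case: eqP => [->|_]; last by rewrite scale0r.
rewrite scale1r (_ : (U_(i) - U_(i))%MM = 0%MM) ?mpolyX0 //.
by apply/mnmP=> k; rewrite mnmBE subnn mnm0E.
Qed.

Section Structure.
Variable R : realType.
Local Notation C := R[i].
Local Notation A := (A R).
Local Notation AH := (AH R).
Local Notation cls := (@cls R).
Local Notation gen := (@gen R).
Implicit Types (a b x y : A) (f g : A -> A) (s t : biweight).

Definition Nmx : 'M[A]_5 := \matrix_(I, J) gen I J.

Lemma NmxE : Nmx = OSO_gen (Q5 C).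
Proof. by apply/matrixP=> I J; rewrite !mxE. Qed.

Lemma map_cls_varmx : map_mx cls (varmx C 5) = Nmx.
Proof. by apply/matrixP=> I J; rewrite !mxE. Qed.

Lemma map_Qpoly5 (B : pzRingType) (phi : {rmorphism {mpoly C[5 * 5]} -> B}) :
  map_mx phi (Qpoly (Q5 C)) = Q5 B.
Proof. by rewrite /Qpoly map_Q5 map_Q5. Qed.

Lemma Nmx_l : Nmx^T *m Q5 A *m Nmx = Q5 A.
Proof. by rewrite -(map_Qpoly5 cls) NmxE; exact: OSO_gen_l. Qed.

Lemma Nmx_r : Nmx *m Q5 A *m Nmx^T = Q5 A.
Proof. by rewrite -(map_Qpoly5 cls) NmxE; exact: OSO_gen_r. Qed.

Lemma Nmx_det : \det Nmx = 1.
Proof. by rewrite NmxE; exact: OSO_gen_det. Qed.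

(** Antilinearity is no obstacle: a ring morphism out of the polynomials may conjugate the
    coefficients. This one sends N to Q N Q, which again satisfies the relations. *)
Lemma star_gen J L : star (gen J L) = gen (prm J) (prm L).
Proof.
pose h := mxvec (\matrix_(J, L) varmx C 5 (prm J) (prm L)).
pose sp : {rmorphism _ -> _} :=
  mmap (@mpolyC (5 * 5) C \o @conjc R) (h 0).
pose phi : {rmorphism _ -> _} := cls \o sp.
have phiN : map_mx phi (varmx C 5) = Q5 A *m Nmx *m Q5 A.
  apply/matrixP=> a b; rewrite mulQ5 mul_Q5 !mxE /= mmapX mmap1U /h mxvecE !mxE.
  by [].
rewrite /star [LHS](@rmorph_OSO _ _ (Q5 C) _ phi _ _ _ _ 'X_(mxvec_index J L)).
- by rewrite /= mmapX mmap1U /h mxvecE !mxE.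
- by rewrite phiN map_Qpoly5; apply: conj_form; rewrite ?trQ5 ?Q5K ?Nmx_l.
- by rewrite phiN map_Qpoly5; apply: conj_form_r; rewrite ?trQ5 ?Q5K ?Nmx_r.
- rewrite phiN !det_mulmx Nmx_det mulr1 -det_mulmx Q5K det1 //.
exact: clsK.
Qed.

End Structure.

Section VectorFields.
Variable R : realType.
Local Notation C := R[i].
Local Notation A := (A R).
Local Notation cls := (@cls R).
Local Notation gen := (@gen R).
Implicit Types (a b x y : A) (X : A -> A).

Definition derivation X := forall a b, X (a * b) = X a * b + a * X b.

(** All ten fields H_j and E_r have this shape. The second pair of indices mirrors the first under
    the form, which places the difference in so(Q). *)
Definition E (J I : 'I_5) : A -> A := vf J I (prm I) (prm J).

Lemma nd_linear J I c (p q : {mpoly C[5 * 5]}) : nd J I (c *: p + q) = c *: nd J I p + nd J I q.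
Proof.
rewrite /nd scaler_sumr -big_split; apply: eq_bigr => K _ /=.
by rewrite linearP mulrDr scalerAr.
Qed.

Lemma ndM J I (p q : {mpoly C[5 * 5]}) : nd J I (p * q) = nd J I p * q + p * nd J I q.
Proof.
rewrite /nd mulr_suml mulr_sumr -big_split; apply: eq_bigr => K _ /=.
by rewrite mderivM mulrDr; congr (_ + _); [exact: mulrA | exact: mulrCA].
Qed.

Lemma nd_var J I (M K : 'I_5) : nd J I ('X_(mxvec_index M K) : {mpoly C[5 * 5]}) =
  (M == I)%:R * 'X_(mxvec_index J K).
Proof.
rewrite /nd (bigD1 K) //= big1 => [|L LK]; rewrite mderivXU.
  rewrite addr0 mulrC; congr (_%:R * _); congr nat_of_bool.
  by apply/eqP/eqP => [/cast_ord_inj/enum_rank_inj[]|->].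
case: eqP => [/cast_ord_inj/enum_rank_inj[_ KL]|]; last by rewrite mulr0.
by rewrite KL eqxx in LK.
Qed.

Lemma prm_eq (a b : 'I_5) : (prm a == b) = (a == prm b).
Proof. by rewrite -(inj_eq (can_inj prmK)) prmK. Qed.

Section E.
Variables J I : 'I_5.

Let d (p : {mpoly C[5 * 5]}) : A := cls (nd J I p - nd (prm I) (prm J) p).

Let d_linear c p q : d (c *: p + q) = c *: d p + d q.
Proof. by rewrite /d !nd_linear -clsZ -rmorphD; congr cls; rewrite opprD scalerBr addrACA. Qed.

Let d' : {linear {mpoly C[5 * 5]} -> A} :=
  HB.pack d (GRing.isLinear.Build C _ A *:%R d d_linear).

Let dM p q : d' (p * q) = d' p * cls q + cls p * d' q.
Proof.
rewrite -[LHS]/(d (p * q)) -[d' p]/(d p) -[d' q]/(d q) /d -!rmorphM -rmorphD.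
by congr cls; rewrite !ndM mulrBl mulrBr opprD addrACA.
Qed.

(** The element of so(Q) by which the field multiplies N on the left. *)
Let e : 'M[A]_5 := delta_mx I J - delta_mx (prm J) (prm I).

Let dN : map_mx d' (varmx C 5) = e *m Nmx R.
Proof.
apply/matrixP=> a K; rewrite !mxE -[LHS]/(d _) /d !nd_var rmorphB.
rewrite !rmorphM !rmorph_nat.
under eq_bigr do rewrite !mxE mulrBl.
rewrite sumrB; congr (_ - _).
- rewrite (bigD1 J) //= eqxx andbT big1 ?addr0 // => b /negbTE bJ.
  by rewrite bJ andbF mul0r.
rewrite (bigD1 (prm I)) //= eqxx andbT big1 ?addr0 // => b /negbTE bJ.
by rewrite bJ andbF mul0r.
Qed.

Let eQ : e^T *m Q5 A + Q5 A *m e = 0.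
Proof.
apply/matrixP=> a b; rewrite mxE mulQ5 mul_Q5 !mxE.
rewrite !(inj_eq (can_inj prmK)) !prm_eq [(b == J) && _]andbC [(a == J) && _]andbC.
by rewrite addrA subrK subrr.
Qed.

Lemma E_cls p : E J I (cls p) = d p.
Proof.
rewrite /E /vf -[LHS]/(d' (repr (cls p))).
apply: (@der_OSO _ _ (Q5 C) _ cls _ _ _ d' dM); last exact: clsK.
- by rewrite map_cls_varmx map_Qpoly5 Nmx_l.
- by rewrite map_cls_varmx map_Qpoly5 Nmx_r.
- by rewrite map_cls_varmx Nmx_det.
- apply/matrixP=> a b; rewrite !mxE -[LHS]/(d _) /d /nd.
  by rewrite !big1 ?subrr ?rmorph0 // => K _; rewrite mderivC mulr0.
- rewrite dN map_cls_varmx map_Qpoly5. exact: so_mul_l eQ.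
- rewrite dN map_cls_varmx map_Qpoly5. by have := so_mul_r (Q5K A) eQ (Nmx_r R).
(* The linearised determinant: tr (e N adj N) = det N tr e, and the traces of the two matrix units
   of [e] cancel. *)
change (\tr (map_mx d' (varmx C 5) *m \adj (map_mx cls (varmx C 5))) = 0).
rewrite dN map_cls_varmx -mulmxA mul_mx_adj Nmx_det mulmx1 raddfB /=.
have tr_delta (a b : 'I_5) : \tr (delta_mx a b : 'M[A]_5) = (a == b)%:R.
  rewrite /mxtrace (bigD1 a) //= mxE eqxx big1 ?addr0 // => k /negbTE ka.
  by rewrite mxE ka.
by rewrite !tr_delta (inj_eq (can_inj prmK)) eq_sym subrr.
Qed.

Lemma linear_E : linear (E J I).
Proof.
by move=> c; elim/cls_ind=> p; elim/cls_ind=> q; rewrite -clsZ -rmorphD !E_cls d_linear.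
Qed.

Lemma E_der : derivation (E J I).
Proof. by elim/cls_ind=> p; elim/cls_ind=> q; rewrite -rmorphM !E_cls; exact: dM. Qed.

Lemma E_gen L K : E J I (gen L K) =
  (L == I)%:R * gen J K - (L == prm J)%:R * gen (prm I) K.
Proof.
rewrite /gen E_cls /d !nd_var rmorphB !rmorphM !rmorph_nat.
by [].
Qed.
End E.
End VectorFields.

Lemma block_mul_diag (S : comNzRingType) m n (X Q Y : 'M[S]_m) :
  block_mx X 0 0 (1%:M : 'M_n) *m block_mx Q 0 0 1%:M *m block_mx Y 0 0 1%:M =
  block_mx (X *m Q *m Y) 0 0 1%:M.
Proof. by rewrite !mulmx_block !(mulmx0, mul0mx, addr0, add0r, mulmx1). Qed.

Section FormMul.
Variables (S : comNzRingType) (n : nat) (Q X Y : 'M[S]_n).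

Lemma form_mul_l : X^T *m Q *m X = Q -> Y^T *m Q *m Y = Q ->
  (X *m Y)^T *m Q *m (X *m Y) = Q.
Proof.
move=> hX hY; rewrite trmx_mul -[RHS]hY -[in RHS]hX !mulmxA.
by [].
Qed.

Lemma form_mul_r : X *m Q *m X^T = Q -> Y *m Q *m Y^T = Q ->
  (X *m Y) *m Q *m (X *m Y)^T = Q.
Proof. by move=> hX hY; rewrite trmx_mul -[RHS]hX -[in RHS]hY !mulmxA. Qed.
End FormMul.

Section Coaction.
Variable R : realType.
Local Notation C := R[i].
Local Notation A := (A R).
Local Notation AH := (AH R).
Local Notation cls := (@cls R).
Local Notation gen := (@gen R).
Local Notation cl := (OSO_class (Q4 A)).
Implicit Types (a b x y : A) (X psi : A -> A) (t : AH).

Definition Mhat : 'M[AH]_5 := block_mx (OSO_gen (Q4 A)) 0 0 1%:M : 'M[AH]_(4 + 1).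

Lemma coactNE : coactN R = map_mx (in_alg AH) (Nmx R) *m Mhat.
Proof. by []. Qed.

Lemma map_Qpoly4 : map_mx cl (Qpoly (Q4 A)) = Q4 AH.
Proof. by rewrite /Qpoly map_Q4 map_Q4. Qed.

Lemma gen4_l : (OSO_gen (Q4 A))^T *m Q4 AH *m OSO_gen (Q4 A) = Q4 AH.
Proof. by rewrite -map_Qpoly4; exact: OSO_gen_l. Qed.

Lemma gen4_r : OSO_gen (Q4 A) *m Q4 AH *m (OSO_gen (Q4 A))^T = Q4 AH.
Proof. by rewrite -map_Qpoly4; exact: OSO_gen_r. Qed.

Lemma tr_Mhat : Mhat^T = (block_mx (OSO_gen (Q4 A))^T 0 0 1%:M : 'M[AH]_(4 + 1)).
Proof.
apply: (etrans (@tr_block_mx AH 4 1 4 1 (OSO_gen (Q4 A)) 0 0 1%:M)).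
by rewrite !trmx0 trmx1.
Qed.

Lemma Mhat_l : Mhat^T *m Q5 AH *m Mhat = Q5 AH.
Proof.
rewrite tr_Mhat; apply: (etrans (@block_mul_diag AH 4 1 _ (Q4 AH) _)).
by rewrite gen4_l.
Qed.

Lemma Mhat_r : Mhat *m Q5 AH *m Mhat^T = Q5 AH.
Proof.
rewrite tr_Mhat; apply: (etrans (@block_mul_diag AH 4 1 _ (Q4 AH) _)).
by rewrite gen4_r.
Qed.

Lemma Mhat_det : \det Mhat = 1.
Proof. by rewrite (det_ublock (OSO_gen (Q4 A))) OSO_gen_det det1 mulr1. Qed.

Lemma Mhat_col5 K : Mhat K i5 = (K == i5)%:R.
Proof.
apply: (etrans (@block_mxE AH 4 1 4 1 _ _ _ _ K i5)).
case: splitP => x ex; (case: splitP => [y ey|y ey];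
  first by exfalso; move: (ltn_ord y); rewrite -ey); rewrite mxE.
- rewrite (_ : (K == i5) = false) //; apply/negbTE/eqP => eK.
  by move: (ltn_ord x); rewrite -ex eK.
rewrite (_ : K == i5) ?ord1 //.
by rewrite -val_eqE /= ex ord1.
Qed.

Definition coact_poly : {rmorphism {mpoly C[5 * 5]} -> AH} :=
  mmap (in_alg AH \o in_alg A) (fun k => mxvec (coactN R) 0 k).

Lemma coact_poly_varmx : map_mx coact_poly (varmx C 5) = coactN R.
Proof. exact: mmap_varmx. Qed.

Let NA : 'M[AH]_5 := map_mx (in_alg AH) (Nmx R).

Lemma NA_l : NA^T *m Q5 AH *m NA = Q5 AH.
Proof.
by rewrite -(map_Q5 (in_alg AH)) /NA matrix.map_trmx -!map_mxM Nmx_l.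
Qed.

Lemma NA_r : NA *m Q5 AH *m NA^T = Q5 AH.
Proof.
by rewrite -(map_Q5 (in_alg AH)) /NA matrix.map_trmx -!map_mxM Nmx_r.
Qed.

Lemma NA_det : \det NA = 1.
Proof. by rewrite /NA det_map_mx Nmx_det rmorph1. Qed.

Lemma coact_cls p : coact (cls p) = coact_poly p.
Proof.
rewrite -[LHS]/(coact_poly (repr (cls p))).
apply: (@rmorph_OSO _ _ (Q5 C) _ coact_poly); last exact: clsK.
- rewrite coact_poly_varmx (map_Qpoly5 coact_poly) coactNE.
  exact: (form_mul_l NA_l Mhat_l).
- rewrite coact_poly_varmx (map_Qpoly5 coact_poly) coactNE.
  exact: (form_mul_r NA_r Mhat_r).
by rewrite coact_poly_varmx coactNE det_mulmx NA_det Mhat_det mulr1.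
Qed.

Lemma coactM a b : coact (a * b) = coact a * coact b.
Proof.
by move: a b; elim/cls_ind=> p; elim/cls_ind=> q; rewrite -rmorphM !coact_cls rmorphM.
Qed.

Lemma coactD a b : coact (a + b) = coact a + coact b.
Proof.
by move: a b; elim/cls_ind=> p; elim/cls_ind=> q; rewrite -rmorphD !coact_cls rmorphD.
Qed.

Lemma coact1 : coact (1 : A) = 1.
Proof. by rewrite -(rmorph1 cls) coact_cls rmorph1. Qed.

Lemma coactZ c a : coact (c *: a) = c%:A *: coact a.
Proof.
move: a; elim/cls_ind=> p; rewrite -clsZ !coact_cls -mul_mpolyC rmorphM /=.
rewrite [mmap _ _ c%:MP]mmapC /=.
by rewrite mulr_algl.
Qed.

Lemma coact_gen I J : coact (gen I J) = \sum_K gen I K *: Mhat K J.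
Proof.
rewrite /gen coact_cls /= mmapX mmap1U mxvecE coactNE mxE.
by apply: eq_bigr => K _; rewrite !mxE mulr_algl.
Qed.
End Coaction.

Section TensId.
Variable R : realType.
Local Notation C := R[i].
Local Notation A := (A R).
Local Notation AH := (AH R).
Local Notation cls := (@cls R).
Local Notation gen := (@gen R).
Local Notation cl := (OSO_class (Q4 A)).
Local Notation Mhat := (Mhat R).
Implicit Types (a b x y : A) (X psi : A -> A) (t : AH).

Lemma clK t : cl (repr t) = t.
Proof. exact: OSO_classK. Qed.

Lemma cl_ind (P : AH -> Prop) : (forall p, P (cl p)) -> forall t, P t.
Proof. by move=> h t; rewrite -[t]clK. Qed.

Lemma cl_scale a p : cl (a *: p) = a *: cl p.
Proof. exact: OSO_classZ. Qed.

Lemma coact0 : coact (0 : A) = 0.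
Proof. by apply: (addrI (coact (0 : A))); rewrite -coactD !addr0. Qed.

Lemma coact_opp a : coact (- a) = - coact a.
Proof. by apply: (addrI (coact a)); rewrite -coactD !subrr coact0. Qed.

Section Psi.
Variables (psi : A -> A) (hpsi : linear psi).
Let psi' : {linear A -> A} := HB.pack psi (GRing.isLinear.Build C A A *:%R psi hpsi).

Lemma map_linear_Qpoly4 i j : map_linear psi' (Qpoly (Q4 A) i j).
Proof.
rewrite mxE Q4E; case: (_ == _); first by rewrite mpolyC1; exact: map_linear1.
by rewrite mpolyC0; exact: map_linear0.
Qed.

Lemma tens_id_cl p : tens_id psi (cl p) = cl (map_mpoly psi p).
Proof.
exact: (map_mpoly_OSO map_linear_Qpoly4 (OSO_classK (cl p))).
Qed.

Lemma map_mpoly_add (p q : {mpoly A[4 * 4]}) :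
  map_mpoly psi (p + q) = map_mpoly psi p + map_mpoly psi q.
Proof. exact: (raddfD (map_mpoly psi')). Qed.

Lemma tens_idD s t : tens_id psi (s + t) = tens_id psi s + tens_id psi t.
Proof.
move: s t; elim/cl_ind=> p; elim/cl_ind=> q.
by rewrite -rmorphD !tens_id_cl map_mpoly_add rmorphD.
Qed.

Lemma tens_id0 : tens_id psi 0 = 0.
Proof. by apply: (addrI (tens_id psi 0)); rewrite -tens_idD !addr0. Qed.

Lemma tens_id_sum (I : Type) (r : seq I) (P : pred I) F :
  tens_id psi (\sum_(i <- r | P i) F i) = \sum_(i <- r | P i) tens_id psi (F i).
Proof. by apply: (big_morph _ tens_idD tens_id0). Qed.

Lemma tens_id_scale c t : tens_id psi (c%:A *: t) = c%:A *: tens_id psi t.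
Proof.
move: t; elim/cl_ind=> p; rewrite -cl_scale !tens_id_cl -cl_scale; congr cl.
apply/mpolyP=> m; rewrite (mcoeff_map_mpoly psi') !mcoeffZ (mcoeff_map_mpoly psi') /=.
by rewrite !mulr_algl (linZ hpsi).
Qed.

(** This is the rule (psi ⊗ id)(a ⊗ h) = psi a ⊗ h; [map_linear] stands in for the requirement that
    h has complex coefficients. *)
Lemma tens_id_lin a r : map_linear psi' r -> tens_id psi (a *: cl r) = psi a *: cl r.
Proof.
move=> hr; rewrite -cl_scale tens_id_cl -mul_mpolyC.
have -> : map_mpoly psi (a%:MP * r) = map_mpoly psi a%:MP * r by exact: hr.
by rewrite (map_mpolyC _ psi') mul_mpolyC cl_scale.
Qed.

Lemma tens_idE p : tens_id psi (cl p) = \sum_(m <- msupp p) psi p@_m *: cl 'X_[m].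
Proof.
have -> : cl p = \sum_(m <- msupp p) p@_m *: cl 'X_[m].
  rewrite {1}[p]mpolyE [LHS](raddf_sum cl); apply: eq_bigr => m _; exact: cl_scale.
rewrite tens_id_sum; apply: eq_bigr => m _; apply: tens_id_lin; exact: map_linearX.
Qed.

Lemma Mhat_cl K J : exists2 r, Mhat K J = cl r & map_linear psi' r.
Proof.
have -> : Mhat K J = _ := @block_mxE AH 4 1 4 1 _ _ _ _ K J.
case: (split (m := 4) K) => x; case: (split (m := 4) J) => y; rewrite mxE.
- by exists (varmx A 4 x y) => //; exact: map_linear_varmx.
- by exists 0; [rewrite rmorph0 | exact: map_linear0].
- by exists 0; [rewrite rmorph0 | exact: map_linear0].
case: (x == y).
  exists 1; last exact: map_linear1.
  by rewrite [RHS](rmorph1 cl) mulr1n.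
exists 0; last exact: map_linear0.
by rewrite [RHS](rmorph0 cl) mulr0n.
Qed.

Lemma tens_id_Mhat a K J : tens_id psi (a *: Mhat K J) = psi a *: Mhat K J.
Proof. by have [r -> hr] := Mhat_cl K J; exact: tens_id_lin. Qed.

Lemma tens_id_coact_gen I J :
  tens_id psi (coact (gen I J)) = \sum_K psi (gen I K) *: Mhat K J.
Proof.
by rewrite coact_gen tens_id_sum; apply: eq_bigr => K _; exact: tens_id_Mhat.
Qed.

Lemma tens_id_alg a : tens_id psi a%:A = (psi a)%:A.
Proof. by rewrite -(rmorph1 cl) tens_id_lin //; exact: map_linear1. Qed.

Section Der.
Hypothesis psiM : derivation psi.

Lemma tens_idM s t : tens_id psi (s * t) = tens_id psi s * t + s * tens_id psi t.
Proof.
move: s t; elim/cl_ind=> p; elim/cl_ind=> q.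
rewrite -rmorphM !tens_id_cl -!rmorphM -rmorphD; congr cl.
exact: (map_mpoly_der (psi := psi')).
Qed.

(** Both sides are derivations along [coact], the right one because [tens_id psi] is a derivation of
    A ⊗ O(SO(4)); hence agreement on the n_IJ suffices. *)
Lemma equivariant_der :
  (forall I J, coact (psi (gen I J)) = \sum_K psi (gen I K) *: Mhat K J) ->
  forall a, coact (psi a) = tens_id psi (coact a).
Proof.
have psi1 : psi 1 = 0.
  apply: (addrI (psi 1)); rewrite addr0 -{3}[1]mulr1 psiM mulr1 mul1r.
  by [].
move=> hg; apply: A_ind => [|c a ha|a b ha hb|a b ha hb|I J].
- have -> : coact (1 : A) = (1 : A)%:A by rewrite scale1r coact1.
  by rewrite tens_id_alg psi1 scale0r coact0.
- by rewrite (linZ hpsi) !coactZ ha tens_id_scale.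
- by rewrite (linD hpsi) !coactD ha hb tens_idD.
- by rewrite psiM coactD !coactM tens_idM ha hb.
by rewrite tens_id_coact_gen hg.
Qed.
End Der.
End Psi.

Lemma OS4D a b : OS4 a -> OS4 b -> OS4 (a + b).
Proof. by rewrite /OS4 coactD => -> ->; rewrite scalerDl. Qed.

Lemma OS4M a b : OS4 a -> OS4 b -> OS4 (a * b).
Proof. by rewrite /OS4 coactM => -> ->; rewrite -scalerAl mul1r scalerA. Qed.

Lemma OS4Z c a : OS4 a -> OS4 (c *: a).
Proof. by rewrite /OS4 coactZ => ->; rewrite scalerA mulr_algl. Qed.

Lemma OS4N a : OS4 a -> OS4 (- a).
Proof. by rewrite -scaleN1r; exact: OS4Z. Qed.

Lemma OS40 : OS4 (0 : A).
Proof. by rewrite -(scale0r 1); apply: OS4Z; rewrite /OS4 coact1 scale1r. Qed.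

Lemma OS4_gen I : OS4 (gen I i5).
Proof.
rewrite /OS4 coact_gen (bigD1 i5) //= Mhat_col5 eqxx big1 ?addr0 // => K /negbTE K5.
by rewrite Mhat_col5 K5 scaler0.
Qed.

(** The field multiplies N on the left, the coaction multiplies it on the right. *)
Lemma E_equiv J I a : coact (E J I a) = tens_id (E J I) (coact a).
Proof.
apply: equivariant_der; [exact: linear_E | exact: E_der |] => L M.
have cN (k : nat) b : coact (k%:R * b) = (k%:R : A) *: coact b.
  have -> : k%:R * b = (k%:R : C) *: b by rewrite mulr_natl scaler_nat.
  by rewrite coactZ; congr (_ *: _); exact: scaler_nat.
rewrite E_gen coactD coact_opp !cN !coact_gen !scaler_sumr -sumrB.
by apply: eq_bigr => K _; rewrite E_gen scalerBl !scalerA.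
Qed.

End TensId.

(** * Equivariant derivations and their weights *)

Section Gauge.
Variable R : realType.
Local Notation C := R[i].
Local Notation A := (A R).
Local Notation AH := (AH R).
Local Notation cls := (@cls R).
Local Notation gen := (@gen R).
Local Notation cl := (OSO_class (Q4 A)).
Implicit Types (a b x y : A) (X Y psi : A -> A) (t : AH).

(** Verticality is kept apart, since the fields [E J I] are equivariant but move the coinvariants;
    only the combinations K_j and W_r are vertical. *)
Definition gauge_derivation X :=
  [/\ linear X, derivation X & forall a, coact (X a) = tens_id X (coact a)].
Local Notation gder := gauge_derivation.

Lemma gder_E J I : gder (E (R := R) J I).
Proof. by split; [exact: linear_E | exact: E_der | exact: E_equiv]. Qed.

Lemma tens_id_add X Y t : linear X -> linear Y ->
  tens_id (fun a => X a + Y a) t = tens_id X t + tens_id Y t.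
Proof.
move=> hX hY; move: t; elim/cl_ind => p.
rewrite !tens_idE //; last exact: linear_add.
by rewrite -big_split; apply: eq_bigr => m _; exact: scalerDl.
Qed.

Lemma tens_id_mull X b t : linear X -> tens_id (fun a => b * X a) t = b *: tens_id X t.
Proof.
move=> hX; move: t; elim/cl_ind => p.
rewrite !tens_idE //; last exact: linear_mull.
by rewrite scaler_sumr; apply: eq_bigr => m _; rewrite scalerA.
Qed.

Lemma gderD X Y : gder X -> gder Y -> gder (fun a => X a + Y a).
Proof.
move=> [lX dX eX] [lY dY eY]; split; first exact: linear_add.
  by move=> a b; rewrite dX dY mulrDl mulrDr addrACA.
by move=> a; rewrite coactD tens_id_add // eX eY.
Qed.

Lemma gderM b X : OS4 b -> gder X -> gder (fun a => b * X a).
Proof.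
move=> hb [lX dX eX]; split; first exact: linear_mull.
  by move=> a c; rewrite dX mulrDr !mulrA [b * a]mulrC.
move=> a; rewrite coactM tens_id_mull // eX.
have -> : coact b = b%:A by [].
by rewrite mulr_algl.
Qed.

Lemma gderN X : gder X -> gder (fun a => - X a).
Proof.
move=> hX; have -> : (fun a => - X a) = (fun a => (- 1) * X a).
  by apply/funext => a; rewrite mulN1r.
by apply: gderM => //; apply: OS4N; rewrite /OS4 coact1 scale1r.
Qed.

Lemma gder0 : gder (fun=> 0).
Proof.
have -> : (fun=> 0) = (fun a : A => 0 * E i1 i1 a).
  by apply/funext => a; rewrite mul0r.
exact (gderM (OS40 R) (gder_E i1 i1)).
Qed.

Lemma gder_sum (I : Type) (r : seq I) (F : I -> A -> A) :
  (forall i, gder (F i)) -> gder (fun a => \sum_(i <- r) F i a).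
Proof.
move=> hF; elim: r => [|i r IH].
  have -> : (fun a => \sum_(i <- [::]) F i a) = (fun=> 0).
    by apply/funext => a; rewrite big_nil.
  exact: gder0.
have -> : (fun a => \sum_(i <- i :: r) F i a) = (fun a => F i a + \sum_(i <- r) F i a).
  by apply/funext => a; rewrite big_cons.
exact: (gderD (hF i) IH).
Qed.

Lemma derivation_eq X Y : linear X -> linear Y -> derivation X -> derivation Y ->
  (forall I J, X (gen I J) = Y (gen I J)) -> forall a, X a = Y a.
Proof.
have der0 Z : derivation Z -> Z 1 = 0.
  move=> dZ; have := dZ 1 1; rewrite mulr1 mul1r mulr1 => e.
  by apply: (addrI (Z 1)); rewrite -e addr0.
move=> lX lY dX dY g; apply: A_ind => [|c a e|a b ea eb|a b ea eb|//].
- by rewrite !der0.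
- by rewrite !linZ // e.
- by rewrite !linD // ea eb.
by rewrite dX dY ea eb.
Qed.

Definition has_weight (r : weight) X := forall s a, bhom s a -> bhom (s.1 + r, s.2) (X a).

Lemma hw_der r X : linear X -> derivation X ->
  (forall I J, bhom (wt I + r, wt J) (X (gen I J))) -> has_weight r X.
Proof.
move=> lX dX g.
have X1 : X 1 = 0.
  have := dX 1 1; rewrite mulr1 mul1r mulr1 => e.
  by apply: (addrI (X 1)); rewrite -e addr0.
have hX m : bhom ((bwt m).1 + r, (bwt m).2) (X (cls 'X_[m])).
  elim/mnm_ind: m => [|k m IH]; first by rewrite mpolyX0 rmorph1 X1; exact: Graded0.
  have -> : cls 'X_[U_(k) + m] = cls 'X_k * cls 'X_[m] by rewrite mpolyXD rmorphM.
  case/mxvec_indexP: k => I J; rewrite bwtD bwtU dX; apply: GradedD.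
    have -> : (((wt I, wt J) + bwt m).1 + r, ((wt I, wt J) + bwt m).2) =
      ((wt I + r, wt J) : biweight) + bwt m.
      by congr pair; rewrite /= addrAC.
    by apply: hom_mul; [exact: g | exact: GradedX].
  have -> : (((wt I, wt J) + bwt m).1 + r, ((wt I, wt J) + bwt m).2) =
      ((wt I, wt J) : biweight) + ((bwt m).1 + r, (bwt m).2).
      by congr pair; rewrite /= addrA.
  by apply: hom_mul => //; exact: hom_gen.
move=> s a [p -> hp]; rewrite cls_sumE (lin_sum lX) big_seq.
apply: big_ind => [|x y|m /hp e]; [exact: Graded0 | exact: GradedD |].
by rewrite (linZ lX) -e; apply: GradedZ.
Qed.

Lemma hw_E J I : has_weight (wt J - wt I) (E (R := R) J I).
Proof.
apply: hw_der => [||L M]; [exact: linear_E | exact: E_der |].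
rewrite E_gen; apply: GradedD; last apply: GradedN.
  case: eqP => [->|_]; last by rewrite mul0r; exact: Graded0.
  by rewrite mul1r addrC subrK; exact: hom_gen.
case: eqP => [->|_]; last by rewrite mul0r; exact: Graded0.
rewrite mul1r wt_prm addrA addNr add0r -wt_prm; exact: hom_gen.
Qed.

Lemma hwD r X Y : has_weight r X -> has_weight r Y -> has_weight r (fun a => X a + Y a).
Proof. by move=> hX hY s a ha; apply: GradedD; [exact: hX | exact: hY]. Qed.

Lemma hwN r X : has_weight r X -> has_weight r (fun a => - X a).
Proof. by move=> hX s a ha; apply: GradedN; exact: hX. Qed.

Lemma hwM q r X b : bhom (q, 0) b -> has_weight r X -> has_weight (q + r) (fun a => b * X a).
Proof.
move=> hb hX s a ha; have := hom_mul hb (hX _ _ ha).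
by apply: Graded_sub => t ->; congr pair; rewrite /= ?add0r // addrCA.
Qed.

Lemma hw_genE L J I r : r = wt L + (wt J - wt I) ->
  has_weight r (fun a => gen L i5 * E J I a).
Proof. by move=> ->; apply: hwM; [exact: hom_gen | exact: hw_E]. Qed.

Lemma gder_genE L J I : gder (fun a => gen L i5 * E J I a).
Proof. by apply: gderM; [exact: OS4_gen | exact: gder_E]. Qed.

Lemma star_u1 : star (u1 R) = gen i3 i5. Proof. exact: star_gen. Qed.
Lemma star_u2 : star (u2 R) = gen i4 i5. Proof. exact: star_gen. Qed.

Lemma K1E a : K1 a = gen i5 i5 * E i2 i2 a + gen i4 i5 * E i5 i4 a + gen i2 i5 * E i4 i5 a.
Proof. by rewrite /K1 star_u2. Qed.
Lemma K2E a : K2 a = gen i5 i5 * E i1 i1 a + gen i3 i5 * E i5 i3 a + gen i1 i5 * E i3 i5 a.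
Proof. by rewrite /K2 star_u1. Qed.
Lemma W01E a : W01 a = gen i2 i5 * E i1 i1 a + gen i3 i5 * E i2 i3 a + gen i1 i5 * E i3 i4 a.
Proof. by rewrite /W01 star_u1. Qed.
Lemma W0m1E a : W0m1 a = gen i4 i5 * E i1 i1 a + gen i3 i5 * E i4 i3 a + gen i1 i5 * E i3 i2 a.
Proof. by rewrite /W0m1 star_u1 star_u2. Qed.
Lemma W10E a : W10 a = gen i1 i5 * E i2 i2 a - gen i4 i5 * E i2 i3 a + gen i2 i5 * E i4 i3 a.
Proof. by rewrite /W10 star_u2. Qed.
Lemma Wm10E a : Wm10 a = gen i3 i5 * E i2 i2 a + gen i4 i5 * E i3 i4 a - gen i2 i5 * E i3 i2 a.
Proof. by rewrite /Wm10 star_u1 star_u2. Qed.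
Lemma W11E a : W11 a = gen i5 i5 * E i2 i3 a + gen i1 i5 * E i5 i4 a - gen i2 i5 * E i5 i3 a.
Proof. by []. Qed.
Lemma Wm1m1E a : Wm1m1 a = gen i5 i5 * E i3 i2 a + gen i3 i5 * E i4 i5 a - gen i4 i5 * E i3 i5 a.
Proof. by rewrite /Wm1m1 star_u1 star_u2. Qed.
Lemma W1m1E a : W1m1 a = - (gen i5 i5 * E i4 i3 a) + gen i4 i5 * E i5 i3 a + gen i1 i5 * E i4 i5 a.
Proof. by rewrite /W1m1 star_u2 mulNr. Qed.
Lemma Wm11E a : Wm11 a = - (gen i5 i5 * E i3 i4 a) + gen i2 i5 * E i3 i5 a + gen i3 i5 * E i5 i4 a.
Proof. by rewrite /Wm11 star_u1 mulNr. Qed.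

End Gauge.

(** * Vertical fields and the classification *)

Lemma ord5_ind (P : 'I_5 -> Prop) : P i1 -> P i2 -> P i3 -> P i4 -> P i5 -> forall I, P I.
Proof.
move=> h1 h2 h3 h4 h5 I.
case: I => [[|[|[|[|[|]]]]]] // h; [move: h1|move: h2|move: h3|move: h4|move: h5];
 congr (P _); exact: val_inj.
Qed.

Lemma sum5 (V : nmodType) (F : 'I_5 -> V) :
  \sum_K F K = F i1 + F i2 + F i3 + F i4 + F i5.
Proof.
rewrite !big_ord_recl big_ord0 addr0 !addrA; do 4?[congr (_ + _)];
  congr F; exact: val_inj.
Qed.

Lemma prm1 : prm i1 = i3. Proof. by []. Qed.
Lemma prm2 : prm i2 = i4. Proof. by []. Qed.
Lemma prm3 : prm i3 = i1. Proof. by []. Qed.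
Lemma prm4 : prm i4 = i2. Proof. by []. Qed.
Lemma prm5 : prm i5 = i5. Proof. by []. Qed.
Definition prmE := (prm1, prm2, prm3, prm4, prm5).

Section Fields.
Variable T : comNzRingType.
Implicit Types (n m : 'I_5 -> T) (S : 'I_5 -> 'I_5 -> T).

(* The value of E J I on the L-th entry of a column [m] of N. *)
Definition row_E m J I L : T := (L == I)%:R * m J - (L == prm J)%:R * m (prm I).

(** The fields act on each column [m] of N separately, with coefficients from the last column [n].
    With [n] and [m] free over any commutative ring, verticality is the case m = n, and both it and
    the decomposition below become polynomial identities. *)
Definition row_K1 n m L :=
  n i5 * row_E m i2 i2 L + n i4 * row_E m i5 i4 L + n i2 * row_E m i4 i5 L.
Definition row_K2 n m L :=
  n i5 * row_E m i1 i1 L + n i3 * row_E m i5 i3 L + n i1 * row_E m i3 i5 L.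
Definition row_W01 n m L :=
  n i2 * row_E m i1 i1 L + n i3 * row_E m i2 i3 L + n i1 * row_E m i3 i4 L.
Definition row_W0m1 n m L :=
  n i4 * row_E m i1 i1 L + n i3 * row_E m i4 i3 L + n i1 * row_E m i3 i2 L.
Definition row_W10 n m L :=
  n i1 * row_E m i2 i2 L - n i4 * row_E m i2 i3 L + n i2 * row_E m i4 i3 L.
Definition row_Wm10 n m L :=
  n i3 * row_E m i2 i2 L + n i4 * row_E m i3 i4 L - n i2 * row_E m i3 i2 L.
Definition row_W11 n m L :=
  n i5 * row_E m i2 i3 L + n i1 * row_E m i5 i4 L - n i2 * row_E m i5 i3 L.
Definition row_Wm1m1 n m L :=
  n i5 * row_E m i3 i2 L + n i3 * row_E m i4 i5 L - n i4 * row_E m i3 i5 L.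
Definition row_W1m1 n m L :=
  - (n i5 * row_E m i4 i3 L) + n i4 * row_E m i5 i3 L + n i1 * row_E m i4 i5 L.
Definition row_Wm11 n m L :=
  - (n i5 * row_E m i3 i4 L) + n i2 * row_E m i3 i5 L + n i3 * row_E m i5 i4 L.

Ltac row_vert := apply: ord5_ind; rewrite /row_K1 /row_K2 /row_W01 /row_W0m1 /row_W10
  /row_Wm10 /row_W11 /row_Wm1m1 /row_W1m1 /row_Wm11 /row_E !prmE /=; ring.

Lemma row_K1_vert n : forall L, row_K1 n n L = 0. Proof. row_vert. Qed.
Lemma row_K2_vert n : forall L, row_K2 n n L = 0. Proof. row_vert. Qed.
Lemma row_W01_vert n : forall L, row_W01 n n L = 0. Proof. row_vert. Qed.
Lemma row_W0m1_vert n : forall L, row_W0m1 n n L = 0. Proof. row_vert. Qed.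
Lemma row_W10_vert n : forall L, row_W10 n n L = 0. Proof. row_vert. Qed.
Lemma row_Wm10_vert n : forall L, row_Wm10 n n L = 0. Proof. row_vert. Qed.
Lemma row_W11_vert n : forall L, row_W11 n n L = 0. Proof. row_vert. Qed.
Lemma row_Wm1m1_vert n : forall L, row_Wm1m1 n n L = 0. Proof. row_vert. Qed.
Lemma row_W1m1_vert n : forall L, row_W1m1 n n L = 0. Proof. row_vert. Qed.
Lemma row_Wm11_vert n : forall L, row_Wm11 n n L = 0. Proof. row_vert. Qed.

Definition contract S n I J K := S I J * n K - S I K * n J + S J K * n I.

(* A skew form S annihilating the vector v = (n (prm K))_K, which satisfies
   n.v = 1, is the interior product by v of the three-form [contract S n];
   the ten vector fields are, up to sign, the interior products by v of the
   basis three-forms. *)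
Lemma row_decomposition S n m :
  (forall I, S I I = 0) -> (forall I J, S J I = - S I J) ->
  (forall I, \sum_K S I K * n (prm K) = 0) -> \sum_K n K * n (prm K) = 1 ->
  forall L, \sum_K S L K * m (prm K) =
    contract S n i2 i4 i5 * row_K1 n m L + contract S n i1 i3 i5 * row_K2 n m L
    + (- contract S n i2 i3 i4 * row_W10 n m L + contract S n i1 i2 i4 * row_Wm10 n m L
    + contract S n i1 i3 i4 * row_W01 n m L - contract S n i1 i2 i3 * row_W0m1 n m L
    + contract S n i3 i4 i5 * row_W11 n m L - contract S n i1 i2 i5 * row_Wm1m1 n m L
    + contract S n i2 i3 i5 * row_W1m1 n m L + contract S n i1 i4 i5 * row_Wm11 n m L).
Proof.
move=> S0 Sa Sv nv L.
(* The left side is the interior product by v of the three-form, paired with m, before n.v = 1 and S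
   v = 0 are used. In this form the equality is a polynomial identity in the entries of S, n and m,
   modulo the skewness of S alone. *)
suff H : (\sum_K S L K * m (prm K)) * (\sum_K n K * n (prm K)) -
   \sum_K m (prm K) * (n K * (\sum_J S L J * n (prm J)) - n L * (\sum_J S K J * n (prm J))) =
    contract S n i2 i4 i5 * row_K1 n m L + contract S n i1 i3 i5 * row_K2 n m L
    + (- contract S n i2 i3 i4 * row_W10 n m L + contract S n i1 i2 i4 * row_Wm10 n m L
    + contract S n i1 i3 i4 * row_W01 n m L - contract S n i1 i2 i3 * row_W0m1 n m L
    + contract S n i3 i4 i5 * row_W11 n m L - contract S n i1 i2 i5 * row_Wm1m1 n m L
    + contract S n i2 i3 i5 * row_W1m1 n m L + contract S n i1 i4 i5 * row_Wm11 n m L).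
  rewrite -H nv mulr1 [X in _ - X]big1 ?subr0 // => K _.
  by rewrite !Sv !mulr0 subr0 mulr0.
have e21 := Sa i1 i2; have e31 := Sa i1 i3; have e41 := Sa i1 i4; have e51 := Sa i1 i5.
have e32 := Sa i2 i3; have e42 := Sa i2 i4; have e52 := Sa i2 i5.
have e43 := Sa i3 i4; have e53 := Sa i3 i5; have e54 := Sa i4 i5.
rewrite !sum5 /contract.
move: L; apply: ord5_ind; rewrite /row_K1 /row_K2 /row_W01 /row_W0m1 /row_W10
  /row_Wm10 /row_W11 /row_Wm1m1 /row_W1m1 /row_Wm11 /row_E !prmE /=
  !S0 ?e21 ?e31 ?e41 ?e51 ?e32 ?e42 ?e52 ?e43 ?e53 ?e54; ring.
Qed.

End Fields.

Section Generators.
Variable R : realType.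
Local Notation C := R[i].
Local Notation A := (A R).
Local Notation gen := (@gen R).
Implicit Types (a b x y : A) (X Y psi : A -> A).
Local Notation gder := (@gauge_derivation R).

Definition vertical X := forall I, X (gen I i5) = 0.

Definition gauge_generator (r : weight) X := [/\ gder X, has_weight r X & vertical X].

Local Notation gE := (@gder_genE R).
Local Notation wE := (@hw_genE R).
Local Notation n5 := (fun I => gen I i5).

Lemma K1_gen L J : K1 (gen L J) = row_K1 n5 (fun I => gen I J) L.
Proof. by rewrite K1E !E_gen. Qed.
Lemma K2_gen L J : K2 (gen L J) = row_K2 n5 (fun I => gen I J) L.
Proof. by rewrite K2E !E_gen. Qed.
Lemma W01_gen L J : W01 (gen L J) = row_W01 n5 (fun I => gen I J) L.
Proof. by rewrite W01E !E_gen. Qed.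
Lemma W0m1_gen L J : W0m1 (gen L J) = row_W0m1 n5 (fun I => gen I J) L.
Proof. by rewrite W0m1E !E_gen. Qed.
Lemma W10_gen L J : W10 (gen L J) = row_W10 n5 (fun I => gen I J) L.
Proof. by rewrite W10E !E_gen. Qed.
Lemma Wm10_gen L J : Wm10 (gen L J) = row_Wm10 n5 (fun I => gen I J) L.
Proof. by rewrite Wm10E !E_gen. Qed.
Lemma W11_gen L J : W11 (gen L J) = row_W11 n5 (fun I => gen I J) L.
Proof. by rewrite W11E !E_gen. Qed.
Lemma Wm1m1_gen L J : Wm1m1 (gen L J) = row_Wm1m1 n5 (fun I => gen I J) L.
Proof. by rewrite Wm1m1E !E_gen. Qed.
Lemma W1m1_gen L J : W1m1 (gen L J) = row_W1m1 n5 (fun I => gen I J) L.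
Proof. by rewrite W1m1E !E_gen. Qed.
Lemma Wm11_gen L J : Wm11 (gen L J) = row_Wm11 n5 (fun I => gen I J) L.
Proof. by rewrite Wm11E !E_gen. Qed.

Lemma K1_gauge : gauge_generator 0 (@K1 R).
Proof.
rewrite (funext (@K1E R)); split.
- exact: (gderD (gderD (gE _ _ _) (gE _ _ _)) (gE _ _ _)).
- by refine (hwD (hwD (wE _) (wE _)) (wE _)).
by move=> I; rewrite -K1E K1_gen row_K1_vert.
Qed.

Lemma K2_gauge : gauge_generator 0 (@K2 R).
Proof.
rewrite (funext (@K2E R)); split.
- exact: (gderD (gderD (gE _ _ _) (gE _ _ _)) (gE _ _ _)).
- by refine (hwD (hwD (wE _) (wE _)) (wE _)).
by move=> I; rewrite -K2E K2_gen row_K2_vert.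
Qed.

Lemma W01_gauge : gauge_generator (0, 1) (@W01 R).
Proof.
rewrite (funext (@W01E R)); split.
- exact: (gderD (gderD (gE _ _ _) (gE _ _ _)) (gE _ _ _)).
- by refine (hwD (hwD (wE _) (wE _)) (wE _)).
by move=> I; rewrite -W01E W01_gen row_W01_vert.
Qed.

Lemma W0m1_gauge : gauge_generator (0, - 1) (@W0m1 R).
Proof.
rewrite (funext (@W0m1E R)); split.
- exact: (gderD (gderD (gE _ _ _) (gE _ _ _)) (gE _ _ _)).
- by refine (hwD (hwD (wE _) (wE _)) (wE _)).
by move=> I; rewrite -W0m1E W0m1_gen row_W0m1_vert.
Qed.

Lemma W10_gauge : gauge_generator (1, 0) (@W10 R).
Proof.
rewrite (funext (@W10E R)); split.
- exact: (gderD (gderD (gE _ _ _) (gderN (gE _ _ _))) (gE _ _ _)).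
- by refine (hwD (hwD (wE _) (hwN (wE _))) (wE _)).
by move=> I; rewrite -W10E W10_gen row_W10_vert.
Qed.

Lemma Wm10_gauge : gauge_generator (- 1, 0) (@Wm10 R).
Proof.
rewrite (funext (@Wm10E R)); split.
- exact: (gderD (gderD (gE _ _ _) (gE _ _ _)) (gderN (gE _ _ _))).
- by refine (hwD (hwD (wE _) (wE _)) (hwN (wE _))).
by move=> I; rewrite -Wm10E Wm10_gen row_Wm10_vert.
Qed.

Lemma W11_gauge : gauge_generator (1, 1) (@W11 R).
Proof.
rewrite (funext (@W11E R)); split.
- exact: (gderD (gderD (gE _ _ _) (gE _ _ _)) (gderN (gE _ _ _))).
- by refine (hwD (hwD (wE _) (wE _)) (hwN (wE _))).
by move=> I; rewrite -W11E W11_gen row_W11_vert.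
Qed.

Lemma Wm1m1_gauge : gauge_generator (- 1, - 1) (@Wm1m1 R).
Proof.
rewrite (funext (@Wm1m1E R)); split.
- exact: (gderD (gderD (gE _ _ _) (gE _ _ _)) (gderN (gE _ _ _))).
- by refine (hwD (hwD (wE _) (wE _)) (hwN (wE _))).
by move=> I; rewrite -Wm1m1E Wm1m1_gen row_Wm1m1_vert.
Qed.

Lemma W1m1_gauge : gauge_generator (1, - 1) (@W1m1 R).
Proof.
rewrite (funext (@W1m1E R)); split.
- exact: (gderD (gderD (gderN (gE _ _ _)) (gE _ _ _)) (gE _ _ _)).
- by refine (hwD (hwD (hwN (wE _)) (wE _)) (wE _)).
by move=> I; rewrite -W1m1E W1m1_gen row_W1m1_vert.
Qed.

Lemma Wm11_gauge : gauge_generator (- 1, 1) (@Wm11 R).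
Proof.
rewrite (funext (@Wm11E R)); split.
- exact: (gderD (gderD (gderN (gE _ _ _)) (gE _ _ _)) (gE _ _ _)).
- by refine (hwD (hwD (hwN (wE _)) (wE _)) (wE _)).
by move=> I; rewrite -Wm11E Wm11_gen row_Wm11_vert.
Qed.

Lemma K_gauge j : gauge_generator 0 (@K R j).
Proof.
by case: j => [[|[|]]] // h; [exact: K1_gauge | exact: K2_gauge].
Qed.

Lemma W_gauge r : r \in Gamma -> gauge_generator r (@W R r).
Proof.
rewrite !inE => /orP[/eqP->|/orP[/eqP->|/orP[/eqP->|/orP[/eqP->|/orP[/eqP->|/orP[/eqP->|/orP[/eqP->|/eqP->]]]]]]].
- exact: W10_gauge.
- exact: Wm10_gauge.
- exact: W01_gauge.
- exact: W0m1_gauge.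
- exact: W11_gauge.
- exact: Wm1m1_gauge.
- exact: W1m1_gauge.
exact: Wm11_gauge.
Qed.

End Generators.

(** * Points of SO(4) and tangent vectors at the identity *)

Section Evaluation.
Variable B : comNzRingType.
Local Notation cl := (OSO_class (Q4 B)).
Local Notation OSO := (OSO (Q4 B)).
Implicit Types (a b : B) (s t : OSO).

Definition hat (D : 'M[B]_4) (e : B) : 'M[B]_5 := block_mx D 0 0 e%:M : 'M[B]_(4 + 1).
Definition OSO4_hat : 'M[OSO]_5 := block_mx (OSO_gen (Q4 B)) 0 0 1%:M : 'M[OSO]_(4 + 1).

Lemma hat_split D e K J : hat D e K J =
  match split (K : 'I_(4 + 1)), split (J : 'I_(4 + 1)) with
  | inl x, inl y => D x y | inl x, inr y => 0
  | inr x, inl y => 0 | inr x, inr y => e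
  end.
Proof.
apply: (etrans (@block_mxE B 4 1 4 1 _ _ _ _ K J)).
case: (split _) => x; case: (split _) => y //; rewrite ?mxE //.
by rewrite !ord1 mulr1n.
Qed.

Lemma OSO4_hat_split K J : OSO4_hat K J =
  match split (K : 'I_(4 + 1)), split (J : 'I_(4 + 1)) with
  | inl x, inl y => cl (varmx B 4 x y) | inl x, inr y => 0
  | inr x, inl y => 0 | inr x, inr y => 1
  end.
Proof.
apply: (etrans (@block_mxE OSO 4 1 4 1 _ _ _ _ K J)).
case: (split _) => x; case: (split _) => y; rewrite mxE; [exact: erefl|exact: erefl|exact: erefl|].
by rewrite !ord1 eqxx mulr1n.
Qed.

Lemma hat1 : hat 1%:M 1 = 1%:M.
Proof. by rewrite /hat; symmetry; exact: (@scalar_mx_block B 4 1 1). Qed.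

Lemma cl_ind4 (P : OSO -> Prop) : (forall p, P (cl p)) -> forall t, P t.
Proof. by move=> h t; rewrite -[t]OSO_classK. Qed.

Lemma map_Qpoly_4 (S : pzRingType) (phi : {rmorphism {mpoly B[4 * 4]} -> S}) :
  map_mx phi (Qpoly (Q4 B)) = Q4 S.
Proof. by rewrite /Qpoly map_Q4 map_Q4. Qed.

Section Ev.
Variable D : 'M[B]_4.
Hypotheses (D_l : D^T *m Q4 B *m D = Q4 B) (D_r : D *m Q4 B *m D^T = Q4 B)
  (D_det : \det D = 1).

Definition ev_poly : {rmorphism {mpoly B[4 * 4]} -> B} :=
  mmap idfun (fun k => mxvec D 0 k).
Definition ev t : B := ev_poly (repr t).

Lemma ev_poly_varmx : map_mx ev_poly (varmx B 4) = D.
Proof. exact: (mmap_varmx idfun). Qed.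

Lemma ev_cl p : ev (cl p) = ev_poly p.
Proof.
apply: (@rmorph_OSO _ _ (Q4 B) _ ev_poly); last exact: OSO_classK.
- by rewrite ev_poly_varmx map_Qpoly_4.
- by rewrite ev_poly_varmx map_Qpoly_4.
by rewrite ev_poly_varmx.
Qed.

Lemma evM s t : ev (s * t) = ev s * ev t.
Proof.
by move: s t; elim/cl_ind4=> p; elim/cl_ind4=> q; rewrite -rmorphM !ev_cl rmorphM.
Qed.

Lemma evD s t : ev (s + t) = ev s + ev t.
Proof.
by move: s t; elim/cl_ind4=> p; elim/cl_ind4=> q; rewrite -rmorphD !ev_cl rmorphD.
Qed.

Lemma ev1 : ev 1 = 1.
Proof. by rewrite -(rmorph1 cl) ev_cl rmorph1. Qed.

Lemma ev_scale a t : ev (a *: t) = a * ev t.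
Proof.
move: t; elim/cl_ind4=> p; rewrite -OSO_classZ !ev_cl -mul_mpolyC rmorphM /=.
by rewrite [mmap _ _ a%:MP]mmapC.
Qed.

Lemma ev0 : ev 0 = 0.
Proof. by apply: (addrI (ev 0)); rewrite -evD !addr0. Qed.

Lemma ev_sum (I : Type) (r : seq I) F :
  ev (\sum_(i <- r) F i) = \sum_(i <- r) ev (F i).
Proof. exact: (big_morph _ evD ev0). Qed.

Lemma ev_hat K J : ev (OSO4_hat K J) = hat D 1 K J.
Proof.
rewrite OSO4_hat_split hat_split; case: (split _) => x; case: (split _) => y.
- by rewrite ev_cl; have := congr1 (fun M : 'M_4 => M x y) ev_poly_varmx; rewrite mxE => <-.
- exact: ev0.
- exact: ev0.
exact: ev1.
Qed.
End Ev.

Section Dz.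
Variable z : 'M[B]_4.
Hypotheses (zQ : z^T *m Q4 B + Q4 B *m z = 0) (tr_z : \tr z = 0).

Let ep : {rmorphism {mpoly B[4 * 4]} -> B} := ev_poly 1%:M.

(** The derivative at the identity in the direction [z], a derivation along the counit; it descends
    to the quotient because [z] lies in so(4). *)
Let d (p : {mpoly B[4 * 4]}) : B := \sum_k mxvec z 0 k * ep p^`M(k).

Let d_linear : linear_for *%R d.
Proof.
move=> c p q; rewrite /d mulr_sumr -big_split; apply: eq_bigr => k _ /=.
by rewrite mderivD mderivZ -mul_mpolyC rmorphD rmorphM /= [mmap _ _ c%:MP]mmapC mulrDr mulrCA.
Qed.

Let d' : {linear {mpoly B[4 * 4]} -> B | *%R} :=
  HB.pack d (GRing.isLinear.Build B _ B *%R d d_linear).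

Let dM p q : d' (p * q) = d' p * ep q + ep p * d' q.
Proof.
rewrite -[LHS]/(d (p * q)) -[d' p]/(d p) -[d' q]/(d q) /d mulr_suml mulr_sumr -big_split.
apply: eq_bigr => k _ /=; rewrite mderivM rmorphD !rmorphM mulrDr.
by congr (_ + _); [exact: mulrA | exact: mulrCA].
Qed.

Let dN : map_mx d' (varmx B 4) = z.
Proof.
apply/matrixP=> i j; rewrite !mxE -[LHS]/(d _) /d (bigD1 (mxvec_index i j)) //=.
rewrite mxvecE mderivXU eqxx -/ep rmorph1 mulr1 big1 ?addr0 // => k /negbTE kij.
by rewrite mderivXU eq_sym kij -/ep rmorph0 mulr0.
Qed.

Definition tangent t : B := d' (repr t).

Lemma tangent_cl p : tangent (cl p) = d p.
Proof.
have h1 := ev_poly_varmx 1%:M.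
apply: (@der_OSO _ _ (Q4 B) _ ep _ _ _ d' dM); last exact: OSO_classK.
- by rewrite h1 map_Qpoly_4 trmx1 mul1mx mulmx1.
- by rewrite h1 map_Qpoly_4 trmx1 mul1mx mulmx1.
- by rewrite h1 det1.
- apply/matrixP=> i j; rewrite !mxE -[LHS]/(d _) /d.
  by rewrite big1 // => k _; rewrite mderivC -/ep rmorph0 mulr0.
- by rewrite dN h1 map_Qpoly_4 trmx1 mulmx1 mul1mx.
- rewrite dN h1 map_Qpoly_4 trmx1 mulmx1 mul1mx.
  transitivity (Q4 B *m (z^T *m Q4 B + Q4 B *m z) *m Q4 B).
    rewrite mulmxDr mulmxDl -!mulmxA Q4K mulmx1 addrC; congr (_ + _).
    by rewrite !mulmxA Q4K mul1mx.
  by rewrite zQ mulmx0 mul0mx.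
rewrite dN h1.
have -> : \adj (1%:M : 'M[B]_4) = 1%:M.
  by have := mul_mx_adj (1%:M : 'M[B]_4); rewrite mul1mx det1.
by rewrite mulmx1.
Qed.

Lemma tangentM s t : tangent (s * t) = tangent s * ev 1%:M t + ev 1%:M s * tangent t.
Proof.
have h1 : (1%:M : 'M[B]_4)^T *m Q4 B *m 1%:M = Q4 B by rewrite trmx1 mul1mx mulmx1.
have h2 : (1%:M : 'M[B]_4) *m Q4 B *m 1%:M^T = Q4 B by rewrite trmx1 mul1mx mulmx1.
have h3 : \det (1%:M : 'M[B]_4) = 1 by exact: det1.
move: s t; elim/cl_ind4=> p; elim/cl_ind4=> q.
by rewrite -rmorphM !tangent_cl !ev_cl //; exact: dM.
Qed.

Lemma tangentD s t : tangent (s + t) = tangent s + tangent t.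
Proof.
move: s t; elim/cl_ind4=> p; elim/cl_ind4=> q.
by rewrite -rmorphD !tangent_cl; exact: (raddfD d').
Qed.

Lemma tangent_scale a t : tangent (a *: t) = a * tangent t.
Proof.
by move: t; elim/cl_ind4=> p; rewrite -OSO_classZ !tangent_cl; exact: (linearZ_LR d').
Qed.

Lemma tangent0 : tangent 0 = 0.
Proof. by apply: (addrI (tangent 0)); rewrite -tangentD !addr0. Qed.

Lemma tangent1 : tangent 1 = 0.
Proof.
rewrite -(rmorph1 cl) tangent_cl /d big1 // => k _.
by rewrite -mpolyC1 mderivC rmorph0 mulr0.
Qed.

Lemma tangent_sum (I : Type) (r : seq I) F :
  tangent (\sum_(i <- r) F i) = \sum_(i <- r) tangent (F i).
Proof. exact: (big_morph _ tangentD tangent0). Qed.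

Lemma tangent_hat K J : tangent (OSO4_hat K J) = hat z 0 K J.
Proof.
rewrite OSO4_hat_split hat_split; case: (split _) => x; case: (split _) => y.
- by rewrite tangent_cl; have := congr1 (fun M : 'M_4 => M x y) dN; rewrite mxE => <-.
- exact: tangent0.
- exact: tangent0.
exact: tangent1.
Qed.
End Dz.
End Evaluation.

Lemma block_so_diag (B : comNzRingType) m n (z Q : 'M[B]_m) (e : 'M[B]_n) :
  (block_mx z 0 0 e)^T *m block_mx Q 0 0 1%:M + block_mx Q 0 0 1%:M *m block_mx z 0 0 e =
  block_mx (z^T *m Q + Q *m z) 0 0 (e^T + e).
Proof.
rewrite tr_block_mx !mulmx_block add_block_mx !trmx0.
by rewrite !(mulmx0, mul0mx, mulmx1, mul1mx, addr0, add0r).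
Qed.

(** The stabiliser of the last basis vector in so(5) is so(4): the form pairs the index 5 with
    itself, so a vanishing last column forces a vanishing last row. *)
Lemma block_so (B : comNzRingType) (zh : 'M[B]_5) :
  zh^T *m Q5 B + Q5 B *m zh = 0 -> (forall K, zh K i5 = 0) ->
  exists2 z : 'M[B]_4, zh = hat z 0 & z^T *m Q4 B + Q4 B *m z = 0.
Proof.
move=> hz col5.
have row5 J : zh i5 J = 0.
  have := congr1 (fun M : 'M_5 => M i5 J) hz.
  by rewrite mxE mulQ5 mul_Q5 !mxE col5 add0r.
have ez : zh = hat (@ulsubmx B 4 1 4 1 zh) 0.
  apply/matrixP=> K J; rewrite hat_split.
  case: split_ordP => x ->; case: split_ordP => y ->; rewrite ?mxE //.
  - rewrite -[RHS](col5 (lshift 1 x)); congr (zh _ _); apply/val_inj => /=.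
    by rewrite ord1.
  - rewrite -[RHS](row5 (lshift 1 y)); congr (zh _ _); apply/val_inj => /=.
    by rewrite ord1.
  rewrite -[RHS](row5 (rshift 4 y)); congr (zh _ _); apply/val_inj => /=.
  by rewrite ord1.
exists (@ulsubmx B 4 1 4 1 zh) => //; set z := @ulsubmx B 4 1 4 1 zh.
have := @block_so_diag B 4 1 z (Q4 B) (0%:M) => e.
have {e} : 0 = block_mx (z^T *m Q4 B + Q4 B *m z) 0 0 (0%:M^T + 0%:M) :> 'M[B]_(4 + 1).
  by rewrite -e -[LHS]hz {1 2}ez.
by move/(congr1 (@ulsubmx B 4 1 4 1)); rewrite block_mxKul => <-; apply/matrixP=> i j; rewrite !mxE.
Qed.

(** Multiplying the relation by Q and taking traces gives 2 tr z = 0. *)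
Lemma so_trace (B : comNzRingType) (z : 'M[B]_4) :
  (forall b : B, b + b = 0 -> b = 0) -> z^T *m Q4 B + Q4 B *m z = 0 -> \tr z = 0.
Proof.
move=> h2 hz; apply: h2.
have : \tr ((z^T *m Q4 B + Q4 B *m z) *m Q4 B) = 0 by rewrite hz mul0mx raddf0.
by rewrite mulmxDl -mulmxA Q4K mulmx1 raddfD /= mxtrace_tr mxtrace_mulC mulmxA Q4K mul1mx.
Qed.

(** * Vertical equivariant derivations as combinations of the ten fields *)

Section Classification.
Variable R : realType.
Local Notation C := R[i].
Local Notation A := (A R).
Local Notation gen := (@gen R).
Implicit Types (a b x y : A) (X Y psi : A -> A).
Local Notation N := (Nmx R).

Lemma A_double0 a : a + a = 0 -> a = 0.
Proof.
rewrite -mulr2n => h; rewrite -[a](scale1r a) -(@mulVf C 2%:R) ?pnatr_eq0 //.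
by rewrite -scalerA scaler_nat h scaler0.
Qed.

Lemma coact_hat I J : coact (gen I J) = \sum_K gen I K *: OSO4_hat A K J.
Proof. exact: coact_gen. Qed.

Lemma Q4_1_l : (1%:M : 'M[A]_4)^T *m Q4 A *m 1%:M = Q4 A.
Proof. by rewrite trmx1 mul1mx mulmx1. Qed.
Lemma Q4_1_r : (1%:M : 'M[A]_4) *m Q4 A *m 1%:M^T = Q4 A.
Proof. by rewrite trmx1 mul1mx mulmx1. Qed.
Lemma Q4_1_det : \det (1%:M : 'M[A]_4) = 1. Proof. exact: det1. Qed.
Local Notation e1 lem := (lem _ _ Q4_1_l Q4_1_r Q4_1_det).

(** Evaluation at the identity is the counit, and this is the counit axiom of the coaction. *)
Lemma eps_coact a : ev 1%:M (coact a) = a.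
Proof.
elim/A_ind: a => [|c a ha|a b ha hb|a b ha hb|I J].
- by rewrite coact1 (e1 (@ev1)).
- by rewrite coactZ (e1 (@ev_scale)) ha mulr_algl.
- by rewrite coactD (e1 (@evD)) ha hb.
- by rewrite coactM (e1 (@evM)) ha hb.
rewrite coact_hat (e1 (@ev_sum)) (bigD1 J) //= big1 => [|K KJ].
  by rewrite (e1 (@ev_scale)) (e1 (@ev_hat)) hat1 mxE eqxx mulr1 addr0.
by rewrite (e1 (@ev_scale)) (e1 (@ev_hat)) hat1 mxE (negbTE KJ) mulr0.
Qed.

Section Derivation.
Variables (X : A -> A) (lX : linear X) (dX : derivation X).
Let X' : {linear A -> A} := HB.pack X (GRing.isLinear.Build C A A *:%R X lX).
Let XN : 'M[A]_5 := map_mx X N.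

Let der_mulmx m n p (Y : 'M[A]_(m, n)) (Z : 'M_(n, p)) :
  map_mx X (Y *m Z) = map_mx X Y *m Z + Y *m map_mx X Z.
Proof.
apply/matrixP=> i j; rewrite !mxE (lin_sum lX) -big_split /=.
by apply: eq_bigr => k _; rewrite dX !mxE.
Qed.

Let X1 : X 1 = 0.
Proof. exact: (@der1 A A idfun X' dX). Qed.

Let XQ : map_mx X (Q5 A) = 0.
Proof.
by apply/matrixP=> i j; rewrite mxE Q5E [RHS]mxE; case: (j == prm i);
  rewrite ?X1 ?(lin0 lX).
Qed.

Lemma derivation_skew_l : XN^T *m Q5 A *m N + N^T *m Q5 A *m XN = 0.
Proof.
have h := congr1 (map_mx X) (Nmx_l R).
rewrite !der_mulmx XQ mulmx0 addr0 in h.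
by rewrite /XN matrix.map_trmx; exact: h.
Qed.

Lemma derivation_skew_r : XN *m Q5 A *m N^T + N *m Q5 A *m XN^T = 0.
Proof.
have h := congr1 (map_mx X) (Nmx_r R).
rewrite !der_mulmx XQ mulmx0 addr0 in h.
by rewrite /XN matrix.map_trmx; exact: h.
Qed.

Hypothesis vX : vertical X.

(* X is the coaction followed by the tangent vector [z] of SO(4) at the identity. *)
Lemma vertical_coinvariant b : OS4 b -> X b = 0.
Proof.
(* The inverse of N is Q N^T Q, so this is the logarithmic derivative of N along X, with values in
   so(5). Its last column vanishes by verticality. *)
pose zh := Q5 A *m N^T *m Q5 A *m XN.
have Nzh : N *m zh = XN.
  rewrite /zh !mulmxA Nmx_r Q5K mul1mx.
  by [].
have Qzh : Q5 A *m zh = N^T *m Q5 A *m XN by rewrite /zh !mulmxA Q5K mul1mx.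
have skew : zh^T *m Q5 A + Q5 A *m zh = 0.
  by rewrite -{1}[Q5 A]trQ5 -trmx_mul Qzh !trmx_mul trmxK trQ5 mulmxA derivation_skew_l.
have col5 K : zh K i5 = 0.
  by rewrite mxE big1 // => L _; rewrite !mxE vX mulr0.
have [z ez hz] := block_so skew col5.
have trz := so_trace A_double0 hz.
(* The right side is a derivation of A because [tangent z] is one along the counit and the counit
   undoes the coaction; comparison on the n_IJ then suffices. *)
have XE a : X a = tangent z (coact a).
  elim/A_ind: a => [|c a ha|a a' ha ha'|a a' ha ha'|I J].
  - by rewrite coact1 X1 tangent1.
  - by rewrite (linZ lX) coactZ tangent_scale // ha mulr_algl.
  - by rewrite (linD lX) coactD tangentD // ha ha'.
  - by rewrite dX coactM tangentM // ha ha' !eps_coact.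
  have := congr1 (fun M : 'M_5 => M I J) Nzh; rewrite !mxE => <-.
  rewrite coact_hat tangent_sum //; apply: eq_bigr => K _.
  by rewrite tangent_scale // tangent_hat // -ez mxE.
move=> hb; rewrite XE; have -> : coact b = b%:A by [].
by rewrite (tangent_scale hz trz) (tangent1 hz trz) mulr0.
Qed.

End Derivation.

Definition skew_form X I K := (map_mx X N *m Q5 A *m N^T) I K.

Lemma sum_mulmx_Q5 (S : comNzRingType) (Y Z : 'M[S]_5) I J :
  (Y *m Q5 S *m Z) I J = \sum_K Y I K * Z (prm K) J.
Proof. by rewrite -mulmxA mxE; apply: eq_bigr => K _; rewrite mul_Q5. Qed.

(** Both sides are derivations, so they are compared on the n_LJ, one column J at a time, with the
    last column of N in the role of n. *)
Lemma gauge_decomposition X : gauge_derivation X -> vertical X ->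
  let g := contract (skew_form X) (fun I => gen I i5) in
  forall a, X a =
    g i2 i4 i5 * K1 a + g i1 i3 i5 * K2 a
    + (- g i2 i3 i4 * W10 a + g i1 i2 i4 * Wm10 a
    + g i1 i3 i4 * W01 a - g i1 i2 i3 * W0m1 a
    + g i3 i4 i5 * W11 a - g i1 i2 i5 * Wm1m1 a
    + g i2 i3 i5 * W1m1 a + g i1 i4 i5 * Wm11 a).
Proof.
move=> [lX dX eX] vX g.
have SN L J : X (gen L J) = \sum_K skew_form X L K * gen (prm K) J.
  (* One product bracketed in two ways: N^T Q N = Q collapses it to X(N), while the other bracketing
     reads S Q N. *)
  have := congr1 (fun M : 'M_5 => M L J) (erefl (map_mx X N *m Q5 A *m (N^T *m Q5 A *m N))).
  rewrite {1}Nmx_l -mulmxA Q5K mulmx1 !mulmxA sum_mulmx_Q5 => h.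
  transitivity (map_mx X N L J); first by rewrite !mxE.
  by rewrite h; apply: eq_bigr => K _; congr (_ * _); rewrite mxE.
have Sa I J : skew_form X J I = - skew_form X I J.
  have := congr1 (fun M : 'M_5 => M I J) (derivation_skew_r lX dX).
  have -> : N *m Q5 A *m (map_mx X N)^T = (map_mx X N *m Q5 A *m N^T)^T.
    by rewrite !trmx_mul trmxK trQ5 mulmxA.
  by rewrite mxE [X in _ + X]mxE [RHS]mxE => /eqP; rewrite addrC addr_eq0 => /eqP.
have S0 I : skew_form X I I = 0.
  by apply: A_double0; rewrite {1}Sa addNr.
have Sv I : \sum_K skew_form X I K * gen (prm K) i5 = 0 by rewrite -SN vX.
have nv : \sum_K gen K i5 * gen (prm K) i5 = 1.
  have := congr1 (fun M : 'M_5 => M i5 i5) (Nmx_l R).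
  rewrite sum_mulmx_Q5 Q5E eqxx mulr1n => h; apply: etrans h.
  by apply: eq_bigr => K _; rewrite !mxE.
have [[[l1 d1 _] _ _] [[l2 d2 _] _ _]] := (K1_gauge R, K2_gauge R).
have [[[l3 d3 _] _ _] [[l4 d4 _] _ _]] := (W10_gauge R, Wm10_gauge R).
have [[[l5 d5 _] _ _] [[l6 d6 _] _ _]] := (W01_gauge R, W0m1_gauge R).
have [[[l7 d7 _] _ _] [[l8 d8 _] _ _]] := (W11_gauge R, Wm1m1_gauge R).
have [[[l9 d9 _] _ _] [[l10 d10 _] _ _]] := (W1m1_gauge R, Wm11_gauge R).
have dD Y Z : derivation Y -> derivation Z -> derivation (fun a => Y a + Z a).
  by move=> dY dZ a b; rewrite dY dZ mulrDl mulrDr addrACA.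
have dM b Y : derivation Y -> derivation (fun a => b * Y a).
  by move=> dY a a'; rewrite dY mulrDr !mulrA [b * a]mulrC.
have dN Y : derivation Y -> derivation (fun a => - Y a).
  by move=> dY a a'; rewrite dY opprD mulNr mulrN.
apply: derivation_eq => //.
- exact: (linear_add (linear_add (linear_mull _ l1) (linear_mull _ l2))
    (linear_add (linear_add (linear_add (linear_add (linear_add (linear_add (linear_add
     (linear_mull _ l3) (linear_mull _ l4)) (linear_mull _ l5)) (linear_opp (linear_mull _ l6)))
     (linear_mull _ l7)) (linear_opp (linear_mull _ l8))) (linear_mull _ l9)) (linear_mull _ l10))).
- exact: (dD _ _ (dD _ _ (dM _ _ d1) (dM _ _ d2))
    (dD _ _ (dD _ _ (dD _ _ (dD _ _ (dD _ _ (dD _ _ (dD _ _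
     (dM _ _ d3) (dM _ _ d4)) (dM _ _ d5)) (dN _ (dM _ _ d6)))
     (dM _ _ d7)) (dN _ (dM _ _ d8))) (dM _ _ d9)) (dM _ _ d10))).
move=> I J; rewrite SN (row_decomposition (fun K => gen K J) S0 Sa Sv nv).
by rewrite K1_gen K2_gen W10_gen Wm10_gen W01_gen W0m1_gen W11_gen Wm1m1_gen W1m1_gen Wm11_gen.
Qed.
End Classification.

Lemma form_cancel (S : comNzRingType) (Q M Y Z : 'M[S]_5) :
  M *m Q *m M^T = Q -> (Y *m M) *m Q *m (Z *m M)^T = Y *m Q *m Z^T.
Proof. by move=> h; rewrite trmx_mul -[in RHS]h !mulmxA. Qed.

Lemma nth_app (T U : Type) (f0 : T -> U) s k x :
  nth f0 s k x = nth (f0 x) [seq f x | f <- s] k.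
Proof. by elim: s k => [|f s IH] [|k] //=. Qed.

Lemma sum_two_nth (B : pzRingType) (c1 c2 c w1 w2 w : B) :
  \sum_(j < 2) nth c [:: c1; c2] j * nth w [:: w1; w2] j = c1 * w1 + c2 * w2.
Proof. by rewrite !big_ord_recl big_ord0 addr0. Qed.

Lemma sum_Gamma_nth (B : pzRingType) (c1 c2 c3 c4 c5 c6 c7 c8 c w1 w2 w3 w4 w5 w6 w7 w8 w : B) :
  \sum_(r <- Gamma) nth c [:: c1; c2; c3; c4; c5; c6; c7; c8] (index r Gamma) *
    nth w [:: w1; w2; w3; w4; w5; w6; w7; w8] (index r Gamma) =
  c1 * w1 + c2 * w2 + c3 * w3 + c4 * w4 + c5 * w5 + c6 * w6 + c7 * w7 + c8 * w8.
Proof. by rewrite !big_cons big_nil addr0 !addrA. Qed.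

Section Span.
Variable R : realType.
Local Notation C := R[i].
Local Notation A := (A R).
Local Notation AH := (AH R).
Local Notation gen := (@gen R).
Implicit Types (a b x y : A) (X Y psi : A -> A).
Local Notation N := (Nmx R).
Local Notation Mhat := (Mhat R).

Let map_coact_mul m n p (Y : 'M[A]_(m, n)) (Z : 'M_(n, p)) :
  map_mx (@coact R) (Y *m Z) = map_mx (@coact R) Y *m map_mx (@coact R) Z.
Proof.
apply/matrixP=> i j; rewrite !mxE (big_morph _ (@coactD R) (coact0 R)).
by apply: eq_bigr => k _; rewrite coactM !mxE.
Qed.

(** The coaction multiplies both N and, by equivariance, X(N) on the right by the same orthogonal
    matrix diag(M, 1), which cancels in X(N) Q N^T. *)
Lemma skew_form_OS4 X I K : gauge_derivation X -> OS4 (skew_form X I K).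
Proof.
move=> [lX dX eX].
pose YA (Y : 'M[A]_5) : 'M[AH]_5 := map_mx (in_alg AH) Y.
have cN : map_mx (@coact R) N = YA N *m Mhat.
  apply/matrixP=> i j; rewrite mxE [N _ _]mxE coact_gen mxE.
  by apply: eq_bigr => k _; rewrite !mxE mulr_algl.
have cX : map_mx (@coact R) (map_mx X N) = YA (map_mx X N) *m Mhat.
  apply/matrixP=> i j; rewrite mxE [X in coact X]mxE [N _ _]mxE eX.
  rewrite (tens_id_coact_gen lX) mxE.
  by apply: eq_bigr => k _; rewrite !mxE mulr_algl.
have cQ : map_mx (@coact R) (Q5 A) = Q5 AH.
  apply/matrixP=> i j; rewrite mxE !Q5E; case: (_ == _); [exact: coact1|exact: coact0].
have cNt : map_mx (@coact R) N^T = (map_mx (@coact R) N)^T by apply/matrixP=> i j; rewrite !mxE.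
have h : map_mx (@coact R) (map_mx X N *m Q5 A *m N^T) = YA (map_mx X N *m Q5 A *m N^T).
  rewrite !map_coact_mul cNt cX cQ cN (form_cancel _ _ (Mhat_r R)).
  by rewrite /YA !map_mxM matrix.map_trmx map_Q5.
have := congr1 (fun M : 'M_5 => M I K) h.
by rewrite mxE [RHS]mxE.
Qed.

(** The entries follow the order of [Gamma], with the signs of the decomposition; the default 0
    makes the coefficient coinvariant at every weight, also outside [Gamma]. *)
Definition Gamma_coef (g : 'I_5 -> 'I_5 -> 'I_5 -> A) (r : weight) : A :=
  nth 0 [:: - g i2 i3 i4; g i1 i2 i4; g i1 i3 i4; - g i1 i2 i3;
            g i3 i4 i5; - g i1 i2 i5; g i2 i3 i5; g i1 i4 i5] (index r Gamma).

Lemma gauge_span X : gauge_derivation X -> vertical X ->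
  exists (b : 'I_2 -> A) (c : weight -> A),
  [/\ forall j, OS4 (b j), forall r, OS4 (c r) &
    forall a, X a = \sum_(j < 2) b j * K j a + \sum_(r <- Gamma) c r * W r a].
Proof.
move=> gX vX; pose g := contract (skew_form X) (fun I => gen I i5).
have gO I J L : OS4 (g I J L).
  have h I1 J1 L1 : OS4 (skew_form X I1 J1 * gen L1 i5).
    by apply: OS4M; [exact: skew_form_OS4 | exact: OS4_gen].
  by apply: OS4D; [apply: OS4D; [|apply: OS4N] |]; exact: h.
exists (fun j => nth (g i1 i3 i5) [:: g i2 i4 i5; g i1 i3 i5] j), (Gamma_coef g); split.
- by case=> [[|[|]]] // h; exact: gO.
- move=> r; rewrite /Gamma_coef.
  by case: (index r Gamma) => [|[|[|[|[|[|[|[|k]]]]]]]] /=;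
    first [exact: gO | exact: (OS4N (gO _ _ _)) | rewrite nth_nil; exact: OS40].
move=> a; rewrite (gauge_decomposition gX vX a) -/g.
rewrite -[RHS]/(\sum_(j < 2) nth (g i1 i3 i5) [:: g i2 i4 i5; g i1 i3 i5] j *
    nth (@K1 R) [:: @K1 R; @K2 R] j a +
  \sum_(r <- Gamma) Gamma_coef g r * nth (fun=> 0) [:: @W10 R; @Wm10 R; @W01 R; @W0m1 R;
    @W11 R; @Wm1m1 R; @W1m1 R; @Wm11 R] (index r Gamma) a).
under [in RHS]eq_bigr do rewrite nth_app.
under [X in _ = _ + X]eq_bigr do rewrite nth_app.
by rewrite (sum_two_nth (g i2 i4 i5)) /Gamma_coef (sum_Gamma_nth (- g i2 i3 i4)) !mulNr.
Qed.

Lemma gauge_span_conv X (b : 'I_2 -> A) (c : weight -> A) :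
  (forall j, OS4 (b j)) -> (forall r, r \in Gamma -> OS4 (c r)) ->
  (forall a, X a = \sum_(j < 2) b j * K j a + \sum_(r <- Gamma) c r * W r a) ->
  gauge_derivation X /\ vertical X.
Proof.
move=> hb hc XE; split; last first.
  move=> I; rewrite XE !big1_seq ?addr0 // => [r /andP[_ hr]|j _].
    by have [_ _ ->] := W_gauge R hr; rewrite mulr0.
  by have [_ _ ->] := K_gauge R j; rewrite mulr0.
(* [gder_sum] wants a gauge derivation at every index of the family, so coefficients and fields are
   cut off outside [Gamma]. *)
pose c' r := if r \in Gamma then c r else 0.
pose W' r : A -> A := if r \in Gamma then W r else fun=> 0.
have XE' : X = (fun a => \sum_(j <- index_enum 'I_2) b j * K j a +
    \sum_(r <- Gamma) c' r * W' r a).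
  apply/funext => a; rewrite XE; congr (_ + _).
  by apply: eq_big_seq => r hr; rewrite /c' /W' hr.
rewrite XE'; apply: (@gderD R (fun a => \sum_(j <- index_enum 'I_2) b j * K j a)
    (fun a => \sum_(r <- Gamma) c' r * W' r a)).
- apply: (@gder_sum R _ _ (fun j a => b j * K j a)) => j.
  by apply: (@gderM R (b j) (K j)) => //; have [] := K_gauge R j.
- apply: (@gder_sum R _ _ (fun r a => c' r * W' r a)) => r; rewrite /c' /W'.
case: ifP => hr; last exact: (@gderM R 0 (fun=> 0) (OS40 R) (gder0 R)).
by apply: (@gderM R (c r) (W r)); [exact: hc | have [] := W_gauge R hr].
Qed.
End Span.

(** * Torus points of SO(4) and right weights *)

Section Diag2.
Variable R : realType.
Local Notation C := R[i].
Local Notation A := (A R).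
Implicit Types (a b x y : A) (h : biweight -> C) (S : biweight -> Prop).

Lemma dg_eigen h c y : dg h y = c *: y -> dg (fun s => (h s == c)%:R) y = y.
Proof.
move=> hy; pose hc s := h s - c.
have hc0 : dg hc y = 0.
  have -> : dg hc y = dg h y - c *: y.
    rewrite -(dg_const c y); move: y {hy}.
    apply: (linear_eq (linear_dg hc) (linear_add (linear_dg h) (linear_opp (linear_dg (fun=> c))))).
    by move=> s a ha; rewrite !(dg_hom _ ha) scalerBl.
  by rewrite hy subrr.
(* With the convention that the inverse of 0 is 0, the product of [hc s] and its inverse is the
   indicator of h s != c. Hence y has no component in the weights where h differs from c. *)
have := congr1 (dg (fun s => (hc s)^-1)) hc0.
rewrite (lin0 (linear_dg _)) dg_comp => h0.
suff e : dg (fun s => (h s == c)%:R) y = 1 *: y - dg (fun s => (hc s)^-1 * hc s) y.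
  by rewrite e h0 subr0 scale1r.
rewrite -(dg_const 1 y); move: y {hy hc0 h0}.
apply: (linear_eq (linear_dg _) (linear_add (linear_dg (fun=> 1)) (linear_opp (linear_dg _)))).
move=> s a ha; rewrite !(dg_hom _ ha) -scalerBl; congr (_ *: _); rewrite /hc.
have [->|ne] := eqVneq (h s) c; first by rewrite subrr mulr0 subr0.
by rewrite mulVf ?subrr // subr_eq0.
Qed.

Lemma Graded_dg_supp S h y : (forall s, S s \/ h s = 0) -> Graded S (dg h y).
Proof.
move=> hS; elim/hom_ind: y => [a b ha hb|s a ha].
  by rewrite (linD (linear_dg h)); exact: GradedD.
rewrite (dg_hom h ha); have [Ss|->] := hS s; last by rewrite scale0r; exact: Graded0.
by apply: GradedZ; apply: Graded_sub ha => t ->.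
Qed.
End Diag2.

Lemma ev_poly_map (B : comNzRingType) (psi : {additive B -> B}) (D : 'M[B]_4) :
  (forall m b, psi (b * ev_poly D 'X_[m]) = psi b * ev_poly D 'X_[m]) ->
  forall p, ev_poly D (map_mpoly psi p) = psi (ev_poly D p).
Proof.
move=> hD p.
have mapS (F : 'X_{1..4 * 4} -> {mpoly B[4 * 4]}) :
    map_mpoly psi (\sum_(k <- msupp p) F k) = \sum_(k <- msupp p) map_mpoly psi (F k).
  exact: raddf_sum.
rewrite [p]mpolyE mapS !rmorph_sum raddf_sum; apply: eq_bigr => m _ /=.
rewrite map_mpolyZX -!mul_mpolyC !rmorphM /= ![mmap _ _ _%:MP]mmapC.
exact: (esym (hD m p@_m)).
Qed.

Section Torus.
Variable R : realType.
Local Notation C := R[i].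
Local Notation A := (A R).
Local Notation AH := (AH R).
Local Notation cl := (OSO_class (Q4 A)).
Local Notation gen := (@gen R).
Implicit Types (a b x y : A) (t : AH) (psi : A -> A).

Section Chi.
Variables (t1 t2 : R) (t1_neq0 : t1 != 0) (t2_neq0 : t2 != 0).

Definition chi (q : weight) : C := ((t1 ^ q.1 * t2 ^ q.2)%:C)%C.

Lemma chiD p q : chi (p + q) = chi p * chi q.
Proof. by rewrite /chi -rmorphM /= !expfzDr // mulrACA. Qed.

Lemma chi0 : chi 0 = 1.
Proof. by rewrite /chi !expr0z mulr1. Qed.

Definition tor_wt (i : 'I_4) : weight := wt (lshift 1 i).
Definition torus : 'M[A]_4 := diag_mx (\row_i (chi (tor_wt i))%:A).

Lemma torus_E (K J : 'I_(4 + 1)) : hat torus 1 K J = (K == J)%:R * (chi (wt J))%:A.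
Proof.
rewrite hat_split; case: split_ordP => x ->; case: split_ordP => y ->.
- rewrite !mxE eq_shift; case: eqP => [->|_]; last by rewrite mulr0n mul0r.
  by rewrite mulr1n mul1r.
- by rewrite eq_shift mul0r.
- by rewrite eq_shift mul0r.
rewrite !ord1 eqxx mul1r (_ : wt _ = 0) ?chi0 ?scale1r //.
Qed.

(** The form pairs indices of opposite weight, whose characters multiply to 1. *)
Let tor_form : (\matrix_(i, j) ((chi (tor_wt i))%:A * Q4 A i j * (chi (tor_wt j))%:A)) = Q4 A.
Proof.
apply/matrixP=> i j; rewrite mxE Q4E; case: eqP => [e|_]; last by rewrite mulr0 mul0r.
rewrite mulr1 -scalerAl mul1r scalerA -chiD.
rewrite (_ : tor_wt i + tor_wt j = 0) ?chi0 ?scale1r //.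
by move: e; case: i => [[|[|[|[|]]]]] //= ?; case: j => [[|[|[|[|]]]]].
Qed.

Lemma torus_l : torus^T *m Q4 A *m torus = Q4 A.
Proof.
rewrite /torus tr_diag_mx -[RHS]tor_form; apply/matrixP=> i j.
by rewrite mul_mx_diag mxE mul_diag_mx !mxE.
Qed.

Lemma torus_r : torus *m Q4 A *m torus^T = Q4 A.
Proof. by have := torus_l; rewrite /torus tr_diag_mx. Qed.

Lemma torus_det : \det torus = 1.
Proof.
rewrite /torus det_diag.
under eq_bigr do rewrite mxE.
transitivity ((\prod_(i < 4) chi (tor_wt i))%:A : A); first exact: (esym (rmorph_prod (in_alg A) _ _ _)).
have -> : \prod_(i < 4) chi (tor_wt i) = chi (\sum_(i < 4) tor_wt i).
  by rewrite (big_morph _ chiD chi0).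
rewrite (_ : \sum_(i < 4) tor_wt i = 0) ?chi0 ?scale1r //.
by rewrite !big_ord_recl big_ord0.
Qed.

Local Notation et lem := (lem _ torus torus_l torus_r torus_det).

Lemma torus_coact a : ev torus (coact a) = dg (fun s => chi s.2) a.
Proof.
have hM (s t : biweight) : chi (s + t).2 = chi s.2 * chi t.2 by exact: chiD.
elim/A_ind: a => [|c a ha|a b ha hb|a b ha hb|I J].
- by rewrite coact1 (et (@ev1)) (dg_hom _ (hom1 R)) chi0 scale1r.
- by rewrite coactZ (et (@ev_scale)) ha mulr_algl (linZ (linear_dg _)).
- by rewrite coactD (et (@evD)) ha hb (linD (linear_dg _)).
- by rewrite coactM (et (@evM)) ha hb (dgM hM).
rewrite coact_hat (et (@ev_sum)) (bigD1 J) //= big1 => [|K KJ].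
  rewrite (et (@ev_scale)) (et (@ev_hat)) torus_E eqxx mul1r addr0.
  by rewrite (dg_hom _ (hom_gen R I J)) mulr_algr.
by rewrite (et (@ev_scale)) (et (@ev_hat)) torus_E (negbTE KJ) mul0r mulr0.
Qed.

Lemma torus_mon m : exists c : C, ev torus (cl 'X_[m]) = c%:A.
Proof.
elim/mnm_ind: m => [|k m [c hc]].
  by exists 1; rewrite mpolyX0 rmorph1 (et (@ev1)) scale1r.
have -> : cl 'X_[U_(k) + m] = cl 'X_k * cl 'X_[m] by rewrite mpolyXD rmorphM.
rewrite (et (@evM)) hc; case/mxvec_indexP: k => i j.
exists ((chi (tor_wt i) *+ (i == j)) * c).
rewrite (et (@ev_cl)); have := congr1 (fun M : 'M_4 => M i j) (ev_poly_varmx torus).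
rewrite !mxE => ->; case: (i == j); rewrite ?mulr1n ?mulr0n ?mul0r ?scale0r //.
by rewrite -scalerAl mul1r scalerA.
Qed.

(** The torus point has complex entries, so every monomial takes a complex value there, and
    evaluation commutes with any C-linear [psi]. At a point with entries in A this could fail. *)
Lemma torus_tens_id psi t : linear psi -> ev torus (tens_id psi t) = psi (ev torus t).
Proof.
move=> lpsi; move: t; elim/cl_ind => p.
pose psi' : {linear A -> A} := HB.pack psi (GRing.isLinear.Build C A A *:%R psi lpsi).
rewrite (tens_id_cl lpsi) !(et (@ev_cl)); apply: (ev_poly_map (psi := psi')) => m a /=.
have [c] := torus_mon m; rewrite (et (@ev_cl)) => ->.
by rewrite !mulr_algr (linZ lpsi).
Qed.
End Chi.

(** At the two points the character of a weight is 2 to the power of its first, respectively second,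
    component, and distinct powers of 2 are different. *)
Lemma rhom_chi q y :
  dg (fun s => chi 2 1 s.2) y = chi 2 1 q *: y ->
  dg (fun s => chi 1 2 s.2) y = chi 1 2 q *: y -> rhom q y.
Proof.
move=> /dg_eigen h1 /dg_eigen h2; rewrite -h1 -h2 dg_comp.
apply: Graded_dg_supp => s.
have inj2 (m n : int) : (2 : R) ^ m = 2 ^ n -> m = n.
  by apply: ieexprIz; rewrite ?ltr0n // (eqr_nat R 2 1).
rewrite /chi !exp1rz !(inj_eq (@complexI R)) !mulr1 !mul1r.
case: eqP => [/inj2 e1|_]; last by right; rewrite mul0r.
case: eqP => [/inj2 e2|_]; last by right; rewrite mulr0.
by left; case: (s.2) (q) e1 e2 => [x1 x2] [y1 y2] /= -> ->.
Qed.

(* Evaluating the coaction at the torus point diag(t1, t2, 1/t1, 1/t2) of SO(4) rescales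
   the right weight spaces, and the points (2, 1) and (1, 2) separate them. *)
Lemma equivariant_rhom psi q a : linear psi ->
  (forall b, coact (psi b) = tens_id psi (coact b)) -> rhom q a -> rhom q (psi a).
Proof.
move=> lpsi epsi ha.
have n2 : (2 : R) != 0 by rewrite pnatr_eq0.
have n1 : (1 : R) != 0 by exact: oner_neq0.
have key (t1 t2 : R) (h1 : t1 != 0) (h2 : t2 != 0) :
    dg (fun s => chi t1 t2 s.2) (psi a) = chi t1 t2 q *: psi a.
  rewrite -torus_coact // epsi torus_tens_id // torus_coact //.
  by rewrite (dg_Graded_const (c := chi t1 t2 q) _ ha) ?(linZ lpsi) // => s ->.
by apply: rhom_chi; exact: key.
Qed.

(** The coaction gives b ⊗ 1, which takes the value b at every torus point. Consequently the right
    phase in a twisted product with a coinvariant is 1. *)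
Lemma OS4_rhom b : OS4 b -> rhom 0 b.
Proof.
move=> hb.
have n2 : (2 : R) != 0 by rewrite pnatr_eq0.
have n1 : (1 : R) != 0 by exact: oner_neq0.
have key (t1 t2 : R) (h1 : t1 != 0) (h2 : t2 != 0) :
    dg (fun s => chi t1 t2 s.2) b = chi t1 t2 0 *: b.
  rewrite -torus_coact // chi0 scale1r.
  have -> : coact b = b%:A by [].
  rewrite ev_scale ?ev1 ?mulr1 //; first [exact: torus_l | exact: torus_r | exact: torus_det].
by apply: rhom_chi; exact: key.
Qed.
End Torus.

(** * Left weights and the coaction *)

Section LeftGrading.
Variable R : realType.
Local Notation C := R[i].
Local Notation A := (A R).
Local Notation AH := (AH R).
Local Notation cl := (OSO_class (Q4 A)).
Local Notation cls := (@cls R).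
Local Notation gen := (@gen R).
Local Notation Mhat := (Mhat R).
Implicit Types (a b x y : A) (s t : AH) (psi : A -> A) (p q : weight).

(** The span of the tensors a ⊗ h with a of left weight q. It is given by generation because the
    coefficients of a representative are not determined by the class. *)
Inductive left_graded q : AH -> Prop :=
| left_gradedD s t of left_graded q s & left_graded q t : left_graded q (s + t)
| left_graded_mon a m of lhom q a : left_graded q (a *: cl 'X_[m]).

Lemma left_graded0 q : left_graded q 0.
Proof. by rewrite -(scale0r (cl 'X_[0])); apply: left_graded_mon; exact: Graded0. Qed.

Lemma left_graded_sum q (I : Type) (r : seq I) (F : I -> AH) :
  (forall i, left_graded q (F i)) -> left_graded q (\sum_(i <- r) F i).
Proof.
by move=> h; apply: big_ind => //; [exact: left_graded0 | exact: left_gradedD].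
Qed.

Lemma lhom_mul p q a b : lhom p a -> lhom q b -> lhom (p + q) (a * b).
Proof. by apply: GradedM => s t <- <-. Qed.

Lemma left_gradedM p q s t : left_graded p s -> left_graded q t -> left_graded (p + q) (s * t).
Proof.
move=> hs ht; elim: hs => [s1 s2 _ h1 _ h2|a m ha].
  by rewrite mulrDl; exact: left_gradedD.
elim: ht => [t1 t2 _ h1 _ h2|b k hb].
  by rewrite mulrDr; exact: left_gradedD.
have -> : (a *: cl 'X_[m]) * (b *: cl 'X_[k]) = (a * b) *: cl 'X_[m + k].
  by rewrite -scalerAl -scalerAr scalerA mpolyXD rmorphM.
by apply: left_graded_mon; exact: lhom_mul.
Qed.

Lemma left_gradedZ q (c : C) t : left_graded q t -> left_graded q (c%:A *: t).
Proof.
elim=> [s1 s2 _ h1 _ h2|a m ha]; first by rewrite scalerDr; exact: left_gradedD.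
by rewrite scalerA mulr_algl; apply: left_graded_mon; exact: GradedZ.
Qed.

Lemma left_graded1 : left_graded 0 1.
Proof.
have -> : (1 : AH) = (1 : A) *: cl 'X_[0] by rewrite scale1r mpolyX0 rmorph1.
by apply: left_graded_mon; apply: Graded_sub (hom1 R) => s ->.
Qed.

Lemma left_graded_Mhat q a K J : lhom q a -> left_graded q (a *: Mhat K J).
Proof.
move=> ha; have -> : Mhat K J = OSO4_hat A K J by [].
rewrite OSO4_hat_split; case: (split _) => x; case: (split _) => y.
- by rewrite mxE; exact: left_graded_mon.
- exact: (eq_ind_r (left_graded q) (left_graded0 q) (scaler0 AH a)).
- exact: (eq_ind_r (left_graded q) (left_graded0 q) (scaler0 AH a)).
by rewrite -(rmorph1 cl) -mpolyX0; exact: left_graded_mon.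
Qed.

Lemma left_graded_coact q a : lhom q a -> left_graded q (coact a).
Proof.
have mon m : left_graded (bwt m).1 (coact (cls 'X_[m])).
  elim/mnm_ind: m => [|k m IH].
    by rewrite mpolyX0 rmorph1 coact1 bwt0; exact: left_graded1.
  have -> : cls 'X_[U_(k) + m] = cls 'X_k * cls 'X_[m] by rewrite mpolyXD rmorphM.
  rewrite coactM bwtD; apply: left_gradedM => //.
  case/mxvec_indexP: k => I J; rewrite bwtU -/(gen I J) coact_gen.
  apply: left_graded_sum => K; apply: left_graded_Mhat.
  by apply: Graded_sub (hom_gen R I K) => s ->.
move=> [p -> hp]; rewrite cls_sumE big_seq.
apply: (big_ind (fun a => left_graded q (coact a))) => [|x y hx hy|m /hp e].
- by rewrite coact0; exact: left_graded0.
- by rewrite coactD; exact: left_gradedD.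
by rewrite coactZ -e; exact: left_gradedZ.
Qed.

(** Allows an operator that is defined weight by weight, such as [D X], to be replaced under
    [tens_id] by the formula it has on the single left weight q. *)
Lemma tens_id_eq_left_graded q psi phi t : linear psi -> linear phi ->
  (forall a, lhom q a -> psi a = phi a) -> left_graded q t -> tens_id psi t = tens_id phi t.
Proof.
move=> lpsi lphi e; elim=> [s1 s2 _ h1 _ h2|a m ha].
  by rewrite (tens_idD lpsi) (tens_idD lphi) h1 h2.
have mon f (lf : linear f) : tens_id f (a *: cl 'X_[m]) = f a *: cl 'X_[m].
  exact: (tens_id_lin (hpsi := lf) a (map_linearX _ m)).
by rewrite !mon // e.
Qed.

Definition ldg (f : weight -> C) : A -> A := dg (fun w : biweight => f w.1).

Lemma linear_ldg f : linear (ldg f). Proof. exact: linear_dg. Qed.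

Lemma ldg_lhom f q a : lhom q a -> ldg f a = f q *: a.
Proof. by apply: dg_Graded_const => s ->. Qed.

Lemma linear_coact_ind (P : A -> Prop) :
  (forall a b, P a -> P b -> P (a + b)) -> (forall q a, lhom q a -> P a) -> forall a, P a.
Proof.
move=> PD Pl; apply: hom_ind => // s a ha; apply: (Pl s.1).
by apply: Graded_sub ha => t ->.
Qed.

(** The coaction affects column indices only and so keeps left weights; on left weight q both sides
    are multiplication by f q. *)
Lemma coact_ldg f a : coact (ldg f a) = tens_id (ldg f) (coact a).
Proof.
elim/linear_coact_ind: a => [a b ha hb|q a ha].
  by rewrite (linD (linear_ldg f)) !coactD (tens_idD (linear_ldg f)) ha hb.
rewrite (ldg_lhom f ha) coactZ.
have lz : linear (fun x : A => f q *: x) by exact: linear_scale (linear_id (R := R)).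
rewrite (@tens_id_eq_left_graded q (ldg f) (fun x => f q *: x)) //.
- have e : (fun x : A => f q *: x) = (fun x => (f q)%:A * id x).
    by apply/funext => x; rewrite mulr_algl.
  rewrite e (tens_id_mull _ _ (linear_id (R := R))); congr (_ *: _).
  move: (coact a) => t; move: t; elim/cl_ind => p.
  rewrite tens_idE; last exact: linear_id.
  rewrite {1}[p]mpolyE [LHS](raddf_sum cl); apply: eq_bigr => m _; exact: cl_scale.
- exact: linear_ldg.
- by move=> b hb; exact: ldg_lhom.
exact: left_graded_coact.
Qed.

Lemma OS4_ldg f b : OS4 b -> OS4 (ldg f b).
Proof.
move=> hb; rewrite /OS4 coact_ldg; have -> : coact b = b%:A by [].
exact: (tens_id_alg (linear_ldg f)).
Qed.

End LeftGrading.

(** * The twist *)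

Lemma wedgeDl p q r : wedge (p + q) r = wedge p r + wedge q r.
Proof. by rewrite /wedge /= !mulrDl opprD addrACA. Qed.

Lemma wedgeDr p q r : wedge p (q + r) = wedge p q + wedge p r.
Proof. by rewrite /wedge /= !mulrDr opprD addrACA. Qed.

Lemma wedgeC p q : wedge p q = - wedge q p.
Proof. by rewrite /wedge opprB [p.1 * _]mulrC [p.2 * _]mulrC. Qed.

Lemma wedgeNl p q : wedge (- p) q = - wedge p q.
Proof. by rewrite /wedge /= !mulNr -opprD. Qed.

Lemma wedgeNr p q : wedge p (- q) = - wedge p q.
Proof. by rewrite wedgeC wedgeNl opprK [LHS]wedgeC. Qed.

Lemma wedge_self p : wedge p p = 0.
Proof. by rewrite /wedge mulrC subrr. Qed.

Lemma wedge0l p : wedge 0 p = 0.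
Proof. by rewrite /wedge /= !mul0r subrr. Qed.

Lemma wedge0r p : wedge p 0 = 0.
Proof. by rewrite wedgeC wedge0l oppr0. Qed.

Definition wedgeE := (wedgeDl, wedgeDr, wedgeNl, wedgeNr, wedge_self, wedge0l, wedge0r).

Section Phase.
Variables (R : realType) (theta : R).
Local Notation ph := (phase theta).

Lemma phaseD k l : ph (k + l) = ph k * ph l.
Proof. by rewrite /phase intrD mulrDr cosD sinD; congr Complex; rewrite addrC. Qed.

Lemma phase0 : ph 0 = 1.
Proof. by rewrite /phase mulr0z mulr0 cos0 sin0. Qed.

Lemma phaseNV k : ph k * ph (- k) = 1.
Proof. by rewrite -phaseD subrr phase0. Qed.

Lemma phase_neq0 k : ph k != 0.
Proof. by apply: contra_eq_neq (phaseNV k) => ->; rewrite mul0r eq_sym oner_neq0. Qed.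

Lemma phaseN_theta k : phase (- theta) k = ph (- k).
Proof. by rewrite /phase mulrN mulNr mulrNz mulrN. Qed.
End Phase.

Section Twisted.
Variables (R : realType) (theta : R).
Local Notation C := R[i].
Local Notation A := (A R).
Local Notation ph := (phase theta).
Local Notation tmul := (tmul theta).
Local Notation D := (D theta).
Implicit Types (a b x y : A) (X psi : A -> A) (p q r w : weight) (s t : biweight).

(* The algebra automorphism such that D X = T (- q) o X in left weight q. *)
Definition T w : A -> A := ldg (fun q => ph (wedge q w)).

Lemma linear_T w : linear (T w). Proof. exact: linear_ldg. Qed.

Lemma T_lhom w q a : lhom q a -> T w a = ph (wedge q w) *: a.
Proof. exact: ldg_lhom. Qed.

Lemma TM w a b : T w (a * b) = T w a * T w b.
Proof. by apply: dgM => s t; rewrite wedgeDl phaseD. Qed.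

Lemma T_comp w v a : T w (T v a) = T (w + v) a.
Proof. by rewrite [LHS]dg_comp; apply: dg_eq => s; rewrite wedgeDr phaseD. Qed.

Lemma T0 a : T 0 a = a.
Proof. by rewrite -[RHS]scale1r -dg_const; apply: dg_eq => s; rewrite wedge0r phase0. Qed.

Lemma TVK w a : T w (T (- w) a) = a.
Proof. by rewrite T_comp subrr T0. Qed.

Lemma wsum_lhomE (F : weight -> A -> A) q a :
  (forall p, linear (F p)) -> lhom q a -> wsum F a = F q a.
Proof.
move=> hF; apply: (linear_eq_hom (linear_wsum hF) (hF q)) => s {}a <- ha.
exact: wsum_lhom.
Qed.

Section Wact.
Variables (f : weight -> C) (psi : A -> A).
Hypothesis lpsi : linear psi.

Let F m x := ldg (fun p => f (p - m)) (psi x).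
Let lF m : linear (F m).
Proof. exact: (linear_comp (linear_ldg _) lpsi). Qed.

Lemma linear_wact : linear (wact f psi).
Proof. exact: (linear_wsum lF). Qed.

Lemma wact_lhom q a : lhom q a -> wact f psi a = ldg (fun p => f (p - q)) (psi a).
Proof. exact: (wsum_lhomE lF). Qed.

Lemma wact_weight r s a : has_weight r psi -> bhom s a -> wact f psi a = f r *: psi a.
Proof.
move=> hr ha; have hp := hr s a ha.
rewrite (@wact_lhom s.1); last by apply: Graded_sub ha => t ->.
rewrite (@ldg_lhom _ _ (s.1 + r)) ?[s.1 + r]addrC ?addrK //.
by apply: Graded_sub hp => t ->; rewrite addrC.
Qed.
End Wact.

Section DX.
Variable X : A -> A.
Hypothesis lX : linear X.

Let F q x := wact (fun r => ph (- wedge r q)) X x.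
Let lF q : linear (F q). Proof. exact: linear_wact. Qed.

Lemma linear_D : linear (D X).
Proof. exact: (linear_wsum lF). Qed.

(** The component of [X] of weight r carries q to q + r, and r∧q = (q + r)∧q. The phase thus depends
    only on the weight of the image, which makes it the action of an automorphism. *)
Lemma D_lhom q a : lhom q a -> D X a = T (- q) (X a).
Proof.
move=> ha; rewrite [LHS](wsum_lhomE lF ha) /F (wact_lhom _ lX ha).
by apply: dg_eq => s; rewrite !wedgeE subr0.
Qed.

Lemma D_bhom s a : bhom s a -> D X a = T (- s.1) (X a).
Proof. by move=> ha; apply: D_lhom; apply: Graded_sub ha => t ->. Qed.

Lemma D_weight r s a : has_weight r X -> bhom s a -> D X a = ph (- wedge r s.1) *: X a.
Proof.
move=> hr ha; rewrite (D_bhom ha) (@T_lhom _ (s.1 + r)).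
  by rewrite !wedgeE add0r.
by apply: Graded_sub (hr _ _ ha) => t ->.
Qed.

Lemma has_weight_D r : has_weight r X -> has_weight r (D X).
Proof. by move=> hr s a ha; rewrite (D_weight hr ha); apply: GradedZ; exact: hr. Qed.
End DX.

Lemma tmulE a a' : tmul a a' = gsum (fun s x => gsum (fun t y =>
  (ph (- wedge s.1 t.1) * ph (wedge s.2 t.2)) *: (x * y)) a') a.
Proof. by []. Qed.

Let tmul_lin_y s x : forall t, linear (fun y : A =>
  (ph (- wedge s.1 t.1) * ph (wedge s.2 t.2)) *: (x * y)).
Proof. by move=> t; exact: (linear_scale _ (linear_mull x (linear_id (R := R)))). Qed.

Let tmul_lin_x s a' : linear (fun x : A => gsum (fun t y =>
  (ph (- wedge s.1 t.1) * ph (wedge s.2 t.2)) *: (x * y)) a').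
Proof.
apply: (@linear_sum R _ _ _ (fun m x => (ph (- wedge s.1 (bwt m).1) *
  ph (wedge s.2 (bwt m).2)) *: (x * term a' m))) => m.
exact: (linear_scale _ (linear_mulr _ (linear_id (R := R)))).
Qed.

Lemma linear_tmull a' : linear (fun a => tmul a a').
Proof. exact: (linear_gsum (fun s => tmul_lin_x s a')). Qed.

Lemma linear_tmulr a : linear (tmul a).
Proof.
apply: (@linear_sum R _ _ _ (fun m a' => gsum (fun t y =>
  (ph (- wedge (bwt m).1 t.1) * ph (wedge (bwt m).2 t.2)) *: (term a m * y)) a')) => m.
exact: (linear_gsum (tmul_lin_y (bwt m) (term a m))).
Qed.

Lemma tmul_bhom s t a a' : bhom s a -> bhom t a' ->
  tmul a a' = (ph (- wedge s.1 t.1) * ph (wedge s.2 t.2)) *: (a * a').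
Proof.
move=> ha ha'; rewrite tmulE (gsum_hom _ ha); last by move=> s'; exact: tmul_lin_x.
by rewrite (gsum_hom _ ha') //; exact: tmul_lin_y.
Qed.

(** Applied to values of [D X], whose right weight is known while their left weights are mixed: the
    left phases are absorbed into an automorphism acting on y. *)
Lemma tmul_rhom_bhom q t y a : rhom q y -> bhom t a ->
  tmul y a = ph (wedge q t.2) *: (T (- t.1) y * a).
Proof.
move=> hy ha; move: y hy.
apply: (linear_eq_hom (linear_tmull a)
  (linear_scale _ (linear_mulr a (linear_T (- t.1))))) => s y <- hy.
rewrite (tmul_bhom hy ha) (@T_lhom _ s.1).
  by rewrite -scalerAl scalerA wedgeNr mulrC.
by apply: Graded_sub hy => u ->.
Qed.

Lemma tmul_bhom_rhom q s y a : bhom s a -> rhom q y ->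
  tmul a y = ph (wedge s.2 q) *: (a * T s.1 y).
Proof.
move=> ha hy; move: y hy.
apply: (linear_eq_hom (linear_tmulr a)
  (linear_scale _ (linear_mull a (linear_T s.1)))) => t y <- hy.
rewrite (tmul_bhom ha hy) (@T_lhom _ t.1).
  by rewrite -scalerAr scalerA -wedgeC mulrC.
by apply: Graded_sub hy => u ->.
Qed.

Definition right_homogeneous X := forall q a, rhom q a -> rhom q (X a).

End Twisted.

(** * Braided derivations and ordinary derivations *)

Section Automorphisms.
Variables (R : realType) (theta : R).
Local Notation C := R[i].
Local Notation A := (A R).
Local Notation ph := (phase theta).
Local Notation tmul := (tmul theta).
Local Notation D := (D theta).
Local Notation T := (T theta).
Local Notation gen := (@gen R).
Implicit Types (a b x y : A) (X psi : A -> A) (p q r w : weight) (s t : biweight).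

Lemma right_homogeneous_D X : linear X -> right_homogeneous X -> right_homogeneous (D X).
Proof.
move=> lX rX q a; apply: (@Graded_ind R _ (fun a => rhom q (D X a))) => [|x y hx hy|s x sq hx].
- by rewrite (lin0 (linear_D theta lX)); exact: Graded0.
- by rewrite (linD (linear_D theta lX)); exact: GradedD.
rewrite (D_bhom theta lX hx); apply: Graded_dg; apply: rX.
by apply: Graded_sub hx => t ->.
Qed.

Lemma D_inv X a : linear X -> D (Defs.D (- theta) X) a = X a.
Proof.
move=> lX; have lDX := linear_D (- theta) lX; move: a.
apply: (linear_eq (linear_D theta lDX) lX) => s a ha.
rewrite (D_bhom theta lDX ha) (D_bhom _ lX ha) [LHS]dg_comp -[RHS]scale1r -dg_const.
by apply: dg_eq => t; rewrite phaseN_theta -phaseD subrr phase0.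
Qed.

Section Braided.
Variable X : A -> A.
Hypotheses (lX : linear X) (rX : right_homogeneous X).
Let lDX : linear (D X). Proof. exact: linear_D. Qed.
Let rDX : right_homogeneous (D X). Proof. exact: right_homogeneous_D. Qed.

Let rhomDX s a : bhom s a -> rhom s.2 (D X a).
Proof. by move=> ha; apply: rDX; apply: Graded_sub ha => t ->. Qed.

Section Pair.
Variables (s m : biweight) (a a' : A).
Hypotheses (ha : bhom s a) (ha' : bhom m a').
Let c := ph (- wedge s.1 m.1) * ph (wedge s.2 m.2).

Lemma D_tmul : D X (tmul a a') = c *: T (- (s.1 + m.1)) (X (a * a')).
Proof.
by rewrite (tmul_bhom theta ha ha') (linZ lDX) (D_bhom theta lX (hom_mul ha ha')).
Qed.

(** With [D_tmul] this shows that, on homogeneous a and a', the two sides of the braided Leibniz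
    rule for [D X] are the images of the two sides of the ordinary rule for [X] under one and the
    same operator. *)
Lemma braided_leibniz :
  tmul (D X a) a' + tmul a (Ract theta s.1 (D X) a') =
  c *: T (- (s.1 + m.1)) (X a * a' + a * X a').
Proof.
have la : lhom s.1 a by apply: Graded_sub ha => t ->.
have la' : lhom m.1 a' by apply: Graded_sub ha' => t ->.
rewrite (tmul_rhom_bhom theta (rhomDX ha) ha').
have hR : rhom m.2 (Ract theta s.1 (D X) a').
  by rewrite /Ract (wact_lhom _ lDX la'); apply: Graded_dg; exact: rhomDX.
rewrite (tmul_bhom_rhom theta ha hR) (D_bhom theta lX ha).
rewrite /Ract (wact_lhom _ lDX la') (D_bhom theta lX ha').
(* On weight p the braiding contributes the phase of - 2 p∧s, which turns [T s] into [T (- s)] and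
   leaves the constant phase of 2 m∧s. *)
have -> : T s.1 (ldg (fun p => ph (- 2 * wedge (p - m.1) s.1)) (T (- m.1) (X a'))) =
  ph (2 * wedge m.1 s.1) *: T (- (s.1 + m.1)) (X a').
  rewrite [X in T s.1 X]dg_comp [LHS]dg_comp -[RHS]dg_const dg_comp; apply: dg_eq => t.
  rewrite -!phaseD; congr (phase _ _); rewrite !wedgeE.
  by ring.
rewrite T_comp (linD (linear_T theta _)) scalerDr !TM.
rewrite (T_lhom theta _ la) (T_lhom theta _ la') -!scalerAl -!scalerAr !scalerA.
congr (_ *: (T _ _ * _) + _ *: _).
- rewrite /c mulrAC -phaseD [X in ph X * _](_ : _ = 0) ?phase0 ?mul1r //.
  by rewrite !wedgeE [wedge m.1 s.1]wedgeC; ring.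
- by rewrite opprD addrC.
rewrite /c [RHS]mulrAC -[X in _ = X * _]phaseD [LHS]mulrC; congr (ph _ * _).
by rewrite !wedgeE [wedge m.1 s.1]wedgeC; ring.
Qed.
End Pair.

Let lRact s : linear (Ract theta s.1 (D X)). Proof. exact: linear_wact. Qed.

Let F a' p x := tmul x (Ract theta p (D X) a').
Let lF a' p : linear (F a' p). Proof. exact: (linear_tmull theta). Qed.

Lemma braided_derivationP : braided_derivation theta (D X) <-> derivation X.
Proof.
split=> [[_ bX]|dX].
  move=> a a'; move: a.
  apply: (linear_eq (linear_comp lX (linear_mulr a' (linear_id (R := R))))
    (linear_add (linear_mulr a' lX) (linear_mulr (X a') (linear_id (R := R))))) => s a ha.
  move: a'.
  apply: (linear_eq (linear_comp lX (linear_mull a (linear_id (R := R))))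
    (linear_add (linear_mull (X a) (linear_id (R := R))) (linear_mull a lX))) => m a' ha'.
  have := bX a a'; rewrite (wsum_lhom (lF a') ha) (D_tmul ha ha') (braided_leibniz ha ha').
  (* The common operator is invertible: [T (s + m)] undoes the automorphism, and the scalar is a
     product of phases. *)
  move/(congr1 (T (s.1 + m.1))); rewrite !(linZ (linear_T theta _)) !TVK.
  by move/scalerI; apply; rewrite mulf_neq0 ?phase_neq0.
split; first exact: lDX.
move=> a a'; move: a.
apply: (linear_eq (linear_comp lDX (linear_tmull theta a'))
   (linear_add (linear_comp (linear_tmull theta a') lDX) (linear_wsum (lF a')))) => s a ha.
rewrite (wsum_lhom (lF a') ha); move: a'.
apply: (linear_eq (linear_comp lDX (linear_tmulr theta a))
   (linear_add (linear_tmulr theta (D X a)) (linear_comp (linear_tmulr theta a) (lRact s)))) => m a' ha'.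
by rewrite (D_tmul ha ha') (braided_leibniz ha ha') dX.
Qed.
End Braided.

(** On weight s the automorphism [T (- s)] reaches both b and X a, while the twisted product with
    [D X a], of weight s + r, acts on b by [T (- (s + r))]. The discrepancy is [T r b]. *)
Lemma D_mull r X b a : linear X -> has_weight r X -> rhom 0 b ->
  D (fun a => b * X a) a = tmul (T r b) (D X a).
Proof.
move=> lX hX hb; have lbX := linear_mull b lX; move: a.
apply: (linear_eq (linear_D theta lbX)
  (linear_comp (linear_tmulr theta (T r b)) (linear_D theta lX))) => s a ha.
have hDX := has_weight_D theta lX hX ha.
rewrite (tmul_rhom_bhom theta (Graded_dg _ hb) hDX) wedge0l phase0 scale1r.
rewrite (D_bhom theta lbX ha) TM T_comp -(D_bhom theta lX ha).
by rewrite opprD subrK.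
Qed.

Lemma tens_id_comp X psi (t : AH R) : linear X -> linear psi ->
  tens_id X (tens_id psi t) = tens_id (fun a => X (psi a)) t.
Proof.
move=> lX lpsi; move: t; elim/cl_ind => p.
rewrite (tens_idE lpsi) (tens_idE (linear_comp lX lpsi)) (tens_id_sum lX).
apply: eq_bigr => m _.
exact: (tens_id_lin (hpsi := lX) _ (map_linearX _ m)).
Qed.

(** [D X] is [T (- q)] after [X] with q depending on the argument, so the left weights are separated
    first; the coaction keeps each of them, and there both factors are equivariant. *)
Lemma equivariant_D X : linear X -> (forall a, coact (X a) = tens_id X (coact a)) ->
  forall a, coact (D X a) = tens_id (D X) (coact a).
Proof.
move=> lX eX a; have lDX := linear_D theta lX.
elim/linear_coact_ind: a => [a b ha hb|q a ha].
  by rewrite (linD lDX) !coactD (tens_idD lDX) ha hb.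
rewrite (D_lhom theta lX ha); transitivity (tens_id (T (- q)) (coact (X a))).
  exact: coact_ldg.
rewrite eX (tens_id_comp (coact a) (linear_T theta (- q)) lX).
have e b : lhom q b -> T (- q) (X b) = D X b by move=> hb; rewrite (D_lhom theta lX hb).
exact: (tens_id_eq_left_graded (linear_comp (linear_T theta (- q)) lX) lDX e
  (left_graded_coact ha)).
Qed.

End Automorphisms.

(** * The module of infinitesimal gauge transformations *)

Section PartOne.
Variables (R : realType) (theta : R).
Local Notation C := R[i].
Local Notation A := (A R).
Local Notation ph := (phase theta).
Local Notation tmul := (tmul theta).
Local Notation D := (D theta).
Local Notation T := (T theta).
Local Notation gen := (@gen R).
Implicit Types (a b x y : A) (X psi : A -> A) (p q r w : weight) (s t : biweight).

Lemma Graded_dg_restrict (S U : biweight -> Prop) h y :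
  (forall s, S s -> U s \/ h s = 0) -> Graded S y -> Graded U (dg h y).
Proof.
move=> hS; apply: (@Graded_ind R S (fun y => Graded U (dg h y))) => [|a b ha hb|s a Ss ha].
- by rewrite (lin0 (linear_dg h)); exact: Graded0.
- by rewrite (linD (linear_dg h)); exact: GradedD.
rewrite (dg_hom h ha); have [Us|->] := hS s Ss; last by rewrite scale0r; exact: Graded0.
by apply: GradedZ; apply: Graded_sub ha => t ->.
Qed.

(** The left weight components of a coinvariant are again coinvariant, because projections onto left
    weights commute with the coaction, and they have right weight 0. *)
Lemma OS4_ind (P : A -> Prop) :
  (forall a b, P a -> P b -> P (a + b)) ->
  (forall q b, OS4 b -> bhom (q, 0) b -> P b) -> forall b, OS4 b -> P b.
Proof.
move=> PD Pb b hb; pose L := undup [seq lwt m | m <- msupp (repr b)].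
pose h q : biweight -> C := fun s => (s.1 == q)%:R.
have bL : Graded (fun s => s.1 \in L) b.
  by exists (repr b); rewrite ?clsK // => m hm; rewrite mem_undup; apply/mapP; exists m.
have hsum y : \sum_(q <- L) dg (h q) y = dg (fun s => \sum_(q <- L) h q s) y.
  move: y; apply: (linear_eq (@linear_sum R _ L xpredT _ (fun q => linear_dg (h q))) (linear_dg _)).
  by move=> s a ha; rewrite (dg_hom _ ha) scaler_suml; apply: eq_bigr => q _; rewrite (dg_hom _ ha).
have -> : b = \sum_(q <- L) dg (h q) b.
  rewrite hsum (dg_Graded_const (c := 1) _ bL) ?scale1r // => s hs.
  rewrite (bigD1_seq s.1) ?undup_uniq //= /h eqxx big1 ?addr0 // => q.
  by rewrite eq_sym => /negbTE ->.
have P0 : P 0 by apply: (Pb 0); [exact: OS40 | exact: Graded0].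
apply: big_ind => // q _; apply: (Pb q); first exact: (OS4_ldg (fun p => (p == q)%:R)).
apply: Graded_dg_restrict (OS4_rhom hb) => s e; rewrite /h.
case: eqP => [e1|_]; last by right.
by left; case: s e e1 => /= ? ? -> ->.
Qed.

Lemma D_vertical X : gauge_derivation X -> vertical X -> forall b, OS4 b -> D X b = 0.
Proof.
move=> [lX dX eX] vX; apply: OS4_ind => [a b ha hb|q b hb hq].
  by rewrite (linD (linear_D theta lX)) ha hb addr0.
by rewrite (D_bhom theta lX hq) (vertical_coinvariant lX dX vX hb) (lin0 (linear_T theta _)).
Qed.

Lemma gauge_right_homogeneous X : gauge_derivation X -> right_homogeneous X.
Proof. by move=> [lX _ eX] q a; exact: equivariant_rhom. Qed.

Lemma aut_D X : gauge_derivation X -> vertical X -> aut theta (D X).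
Proof.
move=> gX vX; have [lX dX eX] := gX; split.
- exact: (proj2 (braided_derivationP theta lX (gauge_right_homogeneous gX)) dX).
- exact: equivariant_D.
exact: D_vertical.
Qed.

Lemma aut_inv psi : aut theta psi ->
  exists2 X, gauge_derivation X /\ vertical X & forall a, psi a = D X a.
Proof.
move=> [[lpsi bpsi] epsi vpsi]; pose X := Defs.D (- theta) psi.
have rpsi : right_homogeneous psi by move=> q a; exact: equivariant_rhom.
have lX : linear X by exact: linear_D.
have rX : right_homogeneous X by exact: right_homogeneous_D.
have psiE a : psi a = D X a by rewrite D_inv.
exists X; last exact: psiE.
split.
  split; [exact: lX | | exact: equivariant_D].
  apply: (proj1 (braided_derivationP theta lX rX)).
  have -> : D X = psi by apply/funext => a; rewrite psiE.
  by split.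
move=> I; rewrite /X (D_bhom _ lpsi (hom_gen R I i5)) vpsi; last exact: OS4_gen.
exact: lin0 (linear_T _ _).
Qed.

(** Outside [Gamma] the field is 0. Being total in r, the statement applies to whole families
    indexed by weights. *)
Lemma W_gaugeT r : gauge_generator r (@W R r).
Proof.
case: (boolP (r \in Gamma)) => [|hr]; first exact: W_gauge.
have -> : @W R r = fun=> 0.
  by rewrite /W nth_default // leqNgt (index_mem r Gamma).
split; first exact: gder0.
  by move=> s a _; exact: Graded0.
by [].
Qed.

Lemma D_sum (I : Type) (r : seq I) (F : I -> A -> A) a : (forall i, linear (F i)) ->
  D (fun a => \sum_(i <- r) F i a) a = \sum_(i <- r) D (F i) a.
Proof.
move=> lF; have lS := @linear_sum R _ r xpredT _ lF; move: a.
apply: (linear_eq (linear_D theta lS) (@linear_sum R _ r xpredT _ (fun i => linear_D theta (lF i)))) => s a ha.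
rewrite (D_bhom theta lS ha) (lin_sum (linear_T theta _)); apply: eq_bigr => i _.
by rewrite (D_bhom theta (lF i) ha).
Qed.

Lemma D_add X psi a : linear X -> linear psi ->
  D (fun a => X a + psi a) a = D X a + D psi a.
Proof.
move=> lX lp; have lS := linear_add lX lp; move: a.
apply: (linear_eq (linear_D theta lS) (linear_add (linear_D theta lX) (linear_D theta lp))).
move=> s a ha.
by rewrite (D_bhom theta lS ha) (linD (linear_T theta _)) -!(D_bhom theta _ ha).
Qed.

Lemma D_combination (b : 'I_2 -> A) (c : weight -> A) a :
  (forall j, OS4 (b j)) -> (forall r, r \in Gamma -> OS4 (c r)) ->
  D (fun a => \sum_(j < 2) b j * K j a + \sum_(r <- Gamma) c r * W r a) a =
  \sum_(j < 2) tscale theta (b j) (tK theta j) a +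
  \sum_(r <- Gamma) tscale theta (T r (c r)) (tW theta r) a.
Proof.
move=> hb hc.
have lK j : linear (@K R j) by have [[]] := K_gauge R j.
have lW r : linear (@W R r) by have [[]] := W_gaugeT r.
have lbK j := linear_mull (b j) (lK j); have lcW r := linear_mull (c r) (lW r).
rewrite (D_add _ (@linear_sum R _ _ xpredT _ lbK) (@linear_sum R _ Gamma xpredT _ lcW)) (D_sum _ _ lbK) (D_sum _ _ lcW).
congr (_ + _).
  apply: eq_bigr => j _; have [_ wK _] := K_gauge R j.
  by rewrite (D_mull theta a (lK j) wK (OS4_rhom (hb j))) T0.
apply: eq_big_seq => r hr; have [_ wW _] := W_gaugeT r.
exact: (D_mull theta a (lW r) wW (OS4_rhom (hc r hr))).
Qed.

Lemma autP psi :
  aut theta psi <->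
  exists (b : 'I_2 -> A) (c : weight -> A),
    [/\ forall j, OS4 (b j),
        forall r, r \in Gamma -> OS4 (c r)
      & forall a, psi a =
          \sum_(j < 2) tscale theta (b j) (tK theta j) a +
          \sum_(r <- Gamma) tscale theta (c r) (tW theta r) a].
Proof.
split=> [/aut_inv[X [gX vX] psiE]|[b [c [hb hc psiE]]]].
  have [b [c [hb hc XE]]] := gauge_span gX vX.
  exists b, (fun r => T r (c r)); split => // [r _|a]; first exact: OS4_ldg.
  by rewrite psiE (funext XE) D_combination.
(* Undoes the [T r] that [D] puts on the coefficient of W_r; the K_j have weight 0 and keep their
   coefficients. *)
pose c' r := T (- r) (c r).
have hc' r : r \in Gamma -> OS4 (c' r) by move=> /hc; exact: OS4_ldg.
pose X a := \sum_(j < 2) b j * K j a + \sum_(r <- Gamma) c' r * W r a.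
have [gX vX] := gauge_span_conv (X := X) hb hc' (fun=> erefl).
have -> : psi = D X.
  apply/funext => a; rewrite psiE D_combination //; congr (_ + _).
  by apply: eq_bigr => r _; rewrite /c' TVK.
exact: aut_D.
Qed.
End PartOne.

(** * The braided bracket *)

Section Bracket.
Variables (R : realType) (theta : R).
Local Notation C := R[i].
Local Notation A := (A R).
Local Notation ph := (phase theta).
Local Notation tmul := (tmul theta).
Local Notation tscale := (tscale theta).
Local Notation D := (D theta).
Local Notation T := (T theta).
Local Notation brk := (brk theta).
Local Notation Ract := (Ract theta).
Implicit Types (a b x y : A) (X Y psi lam : A -> A) (p q r w : weight) (s t : biweight).

Lemma wsum_comb k (F G : weight -> A -> A) a :
  wsum (fun p y => k *: F p y + G p y) a = k *: wsum F a + wsum G a.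
Proof. by rewrite /wsum big_split scaler_sumr. Qed.

Lemma linear_comb k X Y : linear X -> linear Y -> linear (fun a => k *: X a + Y a).
Proof. by move=> lX lY; exact: (linear_add (linear_scale k lX) lY). Qed.

Lemma wact_comb f k X Y a : linear X -> linear Y ->
  wact f (fun a => k *: X a + Y a) a = k *: wact f X a + wact f Y a.
Proof.
move=> lX lY; rewrite -wsum_comb /wact; congr (wsum _ a).
apply/funext => m; apply/funext => x.
by rewrite [LHS](linear_ldg (fun p => f (p - m))).
Qed.

Let H lam m p y := wact (fun q => ph (-2 * wedge (p - m) q)) lam y.
Let G psi lam m x := wsum (H lam m) (psi x).

Let lH lam m : linear lam -> forall p, linear (H lam m p).
Proof. by move=> ll p; exact: linear_wact. Qed.

Let lG psi lam : linear psi -> linear lam -> forall m, linear (G psi lam m).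
Proof. by move=> lp ll m; exact: (linear_comp (linear_wsum (lH m ll)) lp). Qed.

Lemma linear_brk psi lam : linear psi -> linear lam -> linear (brk psi lam).
Proof.
move=> lp ll; exact: (linear_add (linear_comp lp ll) (linear_opp (linear_wsum (lG lp ll)))).
Qed.

Lemma brk_weight r q psi lam s a : linear psi -> linear lam ->
  has_weight r psi -> has_weight q lam -> bhom s a ->
  brk psi lam a = psi (lam a) - ph (-2 * wedge r q) *: lam (psi a).
Proof.
move=> lp ll hp hl ha; rewrite /brk; congr (_ - _).
rewrite [LHS](wsum_lhom (lG lp ll) ha) /G (wsum_lhom (lH _ ll) (hp _ _ ha)) /=.
by rewrite /H (wact_weight _ ll hl (hp _ _ ha)) /= [s.1 + r]addrC addrK.
Qed.

Lemma brk_comb_l k psi1 psi2 lam a : linear psi1 -> linear psi2 -> linear lam ->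
  brk (fun a => k *: psi1 a + psi2 a) lam a = k *: brk psi1 lam a + brk psi2 lam a.
Proof.
move=> l1 l2 ll; rewrite /brk scalerBr addrACA -opprD; congr (_ - _).
rewrite -wsum_comb; congr (wsum _ a); apply/funext => m; apply/funext => x.
exact: (linear_wsum (lH m ll)).
Qed.

Lemma brk_comb_r k psi lam1 lam2 a : linear psi -> linear lam1 -> linear lam2 ->
  brk psi (fun a => k *: lam1 a + lam2 a) a = k *: brk psi lam1 a + brk psi lam2 a.
Proof.
move=> lp l1 l2; rewrite /brk lp scalerBr addrACA -opprD; congr (_ - _).
rewrite -wsum_comb; congr (wsum _ a); apply/funext => m; apply/funext => x.
rewrite -wsum_comb; congr (wsum _ (psi x)); apply/funext => p; apply/funext => y.
exact: wact_comb.
Qed.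

(** On left weight s the compositions of [D X] and [D Y] in the two orders carry the exponents - r∧q
    - (r + q)∧s and r∧q - (r + q)∧s. The factor - 2 r∧q of the R-matrix makes the second equal to
    the first. *)
Lemma brk_D r q X Y a : linear X -> linear Y -> has_weight r X -> has_weight q Y ->
  brk (D X) (D Y) a = ph (- wedge r q) *: D (comm X Y) a.
Proof.
move=> lX lY hX hY.
have lXY : linear (comm X Y).
  exact: (linear_add (linear_comp lX lY) (linear_opp (linear_comp lY lX))).
have hXY : has_weight (r + q) (comm X Y).
  move=> s b hb; apply: GradedD; last apply: GradedN.
    by have := hX _ _ (hY _ _ hb); rewrite /= addrAC addrA.
  by have := hY _ _ (hX _ _ hb); rewrite /= addrA.
have [lDX lDY] := (linear_D theta lX, linear_D theta lY).
move: a; apply: (linear_eq (linear_brk lDX lDY) (linear_scale _ (linear_D theta lXY))) => s a ha.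
rewrite (brk_weight lDX lDY (has_weight_D theta lX hX) (has_weight_D theta lY hY) ha).
rewrite (D_weight theta lXY hXY ha) (D_weight theta lX hX ha) (D_weight theta lY hY ha).
rewrite (linZ lDX) (linZ lDY).
rewrite (D_weight theta lX hX (hY _ _ ha)) (D_weight theta lY hY (hX _ _ ha)).
rewrite /comm !scalerBr !scalerA -!phaseD; congr (ph _ *: _ - ph _ *: _).
  by rewrite /= !wedgeE; ring.
by rewrite /= !wedgeE [wedge q r]wedgeC; ring.
Qed.

(** Linearity is carried along with [P], because the bracket is bilinear only on linear maps. *)
Lemma span_ind (P : (A -> A) -> Prop) :
  (forall k X Y, linear X -> linear Y -> P X -> P Y -> P (fun a => k *: X a + Y a)) ->
  (forall r Y, gauge_generator r Y -> P (D Y)) ->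
  forall X, in_span theta X -> linear X /\ P X.
Proof.
move=> Pc PD X [k [w XE]]; pose Q Y := linear Y /\ P Y.
have QD r Y : gauge_generator r Y -> Q (D Y).
  by move=> gY; split; [have [[lY _ _] _ _] := gY; exact: linear_D | exact: PD gY].
have Qc c Y Z : Q Y -> Q Z -> Q (fun a => c *: Y a + Z a).
  by move=> [lY PY] [lZ PZ]; split; [exact: linear_comb | exact: Pc].
(* The only available operation is k X + Y, so 0 is obtained by cancelling a generator against
   itself. *)
have Q0 : Q (fun=> 0).
  have -> : (fun=> 0 : A) = (fun a => -1 *: tK theta ord0 a + tK theta ord0 a).
    by apply/funext => a; rewrite scaleN1r addNr.
  by apply: Qc; exact: (QD 0 _ (K_gauge R ord0)).
have Qsum (I : Type) (l : seq I) (u : I -> C) (F : I -> A -> A) Z :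
    (forall i, Q (F i)) -> Q Z -> Q (fun a => \sum_(i <- l) u i *: F i a + Z a).
  move=> QF QZ; elim: l => [|i l IH].
    have -> : (fun a => \sum_(i <- [::]) u i *: F i a + Z a) = Z.
      by apply/funext => a; rewrite big_nil add0r.
    exact: QZ.
  have -> : (fun a => \sum_(j <- i :: l) u j *: F j a + Z a) =
      (fun a => u i *: F i a + (\sum_(j <- l) u j *: F j a + Z a)).
    by apply/funext => a; rewrite big_cons addrA.
  exact: (Qc _ _ _ (QF i) IH).
have -> : X = (fun a => \sum_(j <- index_enum 'I_2) k j *: tK theta j a +
    (\sum_(r <- Gamma) w r *: tW theta r a + 0)).
  by apply/funext => a; rewrite XE addr0.
apply: (Qsum _ _ k (tK theta) (fun a => \sum_(r <- Gamma) w r *: tW theta r a + 0)).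
  by move=> j; exact: (QD 0 _ (K_gauge R j)).
apply: (Qsum _ Gamma w (tW theta) (fun=> 0)) => [r|]; last exact: Q0.
exact: (QD r _ (W_gaugeT R r)).
Qed.

End Bracket.

Section BracketModule.
Variables (R : realType) (theta : R).
Local Notation C := R[i].
Local Notation A := (A R).
Local Notation ph := (phase theta).
Local Notation tmul := (tmul theta).
Local Notation tscale := (tscale theta).
Local Notation D := (D theta).
Local Notation brk := (brk theta).
Local Notation Ract := (Ract theta).
Implicit Types (a b x y : A) (X Y psi lam : A -> A) (p q r w : weight) (s t : biweight).

Lemma linear_tscale b X : linear X -> linear (tscale b X).
Proof. by move=> lX; exact: (linear_comp (linear_tmulr theta b) lX). Qed.

Lemma linear_Ract p X : linear X -> linear (Ract p X).
Proof. exact: linear_wact. Qed.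

Lemma tmul_mul_bhom p s b a : bhom (p, 0) b -> bhom s a ->
  tmul b a = ph (- wedge p s.1) *: (b * a).
Proof. by move=> hb ha; rewrite (tmul_bhom theta hb ha) wedge0l phase0 mulr1. Qed.

Lemma tscale_weight p r b X : bhom (p, 0) b -> has_weight r X ->
  has_weight (p + r) (tscale b X).
Proof.
move=> hb hX s a ha; rewrite /tscale (tmul_mul_bhom hb (hX _ _ ha)); apply: GradedZ.
have := hom_mul hb (hX _ _ ha); apply: Graded_sub => t ->.
by congr pair; rewrite /= ?add0r // addrCA.
Qed.

(** This is where verticality enters the bracket: in the braided Leibniz rule on the product of e
    and Z' a the term with [D Z e] vanishes, and [D Z] merely moves past e at the cost of a braiding
    phase. *)
Lemma braided_tscale (u v z w : weight) d e (Z Z' : A -> A) s a :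
  bhom (u, 0) d -> bhom (v, 0) e -> OS4 e -> gauge_generator z Z -> has_weight w Z' ->
  bhom s a -> tscale d (D Z) (tscale e Z' a) =
    ph (-2 * wedge z v) *: tmul d (tmul e (D Z (Z' a))).
Proof.
move=> hd he Oe [[lZ dZ eZ] wZ vZ] wZ' ha.
have [[lDZ bDZ] _ vDZ] : aut theta (D Z) by apply: aut_D.
rewrite /tscale bDZ (vDZ e Oe) (lin0 (linear_tmull theta _)) add0r.
have lF (t : weight) : linear (fun x => tmul x (Ract t (D Z) (Z' a))) by exact: linear_tmull.
rewrite (wsum_lhom lF he) /=.
rewrite /Ract (wact_weight _ lDZ (has_weight_D theta lZ wZ) (wZ' _ _ ha)).
by rewrite !(linZ (linear_tmulr theta _)).
Qed.
Lemma brk_tscale_base p q r w b c X Y s a :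
  bhom (p, 0) b -> bhom (q, 0) c -> OS4 b -> OS4 c ->
  gauge_generator r X -> gauge_generator w Y -> bhom s a ->
  brk (tscale b (D X)) (tscale c (D Y)) a =
  tmul b (tmul c (brk (Ract q (D X)) (D Y) a)).
Proof.
move=> hb hc Ob Oc gX gY ha.
have [[lX _ _] wX vX] := gX; have [[lY _ _] wY vY] := gY.
have [lDX lDY] := (linear_D theta lX, linear_D theta lY).
have wDX := has_weight_D theta lX wX; have wDY := has_weight_D theta lY wY.
rewrite (brk_weight theta (linear_tscale b lDX) (linear_tscale c lDY)
  (tscale_weight hb wDX) (tscale_weight hc wDY) ha).
rewrite (braided_tscale hb hc Oc gX wDY ha) (braided_tscale hc hb Ob gY wDX ha).
have wRX : has_weight r (Ract q (D X)).
  by move=> t y hy; rewrite /Ract (wact_weight _ lDX wDX hy); apply: GradedZ; exact: wDX.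
rewrite (brk_weight theta (linear_Ract q lDX) lDY wRX wDY ha).
have RE t y : bhom t y -> Ract q (D X) y = ph (-2 * wedge r q) *: D X y.
  by move=> hy; exact: (wact_weight _ lDX wDX hy).
rewrite (RE _ _ (wDY _ _ ha)) (RE _ _ ha) (linZ lDY).
rewrite !(linB (linear_tmulr theta _)) !(linZ (linear_tmulr theta _)).
congr (_ - _); rewrite !scalerA.
(* In the subtracted terms b and c multiply D Y (D X a) in opposite orders. All three are
   homogeneous, so both are multiples of the same classical product and only phases have to be
   compared. *)
have hz := wDY _ _ (wDX _ _ ha); move: (D Y (D X a)) hz => z hz.
have hbz := hom_mul hb hz; have hcz := hom_mul hc hz.
rewrite (tmul_mul_bhom hb hz) (tmul_mul_bhom hc hz) !(linZ (linear_tmulr theta _)).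
rewrite (tmul_mul_bhom hc hbz) (tmul_mul_bhom hb hcz) !scalerA [c * (b * z)]mulrCA.
rewrite -!phaseD; congr (ph _ *: _).
rewrite /= !wedgeE [wedge q p]wedgeC [wedge w p]wedgeC.
by ring.
Qed.

Let P b c X Y := forall a, brk (tscale b X) (tscale c Y) a =
  tmul b (wsum (fun p y => tmul y (brk (Ract p X) Y a)) c).

Let linear_F X Y a : forall p : weight, linear (fun y => tmul y (brk (Ract p X) Y a)).
Proof. by move=> p; exact: linear_tmull. Qed.

Let P_X b c Y k X1 X2 : linear X1 -> linear X2 -> linear Y ->
  P b c X1 Y -> P b c X2 Y -> P b c (fun a => k *: X1 a + X2 a) Y.
Proof.
move=> l1 l2 lY h1 h2 a.
have -> : tscale b (fun a => k *: X1 a + X2 a) = (fun a => k *: tscale b X1 a + tscale b X2 a).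
  by apply/funext => x; exact: linear_tmulr.
rewrite (brk_comb_l theta k a (linear_tscale b l1) (linear_tscale b l2) (linear_tscale c lY)).
rewrite h1 h2 -(linear_tmulr theta b) -wsum_comb; congr (tmul b (wsum _ c)).
apply/funext => p; apply/funext => y; rewrite -(linear_tmulr theta y); congr (tmul y _).
rewrite -(brk_comb_l theta k a (linear_Ract p l1) (linear_Ract p l2) lY); congr (brk _ Y a).
by apply/funext => x; rewrite [RHS]wact_comb.
Qed.

Let P_Y b c X k Y1 Y2 : linear X -> linear Y1 -> linear Y2 ->
  P b c X Y1 -> P b c X Y2 -> P b c X (fun a => k *: Y1 a + Y2 a).
Proof.
move=> lX l1 l2 h1 h2 a.
have -> : tscale c (fun a => k *: Y1 a + Y2 a) = (fun a => k *: tscale c Y1 a + tscale c Y2 a).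
  by apply/funext => x; exact: linear_tmulr.
rewrite (brk_comb_r theta k a (linear_tscale b lX) (linear_tscale c l1) (linear_tscale c l2)).
rewrite h1 h2 -(linear_tmulr theta b) -wsum_comb; congr (tmul b (wsum _ c)).
apply/funext => p; apply/funext => y; rewrite -(linear_tmulr theta y); congr (tmul y _).
by rewrite (brk_comb_r theta k a (linear_Ract p lX) l1 l2).
Qed.

Lemma brk_tscale b c X Y : OS4 b -> OS4 c -> in_span theta X -> in_span theta Y ->
  forall a, brk (tscale b X) (tscale c Y) a =
    tmul b (wsum (fun p y => tmul y (brk (Ract p X) Y a)) c).
Proof.
move=> Ob Oc hX hY.
suff : linear X /\ P b c X Y by case.
apply: (@span_ind R theta (fun X => P b c X Y) _ _ X hX) => [k X1 X2 l1 l2|r X0 gX].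
  (* The trivial predicate extracts the linearity of [Y] from its membership in the span. *)
  by have [lY _] := @span_ind R theta (fun=> True) (fun _ _ _ _ _ _ _ => I) (fun _ _ _ => I) Y hY;
    exact: P_X.
have lX : linear (D X0) by have [[l _ _] _ _] := gX; exact: linear_D.
suff : linear Y /\ P b c (D X0) Y by case.
apply: (@span_ind R theta (fun Y => P b c (D X0) Y) _ _ Y hY) => [k Y1 Y2 l1 l2|w Y0 gY]; first exact: P_Y.
have lY : linear (D Y0) by have [[l _ _] _ _] := gY; exact: linear_D.
(* The identity is also additive in c and b and linear in a, which reduces it to homogeneous
   elements. *)
move=> a; move: b c Ob Oc.
suff H : forall c, OS4 c -> forall b, OS4 b -> brk (tscale b (D X0)) (tscale c (D Y0)) a =
    tmul b (wsum (fun p y => tmul y (brk (Ract p (D X0)) (D Y0) a)) c).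
  by move=> b c Ob Oc; exact: H.
have lw := linear_wsum (linear_F (D X0) (D Y0) a).
apply: OS4_ind => [c1 c2 h1 h2 b Ob|q c Oc hc].
  have -> : tscale (c1 + c2) (D Y0) = (fun a => 1 *: tscale c1 (D Y0) a + tscale c2 (D Y0) a).
    by apply/funext => x; rewrite scale1r; exact: (linD (linear_tmull theta _)).
  rewrite (brk_comb_r theta 1 a (linear_tscale b lX) (linear_tscale c1 lY) (linear_tscale c2 lY)).
  by rewrite h1 // h2 // scale1r (linD lw) (linD (linear_tmulr theta b)).
apply: OS4_ind => [b1 b2 h1 h2|p b Ob hb].
  have -> : tscale (b1 + b2) (D X0) = (fun a => 1 *: tscale b1 (D X0) a + tscale b2 (D X0) a).
    by apply/funext => x; rewrite scale1r; exact: (linD (linear_tmull theta _)).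
  rewrite (brk_comb_l theta 1 a (linear_tscale b1 lX) (linear_tscale b2 lX) (linear_tscale c lY)).
  by rewrite h1 h2 scale1r (linD (linear_tmull theta _)).
rewrite (wsum_lhom (linear_F (D X0) (D Y0) a) hc) /=; move: a {lw}.
apply: (linear_eq (linear_brk theta (linear_tscale b lX) (linear_tscale c lY))
  (linear_comp (linear_tmulr theta b) (linear_comp (linear_tmulr theta c)
     (linear_brk theta (linear_Ract q lX) lY)))) => s a ha.
exact: (brk_tscale_base hb hc Ob Oc gX gY ha).
Qed.

End BracketModule.

Theorem proposition4p14 (R : realType) (theta : R) :
  (forall psi : A R -> A R,
     aut theta psi <->
     exists (b : 'I_2 -> A R) (c : weight -> A R),
       [/\ forall j, OS4 (b j),
           forall r, r \in Gamma -> OS4 (c r)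
         & forall a, psi a =
             \sum_(j < 2) tscale theta (b j) (tK theta j) a +
             \sum_(r <- Gamma) tscale theta (c r) (tW theta r) a])
  /\
  [/\ forall a, brk theta (tK theta ord0) (tK theta ord_max) a =
        D theta (comm (K ord0) (K ord_max)) a,
      forall (j : 'I_2) (r : weight), r \in Gamma -> forall a,
        brk theta (tK theta j) (tW theta r) a =
        D theta (comm (K j) (W r)) a
    & forall r s : weight, r \in Gamma -> s \in Gamma -> forall a,
        brk theta (tW theta r) (tW theta s) a =
        phase theta (- wedge r s) *: D theta (comm (W r) (W s)) a]
  /\
  (forall (b b' : A R) (X X' : A R -> A R),
     OS4 b -> OS4 b' -> in_span theta X -> in_span theta X' ->
     forall a,
       brk theta (tscale theta b X) (tscale theta b' X') a =
       tscale theta b (fun a1 =>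
         wsum (fun s b'_s =>
           tscale theta b'_s (brk theta (Ract theta s X) X') a1) b') a).
Proof.
have bracket r s X Y : gauge_generator r X -> gauge_generator s Y -> forall a,
    brk theta (D theta X) (D theta Y) a = phase theta (- wedge r s) *: D theta (comm X Y) a.
  by move=> [[lX _ _] wX _] [[lY _ _] wY _] a; exact: brk_D.
split; first exact: autP.
split; last exact: brk_tscale.
split=> [a|j r hr a|r s hr hs a].
- by rewrite (bracket _ _ _ _ (K_gauge R _) (K_gauge R _)) wedge0l oppr0 phase0 scale1r.
- by rewrite (bracket _ _ _ _ (K_gauge R _) (W_gauge R hr)) wedge0l oppr0 phase0 scale1r.
exact: bracket (W_gauge R hr) (W_gauge R hs) a.
Qed.
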